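(* There exist positive constants $C_X$ and $c_X$ such that, for every real $\kappa\ge 1$, $$ c_X\left(\frac{\ln(1+\kappa)}{\kappa}\right)^{1/2}\le \mathrm{d}_{w}(\mu_{\kappa},\mu_0)\le C_X\left(\frac{\ln(1+\kappa)}{\kappa}\right)^{1/2}, $$ where $\mu_0$ and $\mu_\kappa$ are the measures on $\mathcal{C}_{(0)}$ generated by a standard Brownian motion $W$ and by the process $W^\kappa(t)=\kappa^{-1/2}\int_0^{\kappa t}X(s)\,ds$, $t\ge 0$, respectively.
   Context: $X=X(t)$, $t\in\mathbb{R}$, is a continuous version of a stationary Gaussian process with mean zero and covariance $\mathbb{E}X(t)X(s)=e^{-2|t-s|}$. $W=W(t)$, $t\ge 0$, is a standard Brownian motion. $\mathcal{C}_{(0)}$ is the set of continuous functions $f:[0,+\infty)\to\mathbb{R}$ with $f(0)=0$ and $\lim_{t\to+\infty}|f(t)|/t=0$, equipped with the norm $\|f\|_{(0)}=\sup_{t>0}\frac{|f(t)|}{1+t}$; it is a separable Banach space. With probability one, $W\in\mathcal{C}_{(0)}$ and $W^\kappa\in\mathcal{C}_{(0)}$ for each $\kappa\ge1$. The measure generated by a process is its law on the Borel sigma-algebra of $\mathcal{C}_{(0)}$. For probability measures $\mu,\nu$ on the Borel sigma-algebra of a complete separable metric space $(E,\rho)$, the Wasserstein-1 (Kantorovich-Rubinstein) metric is $\mathrm{d}_{w}(\mu,\nu)=\sup_\varphi\left|\int_E\varphi\,d\mu-\int_E\varphi\,d\nu\right|$, the supremum being over all $\varphi:E\to\mathbb{R}$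 with $|\varphi(x)-\varphi(y)|\le\rho(x,y)$ for all $x,y\in E$. Here $E=\mathcal{C}_{(0)}$ and $\rho(f,g)=\|f-g\|_{(0)}$. *)

(* Defs.v *)
From HB Require Import structures.
From mathcomp Require Import all_boot all_order all_algebra.
From mathcomp Require Import all_classical all_reals all_analysis measurable_realfun.
Set Implicit Arguments.
Unset Strict Implicit.
Unset Printing Implicit Defensive.
Import Order.TTheory GRing.Theory Num.Theory.
Import numFieldNormedType.Exports.
Local Open Scope classical_set_scope.
Local Open Scope ring_scope.

(* An element of C_(0) is encoded by its extension by 0 to the negative half-line,
   which is continuous since f 0 = 0. *)
Definition c0_pred (R : realType) : {pred R -> R} := fun f =>
  `[< [/\ continuous f, (forall t, t <= 0 -> f t = 0)
      & `|f t| / t @[t --> +oo] --> (0 : R)] >].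

Arguments c0_pred : clear implicits.

Record C0 (R : realType) := MkC0 { c0_fun :> R -> R ; _ : c0_fun \in c0_pred R }.

HB.instance Definition _ (R : realType) := [isSub for @c0_fun R].
HB.instance Definition _ (R : realType) := [Choice of C0 R by <:].

Section C0_vector_space.
Variable R : realType.

Lemma c0_predP (f : R -> R) : reflect
  [/\ continuous f, (forall t, t <= 0 -> f t = 0)
      & `|f t| / t @[t --> +oo] --> (0 : R)] (f \in c0_pred R).
Proof. exact: asboolP. Qed.

Lemma c0_pred_submod_closed : submod_closed (c0_pred R).
Proof.
split.
  apply/c0_predP; split => //; first exact: cst_continuous.
  under eq_fun do rewrite /= normr0 mul0r.
  exact: cvg_cst.
move=> a f g /c0_predP[cf f0 lf] /c0_predP[cg g0 lg].
apply/c0_predP; split.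
- move=> x; apply: (@continuousD _ _ _ (a *: f) g x); last exact: cg.
  by apply: continuousM; [exact: cst_continuous|exact: cf].
- by move=> t t0; rewrite [LHS](_ : _ = a * f t + g t)// f0// g0// mulr0 addr0.
- apply: (@squeeze_cvgr _ _ _ _ (cst 0) (fun t => `|a| * (`|f t| / t) + `|g t| / t)).
  + near=> t; have t0 : 0 < t by near: t; exact: nbhs_pinfty_gt.
    rewrite divr_ge0 ?(ltW t0)//= mulrA -mulrDl ler_pM2r ?invr_gt0//.
    by rewrite (le_trans (ler_normD _ _))// lerD2r -normrM.
  + exact: cvg_cst.
  + rewrite -[X in _ --> X](addr0 0) -{1}(mulr0 `|a|).
    by apply: cvgD => //; apply: cvgMr.
Unshelve. all: by end_near.
Qed.

HB.instance Definition _ :=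
  GRing.isSubmodClosed.Build R (R -> R) (c0_pred R) c0_pred_submod_closed.
HB.instance Definition _ := [SubChoice_isSubLmodule of C0 R by <:].

End C0_vector_space.

Section C0_norm.
Variable R : realType.
Implicit Types f g : C0 R.

Definition c0_norm f : R := sup [set `|f t| / (1 + t) | t in [set t | 0 < t]].

Lemma C0_continuous f : continuous f.
Proof. by have /c0_predP[] := valP f. Qed.

Lemma C0_neg f t : t <= 0 -> f t = 0.
Proof. by have /c0_predP[_ f0 _] := valP f; exact: f0. Qed.

Lemma C0_tail f e : 0 < e ->
  exists2 N : nat, (0 < N)%N & forall t, N%:R <= t -> `|f t| <= e * t.
Proof.
move=> e0; have /c0_predP[_ _ lf] := valP f.
have /cvgrPdist_le/(_ _ e0)[M [Mr MP]] := lf.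
have M0 : 0 <= Num.max 0 M by rewrite le_max lexx.
exists (Num.truncn (Num.max 0 M)).+1 => // t Mt.
have tM : Num.max 0 M < t by rewrite (lt_le_trans _ Mt)//= truncnS_gt.
have t0 : 0 < t by rewrite (le_lt_trans M0).
have /MP : M < t by rewrite (le_lt_trans _ tM)// le_max lexx orbT.
by rewrite sub0r normrN ger0_norm ?divr_ge0 ?(ltW t0)//= ler_pdivrMr.
Qed.

Lemma c0_norm_has_sup f : has_sup [set `|f t| / (1 + t) | t in [set t | 0 < t]].
Proof.
split; first by exists (`|f 1| / (1 + 1)); exists 1 => //=; exact: ltr01.
have [N N0 NP] := C0_tail f ltr01.
have cf : {within `[0, N%:R : R], continuous (fun t => `|f t|)}.
  apply: continuous_subspaceT => x.
  by apply: (@continuous_comp _ _ _ f Num.norm); [exact: C0_continuous|exact: norm_continuous].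
have [|c _ cP] := EVT_max _ cf; first by rewrite ler0n.
exists (1 + `|f c|) => _ [t /= t0 <-].
have t1 : 0 < 1 + t by rewrite addr_gt0.
rewrite ler_pdivrMr//; have [tN|/ltW/NP] := leP t N%:R.
  rewrite (le_trans (cP t _)) ?in_itv/= ?(ltW t0)//.
  by rewrite (@le_trans _ _ (1 + `|f c|)) ?lerDr// ler_peMr ?lerDl ?(ltW t0)// addr_ge0.
rewrite mul1r => /le_trans; apply; rewrite (@le_trans _ _ (1 + t)) ?lerDr//.
by rewrite ler_peMl ?lerDl// ltW.
Qed.

Lemma c0_norm_ub f t : `|f t| <= c0_norm f * (1 + `|t|).
Proof.
have [t0|t0] := leP t 0.
  rewrite C0_neg// normr0 mulr_ge0 ?addr_ge0//.
  apply: le_trans (ub_le_sup (c0_norm_has_sup f).2 _); last by exists 1 => //=.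
  by rewrite divr_ge0 ?addr_ge0.
rewrite (gtr0_norm t0) -ler_pdivrMr ?addr_gt0//.
by apply: ub_le_sup; [exact: (c0_norm_has_sup f).2|exists t].
Qed.

Lemma c0_norm_le f M :
  (forall t, 0 < t -> `|f t| <= M * (1 + t)) -> c0_norm f <= M.
Proof.
move=> fM; apply: ge_sup; first exact: (c0_norm_has_sup f).1.
by move=> _ [t /= t0 <-]; rewrite ler_pdivrMr ?fM// addr_gt0.
Qed.

Lemma c0_normD f g : c0_norm (f + g) <= c0_norm f + c0_norm g.
Proof.
apply: c0_norm_le => t t0; rewrite mulrDl (le_trans (ler_normD _ _))//.
by rewrite lerD// -{2}(gtr0_norm t0) c0_norm_ub.
Qed.

Lemma c0_normZ_le a f : c0_norm (a *: f) <= `|a| * c0_norm f.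
Proof.
apply: c0_norm_le => t t0; rewrite normrM -mulrA ler_wpM2l//.
by rewrite -{2}(gtr0_norm t0) c0_norm_ub.
Qed.

Lemma c0_normZ a f : c0_norm (a *: f) = `|a| * c0_norm f.
Proof.
apply/eqP; rewrite eq_le c0_normZ_le/=; have [->|a0] := eqVneq a 0.
  rewrite normr0 mul0r; apply: le_trans (ub_le_sup (c0_norm_has_sup _).2 _).
    2: by exists 1 => //=.
  by rewrite divr_ge0 ?addr_ge0.
rewrite -ler_pdivlMl ?normr_gt0// -normfV -{1}(scale1r f) -(mulVf a0) -scalerA.
exact: c0_normZ_le.
Qed.

Lemma c0_norm_eq0 f : c0_norm f = 0 -> f = 0.
Proof.
move=> f0; apply/val_inj/funext => t /=; apply/eqP; rewrite -normr_le0.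
by rewrite (le_trans (c0_norm_ub f t))// f0 mul0r.
Qed.

HB.instance Definition _ :=
  @Lmodule_isNormed.Build R (C0 R) c0_norm c0_normD c0_normZ c0_norm_eq0.

End C0_norm.

Notation borel E := (g_sigma_algebraType (@open E)).

Section C0_separable.
Variable R : realType.
Implicit Types f g : C0 R.

(* The graph of f over [0, N] is followed up to 1/(m+1) by a step function of mesh
   1/(n+1) with rational values s. *)
Definition followed f (i : nat * nat * nat * seq rat) :=
  let: (m, n, N, s) := i in
  (forall t, 0 <= t <= N%:R ->
     `|f t - ratr s`_(Num.truncn (t * n.+1%:R))| <= m.+1%:R^-1) /\
  (forall t, N%:R <= t -> `|f t| <= m.+1%:R^-1 * t).

Lemma followed_dist f g i :
  followed f i -> followed g i -> `|f - g| <= 2 * i.1.1.1.+1%:R^-1.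
Proof.
case: i => [[[m n] N] s] /= [f1 f2] [g1 g2].
have m0 : 0 <= m.+1%:R^-1 :> R by rewrite invr_ge0.
apply: c0_norm_le => t t0; rewrite mulrDr mulr1.
have [tN|/ltW tN] := leP t N%:R.
  have tN' : 0 <= t <= N%:R by rewrite ltW.
  rewrite (@le_trans _ _ (2 * m.+1%:R^-1))//; last first.
    by rewrite lerDl mulr_ge0 ?mulr_ge0 ?(ltW t0).
  rewrite [leLHS](_ : _ = `|(f t - ratr s`_(Num.truncn (t * n.+1%:R)))
    - (g t - ratr s`_(Num.truncn (t * n.+1%:R)))|); last by rewrite opprB addrA subrK.
  by rewrite (le_trans (ler_normB _ _))// mulr_natl mulr2n lerD ?f1 ?g1.
rewrite [leLHS](_ : _ = `|f t - g t|)// (le_trans (ler_normB _ _))//.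
rewrite (@le_trans _ _ (2 * m.+1%:R^-1 * t)) ?lerDr ?mulr_ge0//.
by rewrite mulr_natl mulr2n mulrDl lerD ?f2 ?g2.
Qed.

Lemma unif_cont f (N : nat) (e : R) : 0 < e ->
  exists n : nat, forall t s, 0 <= t <= N%:R -> `|t - s| <= n.+1%:R^-1 ->
    `|f t - f s| <= e.
Proof.
move=> e0.
have /compact_near_coveringP/(_ nat \oo
   (fun n t => forall s, `|t - s| <= n.+1%:R^-1 -> `|f t - f s| <= e)) :=
  @segment_compact R 0 N%:R.
have H : forall x : R, `[0, N%:R]%classic x -> \forall x' \near x & i \near \oo,
    (forall s, `|x' - s| <= i.+1%:R^-1 -> `|f x' - f s| <= e).
  move=> x _.
  have e2 : 0 < e / 2 by rewrite divr_gt0.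
  have /cvgrPdist_le/(_ _ e2) := @C0_continuous R f x.
  move=> /nbhs_ballP[d /= d0 dP].
  have d2 : 0 < d / 2 by rewrite divr_gt0.
  near=> x' i => s x's.
  have xx' : `|x - x'| < d / 2.
    by near: x'; exact: (@nbhsx_ballx _ _ x _ d2).
  have id : i.+1%:R^-1 < d / 2.
    near: i; have [k _ kP] := near_infty_natSinv_lt (PosNum d2).
    by exists k => // i /= /kP.
  have xs : `|x - s| < d.
    by rewrite (splitr d) (le_lt_trans (ler_distD x' _ _))// ltrD// (le_lt_trans x's).
  have /dP/= h1 : ball x d x' by rewrite /ball/= (lt_trans xx')// ltr_pdivrMr// ltr_pMr ?ltr1n.
  have /dP/= h2 : ball x d s by [].
  by rewrite (splitr e) (le_trans (ler_distD (f x) _ _))// lerD// distrC.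
move=> /(_ _ H)[n _ nP]; exists n => t s tN ts.
by apply: (nP n) => //=; rewrite in_itv.
Unshelve. all: by end_near.
Qed.

Lemma ex_followed f m : exists n N s, followed f (m, n, N, s).
Proof.
have m0 : 0 < m.+1%:R^-1 :> R by rewrite invr_gt0.
have [N _ NP] := C0_tail f m0.
have m2 : 0 < m.+1%:R^-1 / 2 :> R by rewrite divr_gt0.
have [n nP] := unif_cont f N m2.
have /choice[q qP] : forall k : nat, exists q : rat,
    `|f (k%:R / n.+1%:R) - ratr q| <= m.+1%:R^-1 / 2.
  move=> k; have : f (k%:R / n.+1%:R) < f (k%:R / n.+1%:R) + m.+1%:R^-1 / 2.
    by rewrite ltrDl.
  move=> /rat_in_itvoo[q /itvP h]; exists q; rewrite distrC ler_distl; apply/andP; split.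
    by rewrite lerBlDr (@le_trans _ _ (ratr q)) ?h// lerDl ltW.
  by rewrite h.
exists n, N, (mkseq q (N * n.+1).+1); split => //= t /andP[t0 tN].
set k := Num.truncn _.
have /andP[kl ku] : k%:R <= t * n.+1%:R < k.+1%:R.
  by rewrite truncn_itv// mulr_ge0.
have kN : (k < (N * n.+1).+1)%N.
  by rewrite ltnS -(@ler_nat R) (le_trans kl)// natrM ler_wpM2r.
rewrite nth_mkseq// (splitr m.+1%:R^-1) (le_trans (ler_distD (f (k%:R / n.+1%:R)) _ _))//.
rewrite lerD// nP ?t0// ger0_norm ?subr_ge0 ?ler_pdivrMr//.
rewrite lerBlDr -[X in X + _]div1r -mulrDl ler_pdivlMr// (le_trans (ltW ku))//.
by rewrite -natr1 addrC.
Qed.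

Lemma C0_separable : exists g : nat -> C0 R,
  forall f e, 0 < e -> exists n, `|f - g n| <= e.
Proof.
have /choice[g gP] : forall i, exists g, forall f, followed f i -> followed g i.
  move=> i; have [[g gi]|h] := pselect (exists g, followed g i).
    by exists g.
  by exists 0 => f fi; exfalso; apply: h; exists f.
exists (fun n => if unpickle n is Some i then g i else 0) => f e e0.
have e2 : 0 < e / 2 by rewrite divr_gt0.
have [m _ mP] := near_infty_natSinv_lt (PosNum e2).
have [n [N [s fi]]] := ex_followed f m.
exists (pickle (m, n, N, s)); rewrite pickleK.
rewrite (le_trans (followed_dist fi (gP _ _ fi)))//=.
rewrite mulrC -ler_pdivlMr//; apply: ltW; exact: (mP m (leqnn m)).
Qed.

End C0_separable.

Section processes.
Context d (T : measurableType d) (R : realType).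
Implicit Types (Y X : R -> T -> R).

Definition continuous_process (D : set R) Y :=
  (forall t, D t -> measurable_fun setT (Y t)) /\
  (forall w, {within D, continuous (Y^~ w)}).

(* The path t |-> Y t w on [0, +oo[ as a point of C_(0); the (null) event that it is
   not in C_(0) is sent to 0. *)
Definition c0_path Y (w : T) : C0 R :=
  insubd 0 (fun t => if 0 <= t then Y t w else 0).

Lemma ext_le0 (h : R -> R) (a : R) : 0 <= a ->
  {within `[0, +oo[, continuous h} ->
  (forall q : rat, a < ratr q -> h (ratr q) <= 0) -> forall t, a < t -> h t <= 0.
Proof.
move=> a0 /continuous_within_itvcyP[ch _] hq t at_; rewrite leNgt; apply/negP => ht.
have /ch/cvgrPdist_lt/(_ _ ht) : t \in `]0, +oo[.
  by rewrite in_itv/= andbT (le_lt_trans a0).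
move=> /nbhs_ballP[e /= e0 eP].
have : Num.max a (t - e) < t by rewrite gt_max at_ gtrBl.
move=> /rat_in_itvoo[q]; rewrite in_itv/= gt_max => /andP[/andP[aq eq] qt].
have /eP/= : ball t e (ratr q : R).
  by rewrite /ball/= ger0_norm ?subr_ge0 ?(ltW qt)// ltrBlDr addrC -ltrBlDr.
have := hq _ aq; move=> hq0; rewrite ger0_norm.
  by rewrite ltrBlDr ltrDl ltNge hq0.
by rewrite subr_ge0 (le_trans hq0)// ltW.
Qed.

Lemma c0_path_predP Y w : {within `[0, +oo[, continuous (Y^~ w)} ->
  ((fun t => if 0 <= t then Y t w else 0) \in c0_pred R) <->
  Y 0 w = 0 /\ forall m, exists N, forall q : rat,
    N%:R < ratr q :> R -> `|Y (ratr q) w| - ratr q / m.+1%:R <= 0.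
Proof.
move=> cY; split.
  move=> H; split.
    by have /c0_predP[_ H0 _] := H; have := H0 _ (lexx 0); rewrite lexx.
  move=> m; have m0 : 0 < m.+1%:R^-1 :> R by rewrite invr_gt0.
  have [N N0 NP] := C0_tail (MkC0 H) m0; exists N => q Nq.
  have := NP _ (ltW Nq); rewrite /= (le_trans _ (ltW Nq))//.
  by rewrite subr_le0 mulrC.
move=> [Y0 Ym]; apply/c0_predP.
have /continuous_within_itvcyP[cY1 cY0] := cY.
split.
- move=> t; have [t0|t0|<-] := ltgtP 0 t.
  + rewrite /continuous_at (ltW t0); have := cY1 t; rewrite in_itv/= t0 => /(_ isT).
    apply: cvg_trans; apply: near_eq_cvg; near=> s.
    by rewrite ifT// ltW//; near: s; exact: lt_nbhsr.
  + rewrite /continuous_at leNgt t0/=; apply: cvg_near_cst; near=> s.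
    by rewrite ifF//; apply/negbTE; rewrite -ltNge; near: s; exact: lt_nbhsl.
  + apply/left_right_continuousP; rewrite lexx; split.
      rewrite Y0; apply: cvg_near_cst; near=> s.
      by rewrite ifF//; apply/negbTE; rewrite -ltNge.
    move: cY0; apply: cvg_trans; apply: near_eq_cvg; near=> s.
    by rewrite ifT// ltW.
- by move=> t; rewrite le_eqVlt => /predU1P[->|t0]; rewrite ?lexx// leNgt t0.
- apply/cvgrPdist_le => e e0.
  have [m _ mP] := near_infty_natSinv_lt (PosNum e0).
  have [N NP] := Ym m; near=> t.
  have Nt : N%:R < t by near: t; exact: nbhs_pinfty_gt.
  have t0 : 0 < t by rewrite (le_lt_trans _ Nt).
  rewrite sub0r normrN ger0_norm ?divr_ge0 ?(ltW t0)//= ler_pdivrMr//.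
  have : `|Y t w| - t / m.+1%:R <= 0.
    apply: (@ext_le0 (fun t => `|Y t w| - t / m.+1%:R) N%:R) => //.
    have cl : {within `[0, +oo[, continuous (fun t : R => t / m.+1%:R)}.
      by apply: continuous_subspaceT => x; apply: cvgM; [exact: cvg_id|exact: cvg_cst].
    by move=> x; apply: cvgB; [apply: cvg_norm; exact: cY|exact: cl].
  rewrite subr_le0 => /le_trans; apply; rewrite mulrC ler_wpM2r ?(ltW t0)//.
  by apply: ltW; exact: (mP m (leqnn m)).
Unshelve. all: by end_near.
Qed.

Lemma measurable_c0_path Y : continuous_process `[0, +oo[ Y ->
  measurable_fun setT (c0_path Y : T -> borel (C0 R)).
Proof.
move=> [mY cY].
pose ext w t := if 0 <= t then Y t w else 0.
pose G : set T := [set w | ext w \in c0_pred R].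
have mY' (t : R) : 0 <= t -> measurable_fun setT (Y t).
  by move=> t0; apply: mY; rewrite /= in_itv/= t0.
have mrat (P : rat -> T -> Prop) : (forall q, measurable [set w | P q w]) ->
    measurable [set w | forall q, P q w].
  move=> mP; rewrite [X in measurable X](_ : _ =
      \bigcap_n [set w | if unpickle n is Some q then P q w else True]).
    by apply: bigcapT_measurable => n; case: (unpickle n) => [q|]; [exact: mP|exact: measurableT].
  apply/seteqP; split => [w Pw n _ /=|w Pw q].
    by case: (unpickle n) => //.
  by have := Pw (pickle q) I; rewrite /= pickleK.
have GE : G = [set w | Y 0 w = 0] `&` \bigcap_m \bigcup_N
    [set w | forall q : rat, N%:R < ratr q :> R ->
       `|Y (ratr q) w| - ratr q / m.+1%:R <= 0].
  apply/seteqP; split => [w /(c0_path_predP (cY w))[Y0 Ym]|w [Y0 Ym]].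
    by split => // m _; have [N NP] := Ym m; exists N.
  apply/(c0_path_predP (cY w)); split => // m.
  by have [N _ NP] := Ym m I; exists N.
have mG : measurable G.
  rewrite GE; apply: measurableI.
    by rewrite -[X in measurable X]setTI; exact: (mY' 0 (lexx _) measurableT [set 0] (measurable_set1 _)).
  apply: bigcapT_measurable => m; apply: bigcupT_measurable => N.
  apply: mrat => q; have [qN|qN] := ltP N%:R (ratr q : R); last first.
    rewrite [X in measurable X](_ : _ = setT)//.
    by apply/seteqP; split => // w _ /=; rewrite ltNge qN.
  rewrite [X in measurable X](_ : _ =
      [set w | `|Y (ratr q) w| - ratr q / m.+1%:R <= 0]).
    rewrite -[X in measurable X]setTI; apply: measurable_fun_le => //.
    apply: measurable_funB => //; apply: measurableT_comp => //.
    by apply: mY'; rewrite (le_trans _ (ltW qN)).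
  by apply/seteqP; split => [w|w] /=; [exact|].
have c0E w : G w -> forall t, 0 < t -> c0_path Y w t = Y t w.
  move=> Gw t t0; rewrite /c0_path /= [LHS](_ : _ = val (insubd 0 (ext w) : C0 R) t)//.
  by rewrite insubdK// /ext ltW.
have c0N w : ~ G w -> c0_path Y w = 0.
  by move=> /negP Gw; rewrite /c0_path /insubd insubN.
have mball (g : C0 R) (r : R) : measurable [set w | `|c0_path Y w - g| <= r].
  pose B : set T := [set w | forall q : rat, 0 < ratr q :> R ->
     `|Y (ratr q) w - g (ratr q)| - r * (1 + ratr q) <= 0].
  have mB : measurable B.
    apply: mrat => q; have [q0|q0] := ltP 0 (ratr q : R); last first.
      rewrite [X in measurable X](_ : _ = setT)//.
      by apply/seteqP; split => // w _ /=; rewrite ltNge q0.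
    rewrite [X in measurable X](_ : _ =
       [set w | `|Y (ratr q) w - g (ratr q)| - r * (1 + ratr q) <= 0]).
      rewrite -[X in measurable X]setTI; apply: measurable_fun_le => //.
      apply: measurable_funB => //; apply: measurableT_comp => //.
      by apply: measurable_funB => //; apply: mY'; exact: ltW.
    by apply/seteqP; split => [w|w] /=; [exact|].
  have BE w : G w -> B w <-> `|c0_path Y w - g| <= r.
    move=> Gw; split => [Bw|].
      apply: c0_norm_le => t t0.
      rewrite [leLHS](_ : _ = `|c0_path Y w t - g t|)// c0E// -subr_le0.
      apply: (@ext_le0 (fun t => `|Y t w - g t| - r * (1 + t)) 0) => //.
      have cl : {within `[0, +oo[, continuous (fun t : R => r * (1 + t))}.
        apply: continuous_subspaceT => x; apply: cvgM; first exact: cvg_cst.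
        by apply: cvgD; [exact: cvg_cst|exact: cvg_id].
      have cg : {within `[0, +oo[, continuous g}.
        by apply: continuous_subspaceT; exact: C0_continuous.
      move=> x; apply: cvgB; last exact: cl.
      by apply: cvg_norm; apply: cvgB; [exact: cY|exact: cg].
    move=> wr q q0; rewrite subr_le0 -c0E// -[X in r * (1 + X)](gtr0_norm q0).
    rewrite [leLHS](_ : _ = `|(c0_path Y w - g) (ratr q)|)//.
    by rewrite (le_trans (c0_norm_ub _ _))// ler_wpM2r// addr_ge0.
  rewrite [X in measurable X](_ : _ = (G `&` B) `|` (~` G `&` [set w | `|0 - g| <= r])).
    apply: measurableU; apply: measurableI => //; first exact: measurableC.
    have [gr|gr] := pselect (`|0 - g| <= r).
      by rewrite [X in measurable X](_ : _ = setT)//; apply/seteqP; split.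
    by rewrite [X in measurable X](_ : _ = set0)//; apply/seteqP; split.
  apply/seteqP; split => [w /= wr|w /= [[Gw Bw]|[Gw]]].
  - have [Gw|Gw] := pselect (G w); [left|right]; split => //.
      exact/BE.
    by rewrite -(c0N w Gw).
  - exact/BE.
  - by rewrite (c0N w Gw).
have [g gP] := @C0_separable R.
apply: (@measurability _ _ T (borel (C0 R)) setT (c0_path Y) (@open (C0 R))) => // _ [U oU <-].
rewrite setTI.
pose I := [set i : nat * nat | forall f : C0 R, `|f - g i.1| <= i.2.+1%:R^-1 -> U f].
rewrite [X in measurable X](_ : _ = \bigcup_(n in [set: nat])
   [set w | if unpickle n is Some (i, k) then
      I (i, k) /\ `|c0_path Y w - g i| <= k.+1%:R^-1 else False]).
  apply: bigcupT_measurable => n; case: (unpickle n) => [[i k]|].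
    have [Ik|Ik] := pselect (I (i, k)).
      rewrite [X in measurable X](_ : _ = [set w | `|c0_path Y w - g i| <= k.+1%:R^-1]).
        exact: mball.
      by apply/seteqP; split => [w []|].
    by rewrite [X in measurable X](_ : _ = set0)//; apply/seteqP; split => [w []|].
  by rewrite [X in measurable X](_ : _ = set0)//; apply/seteqP; split.
apply/seteqP; split => [w Uw|w [n _] /=]; last first.
  by case: (unpickle n) => // -[i k] [Ik]; exact: Ik.
have /nbhs_ballP[e /= e0 eU] : nbhs (c0_path Y w) U by exact: open_nbhs_nbhs.
have e2 : 0 < e / 2 by rewrite divr_gt0.
have [k _ /(_ k (leqnn k))/= kP] := near_infty_natSinv_lt (PosNum e2).
have k0 : 0 < k.+1%:R^-1 :> R by rewrite invr_gt0.
have [i iP] := gP (c0_path Y w) _ k0.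
exists (pickle (i, k)) => //=; rewrite pickleK; split => // f fg.
apply: eU; rewrite -ball_normE /ball_ /= (splitr e).
rewrite (le_lt_trans (ler_distD (g i) _ _))// distrC.
by rewrite ltrD// ?(le_lt_trans _ kP)// distrC.
Qed.

End processes.

Section integrated_process.
Context d (T : measurableType d) (R : realType).
Implicit Types (X : R -> T -> R) (kappa : R).
Notation mu := (@lebesgue_measure R).

Definition integrated_process kappa X (t : R) (w : T) : R :=
  (Num.sqrt kappa)^-1 * \int[mu]_(s in `[0, kappa * t]) X s w.

Lemma continuous_process_joint X : continuous_process setT X ->
  measurable_fun setT (fun p : T * measurableTypeR R => X p.2 p.1).
Proof.
move=> [mX cX].
pose g (n : nat) (s : R) : R := (Num.floor (s * n.+1%:R))%:~R / n.+1%:R.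
apply: (measurable_fun_cvg (h := fun n p => X (g n p.2) p.1)) => [n|[w s] _ /=].
  move=> _ B mB; rewrite setTI.
  rewrite [X in measurable X](_ : _ = \bigcup_(i in [set: nat])
     (if unpickle i is Some z then
       (X (z%:~R / n.+1%:R) @^-1` B) `*` `[z%:~R / n.+1%:R, (z + 1)%:~R / n.+1%:R[%classic
      else set0)).
    apply: bigcupT_measurable => i; case: (unpickle i) => [z|//].
    apply: measurableX; last exact: measurable_itv.
    by rewrite -[X in measurable X]setTI; exact: mX.
  apply/seteqP; split => [[w s] /= Bw|[w s] [i _]].
    exists (pickle (Num.floor (s * n.+1%:R))) => //; rewrite pickleK; split => //=.
    by rewrite in_itv/= ler_pdivrMr// ltr_pdivlMr// floor_itv.
  case: (unpickle i) => //= z [/= Bw].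
  rewrite in_itv/= ler_pdivrMr// ltr_pdivlMr// => zs.
  by rewrite /g (@floor_def _ _ z).
have /(_ s)/cvgrPdist_lt cs : continuous (X^~ w).
  by move: (cX w); rewrite continuous_open_subspace ?in_setP; [move=> h x; exact: h|exact: openT].
apply/cvgrPdist_lt => e /cs/nbhs_ballP[r /= r0 rP].
have [N _ NP] := near_infty_natSinv_lt (PosNum r0).
exists N => // n /= Nn; apply: rP; rewrite /ball/=.
have /andP[sl su] := floor_itv (s * n.+1%:R).
rewrite ger0_norm; last by rewrite subr_ge0 ler_pdivrMr.
apply: lt_trans (NP n Nn) => /=; rewrite ltrBlDr -[X in X + _]div1r -mulrDl.
by rewrite ltr_pdivlMr// addrC -intrD1.
Qed.

Lemma continuous_integrated_process kappa X : continuous_process setT X ->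
  continuous_process `[0, +oo[ (integrated_process kappa X).
Proof.
move=> cX; split => [t _|w].
  apply: measurable_funM => //; rewrite /Rintegral.

  apply: (measurableT_comp (fine_measurable measurableT)).
  set D := [set` `[0, kappa * t]].
  pose f (p : T * measurableTypeR R) : \bar R := (X p.2 p.1 * \1_D p.2)%:E.
  have mf : measurable_fun setT f.
    apply/measurable_EFinP; apply: measurable_funM.
      exact: continuous_process_joint.
    by apply: measurableT_comp => //; apply: measurable_indic; exact: measurable_itv.
  rewrite (_ : (fun w => _) = (fun w =>
    fubini_F mu f^\+ w - fubini_F mu f^\- w)%E).
    apply: emeasurable_funB; apply: measurable_fun_fubini_tonelli_F => //.
      exact: measurable_funepos.
    exact: measurable_funeneg.
  apply/funext => w; rewrite integral_mkcond.
  have -> : (fun s => (X s w)%:E) \_ D = (fun s => f (w, s)).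
    by apply/funext => s; rewrite patchE /f indicE/=; case: ifP; rewrite ?mulr1 ?mulr0.
  rewrite integralE /fubini_F; congr (_ - _)%E.
    by apply: eq_integral => s _; rewrite !funeposE.
  by apply: eq_integral => s _; rewrite !funenegE.
have cXw : continuous (X^~ w).
  by move: (cX.2 w); rewrite continuous_open_subspace; [move=> h x; exact: (h x (in_setT x))|exact: openT].
have iX (b : R) : mu.-integrable `[0, b] (EFin \o (X^~ w)).
  apply: continuous_compact_integrable; first exact: segment_compact.
  exact: continuous_subspaceT.
have [k0|k0] := leP kappa 0.
  have F0 t : 0 <= t -> integrated_process kappa X t w = 0.
    move=> t0; rewrite /integrated_process.
    have : kappa * t <= 0 by rewrite mulr_le0_ge0.
    rewrite le_eqVlt => /predU1P[->|kt]; first by rewrite set_itv1 Rintegral_set1 mulr0.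
    by rewrite set_itv_ge ?Rintegral_set0 ?mulr0// bnd_simp -ltNge.
  apply: (@subspace_eq_continuous _ _ _ (cst 0)); last exact: cst_continuous.
  by move=> t; rewrite inE/= in_itv/= andbT => /F0 H; exact: esym H.
have ck t : (kappa * s) @[s --> t] --> kappa * t.
  by apply: cvgM; [exact: cvg_cst|exact: cvg_id].
apply/continuous_within_itvcyP; split => [t|].
  rewrite in_itv/= andbT => t0; apply: cvgM; first exact: cvg_cst.
  have kt0 : 0 < kappa * t by rewrite mulr_gt0.
  have kt1 : 0 < kappa * t + 1 by rewrite addr_gt0.
  have /(continuous_within_itvP _ kt1)[+ _ _] :=
    parameterized_integral_continuous (ltW kt1) (iX _).
  move=> /(_ (kappa * t)); rewrite in_itv/= kt0 ltrDl ltr01 => /(_ isT).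
  exact: (cvg_comp _ _ (ck t)).
apply: cvgM; first exact: cvg_cst.
rewrite mulr0 set_itv1 Rintegral_set1; apply: cvg_at_right_filter.
have := ck 0; rewrite mulr0 => ck0.
exact: (cvg_comp _ _ ck0 (parameterized_integral_cvg_left ltr01 (iX 1))).
Qed.

End integrated_process.

Section laws.
Context d (T : measurableType d) (R : realType).

Definition path_rv (Y : R -> T -> R) (cY : continuous_process `[0, +oo[ Y) :
    {mfun T >-> borel (C0 R)} :=
  mfun_Sub (mem_set (measurable_c0_path cY)).

Definition path_law (P : probability T R) (Y : R -> T -> R)
    (cY : continuous_process `[0, +oo[ Y) : probability (borel (C0 R)) R :=
  distribution P (path_rv cY).

End laws.

(* N(m, v), the variance v >= 0 being allowed to vanish; normal_prob takes the
   standard deviation. *)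
Definition gaussian_law (R : realType) (m v : R) (B : set R) : \bar R :=
  if v == 0 then \d_m B else normal_prob m (Num.sqrt v) B.

Section process_properties.
Context d (T : measurableType d) (R : realType) (P : probability T R).
Implicit Types X W : R -> T -> R.

Definition has_law (Z : T -> R) (mu : set R -> \bar R) :=
  forall B, measurable B -> P (Z @^-1` B) = mu B.

Definition gaussian_process X := forall (n : nat) (t a : 'I_n -> R),
  exists m v, 0 <= v /\
    has_law (fun w => \sum_(i < n) a i * X (t i) w) (gaussian_law m v).

(* Equality of the finite-dimensional laws on measurable boxes, which determine them. *)
Definition stationary_process X :=
  forall (n : nat) (t : 'I_n -> R) (h : R) (B : 'I_n -> set R),
  (forall i, measurable (B i)) ->
  P [set w | forall i, B i (X (t i + h) w)] = P [set w | forall i, B i (X (t i) w)].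

Definition OU_process X :=
  [/\ gaussian_process X, stationary_process X,
      forall t, ('E_P[X t] = 0)%E
    & forall t s, ('E_P[X t \* X s] = (expR (- 2 * `|t - s|))%R%:E)%E].

Definition mutually_independent (n : nat) (Z : 'I_n -> T -> R) :=
  forall B : 'I_n -> set R, (forall i, measurable (B i)) ->
  P [set w | forall i, B i (Z i w)] = (\prod_(i < n) fine (P (Z i @^-1` B i)))%:E.

(* Only the times t >= 0 matter. *)
Definition brownian_motion W :=
  [/\ {ae P, forall w, W 0 w = 0},
      (forall s t, 0 <= s <= t -> has_law (W t \- W s) (gaussian_law 0 (t - s)))
    & forall (n : nat) (t : nat -> R), 0 <= t 0%N -> (forall i, t i <= t i.+1) ->
      mutually_independent (fun i : 'I_n => W (t i.+1) \- W (t i))].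

End process_properties.

Definition wasserstein1 (R : realType) (E : normedModType R)
    (mu nu : probability (borel E) R) : \bar R :=
  ereal_sup [set `|\int[mu]_x (phi x)%:E - \int[nu]_x (phi x)%:E|%E
    | phi in [set phi : E -> R | forall x y, `|phi x - phi y| <= `|x - y|]].

(* Main.v *)
Require Import Defs.
From HB Require Import structures.
From mathcomp Require Import all_boot all_order all_algebra.
From mathcomp Require Import all_classical all_reals all_analysis measurable_realfun.
From mathcomp Require Import ring lra zify.
Set Implicit Arguments.
Unset Strict Implicit.
Unset Printing Implicit Defensive.
Import Order.TTheory GRing.Theory Num.Theory.
Import numFieldNormedType.Exports.
Local Open Scope classical_set_scope.
Local Open Scope ring_scope.

(* Let B(t) = (X(t) - X(0)) / 2 + int_0^t X be the noise driving X. It is the limit of sums of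
   the uncorrelated innovations X((k+1)h) - e^(-2h) X(kh), so kappa^(-1/2) B(kappa t) is a
   Brownian motion for every kappa; its law on C_(0) is that of W, since the expectations of
   the cosines of finite linear combinations determine the law of a continuous process.

   Upper bound: W^kappa differs from kappa^(-1/2) B(kappa t) by
   kappa^(-1/2) (X(kappa t) - X(0)) / 2. Chaining over dyadic times gives an integrable Q with
   |X(t)|^2 <= 80^2 (Q + 1 + 2 ln(t + 2)), hence the expected norm of the difference is
   O((ln(1+kappa)/kappa)^(1/2)).

   Lower bound: test with the 1-Lipschitz function max_{k<n} |f((k+1)/n) - f(k/n)| / 4, where
   n is about M^2 kappa. By independence of the increments its expectation under the law of W
   is at least of order (ln n / n)^(1/2), that is M^(-1) (ln(1+kappa)/kappa)^(1/2). The
   increments of W^kappa are at most kappa^(1/2) sup_[0,kappa] |X| / n, of order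
   M^(-2) (ln(1+kappa)/kappa)^(1/2), which is smaller once M is large. *)

(** * Bounded measurable functions and passage to the limit under the integral *)

Section bounded_measurable.
Context d (T : measurableType d) (R : realType).
Implicit Types f g : T -> R.

(** The process [W] is arbitrary and lives on its own probability space, so it cannot be compared
    with [X] path by path. Only its law is carried over, to the noise [coupled_motion] built from
    [X] alone, and the pathwise estimates are made on the space of [X]. Hence the constants depend
    only on the expectation of [Q] and are fixed before [W] and kappa. A second obstacle: [c0_path]
    sends a path outside C_(0) to 0, so a path law speaks about its process only once the paths are
    known to lie in C_(0) almost surely. For the integrated process and the noise this follows from
    the envelope [Q]; for [W] it is transferred through the law on the space of all continuous
    paths. Cosines with a free phase b serve as test functions because their products are again
    combinations of them, and because the expectation for a centred Gaussian variable of variance v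
    is cos b times a function of v alone. That function stays abstract, as [gauss_cos]: both
    processes give it the same argument, the sum of a_p a_q min(t_p, t_q), and the comparison rests
    on that. *)

Definition bounded_measurable f :=
  measurable_fun setT f /\ exists M, forall x, `|f x| <= M.

Lemma bounded_measurable_cst r : bounded_measurable (fun=> r).
Proof. by split => //; exists `|r|. Qed.

Lemma bounded_measurableD f g : bounded_measurable f -> bounded_measurable g ->
  bounded_measurable (fun x => f x + g x).
Proof.
move=> [mf [M fM]] [mg [N gN]]; split; first exact: measurable_funD.
by exists (M + N) => x; rewrite (le_trans (ler_normD _ _))// lerD.
Qed.

Lemma bounded_measurableM f g : bounded_measurable f -> bounded_measurable g ->
  bounded_measurable (fun x => f x * g x).
Proof.
move=> [mf [M fM]] [mg [N gN]]; split; first exact: measurable_funM.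
by exists (M * N) => x; rewrite normrM ler_pM.
Qed.

Lemma bounded_measurable_prod (I : Type) (s : seq I) (P : pred I) (F : I -> T -> R) :
  (forall i, bounded_measurable (F i)) ->
  bounded_measurable (fun x => \prod_(i <- s | P i) F i x).
Proof.
move=> bF; elim: s => [|i s IH].
  under eq_fun do rewrite big_nil; exact: bounded_measurable_cst.
under eq_fun do rewrite big_cons; case: (P i) => //.
exact: bounded_measurableM.
Qed.

Lemma bounded_measurable_indic (A : set T) : measurable A ->
  bounded_measurable (\1_A : T -> R).
Proof.
move=> mA; split => //; exists 1 => x.
by rewrite indicE; case: (x \in A); rewrite ?normr1 ?normr0.
Qed.

Lemma bounded_measurable_cos f : measurable_fun setT f ->
  bounded_measurable (fun x => cos (f x)).
Proof.
move=> mf; split; last by exists 1 => x; exact: cos_max.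
by apply: measurableT_comp => //; apply: continuous_measurable_fun; exact: continuous_cos.
Qed.

Lemma bounded_measurable_sin f : measurable_fun setT f ->
  bounded_measurable (fun x => sin (f x)).
Proof.
move=> mf; split; last by exists 1 => x; exact: sin_max.
by apply: measurableT_comp => //; apply: continuous_measurable_fun; exact: continuous_sin.
Qed.

Lemma bounded_measurable_integrable (P : probability T R) f : bounded_measurable f ->
  P.-integrable setT (EFin \o f).
Proof.
move=> [mf [M fM]]; apply: (@le_integrable _ _ _ _ _ measurableT _ (cst M%:E)).
- exact/measurable_EFinP.
- by move=> x _ /=; rewrite lee_fin (le_trans (fM x))// ler_norm.
- exact: finite_measure_integrable_cst.
Qed.

End bounded_measurable.

Lemma bounded_measurable_comp d d' (T : measurableType d) (T' : measurableType d')
    (R : realType) (f : T' -> R) (g : T -> T') :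
  bounded_measurable f -> measurable_fun setT g -> bounded_measurable (f \o g).
Proof.
move=> [mf [M fM]] mg; split; first exact: measurableT_comp.
by exists M => x; exact: fM.
Qed.

Lemma Rintegral_dominated_cvg d (T : measurableType d) (R : realType)
    (mu : {measure set T -> \bar R}) (f_ : nat -> T -> R) (f g : T -> R) :
  (forall n, measurable_fun setT (f_ n)) -> measurable_fun setT f ->
  mu.-integrable setT (EFin \o g) -> (forall n x, `|f_ n x| <= g x) ->
  {ae mu, forall x, f_ ^~ x @ \oo --> f x} ->
  \int[mu]_x f_ n x @[n --> \oo] --> \int[mu]_x f x.
Proof.
move=> mf_ mf ig fg cf.
have [||||| h1 h2 h3] := @dominated_convergence _ _ _ mu setT measurableT
   (fun n => EFin \o f_ n) (EFin \o f) (EFin \o g).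
- by move=> n; exact/measurable_EFinP.
- exact/measurable_EFinP.
- by apply: filterS cf => x cx _ /=; apply: cvg_EFin; [exact: nearW|exact: cx].
- exact: ig.
- by apply: aeW => x n _ /=; rewrite lee_fin fg.
apply/fine_cvg; rewrite /Rintegral fineK //.
exact: (integrable_fin_num measurableT h1).
Qed.

Lemma Rintegral_bounded_cvg d (T : measurableType d) (R : realType)
    (P : probability T R) (f_ : nat -> T -> R) (f : T -> R) (M : R) :
  (forall n, measurable_fun setT (f_ n)) -> measurable_fun setT f ->
  (forall n x, `|f_ n x| <= M) ->
  {ae P, forall x, f_ ^~ x @ \oo --> f x} ->
  \int[P]_x f_ n x @[n --> \oo] --> \int[P]_x f x.
Proof.
move=> mf_ mf fM cf.
apply: (@Rintegral_dominated_cvg _ _ _ P f_ f (cst M)) => //.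
exact: finite_measure_integrable_cst.
Qed.

(** * A functional monotone class theorem generated by cosines *)

Section bounded_classes.
Variable R : realType.
Implicit Types (f g : R -> R) (K : (R -> R) -> Prop).

(** The typical [K] is the set of functions on which two expectations agree: linearity gives the
    first clause and dominated convergence the second. *)
Definition bounded_class K :=
  (forall r f g, K f -> K g -> K (fun x => r * f x + g x)) /\
  (forall (f_ : nat -> R -> R) f M, (forall n, K (f_ n)) ->
     (forall n x, `|f_ n x| <= M) -> (forall x, f_ ^~ x @ \oo --> f x) -> K f).

(** Phases make constants and sines available, and the product formula makes the span an algebra, so
    polynomials in a trigonometric function stay inside. *)
Inductive trig_poly : (R -> R) -> Prop :=
| trig_poly_cos a b : trig_poly (fun x => cos (a * x + b))
| trig_poly_lin r f g : trig_poly f -> trig_poly g ->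
    trig_poly (fun x => r * f x + g x).

Lemma cos_mul_cos (x y : R) :
  cos x * cos y = 2^-1 * cos (x + y) + 2^-1 * cos (x - y).
Proof. by rewrite cosD cosB; lra. Qed.

Lemma trig_polyZ r f : trig_poly f -> trig_poly (fun x => r * f x).
Proof.
move=> pf; rewrite (_ : (fun _ => _) = (fun x => (r - 1) * f x + f x)).
  exact: trig_poly_lin.
by apply/funext => x; ring.
Qed.

Lemma trig_polyM f g : trig_poly f -> trig_poly g -> trig_poly (fun x => f x * g x).
Proof.
move=> pf pg; elim: pf => [a b|r f1 f2 _ IH1 _ IH2]; last first.
  rewrite (_ : (fun _ => _) = (fun x => r * (f1 x * g x) + f2 x * g x)).
    exact: trig_poly_lin.
  by apply/funext => x; ring.
elim: pg => [c e|r f1 f2 _ IH1 _ IH2]; last first.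
  rewrite (_ : (fun _ => _) =
    (fun x => r * (cos (a * x + b) * f1 x) + cos (a * x + b) * f2 x)).
    exact: trig_poly_lin.
  by apply/funext => x; ring.
rewrite (_ : (fun _ => _) = (fun x => 2^-1 * cos ((a + c) * x + (b + e)) +
   2^-1 * cos ((a - c) * x + (b - e)))).
  by apply: trig_poly_lin; [|apply: trig_polyZ]; exact: trig_poly_cos.
apply/funext => x; rewrite cos_mul_cos; congr (_ * cos _ + _ * cos _); ring.
Qed.

Lemma trig_poly_cst r : trig_poly (fun=> r).
Proof.
rewrite (_ : (fun _ => _) = (fun x : R => r * cos (0 * x + 0))).
  by apply: trig_polyZ; exact: trig_poly_cos.
by apply/funext => x; rewrite mul0r addr0 cos0 mulr1.
Qed.

Lemma trig_polyX f n : trig_poly f -> trig_poly (fun x => f x ^+ n).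
Proof.
move=> pf; elim: n => [|n IH].
  by under eq_fun do rewrite expr0; exact: trig_poly_cst.
by under eq_fun do rewrite exprS; exact: trig_polyM.
Qed.

Lemma trig_poly_class K : bounded_class K ->
  (forall a b, K (fun x => cos (a * x + b))) -> forall f, trig_poly f -> K f.
Proof. by move=> [Klin _] Kcos f; elim=> // r f1 f2 _ ? _ ?; exact: Klin. Qed.

(** With s the square root of r, Bernoulli's inequality bounds n s^n by a constant, and the second
    factor s^n still tends to 0. *)
Lemma cvg_natr_mul_exprn (r : R) : 0 <= r < 1 -> n%:R * r ^+ n @[n --> \oo] --> 0.
Proof.
move=> /andP[r0 r1]; have [->|r_neq0] := eqVneq r 0.
  apply: cvg_near_cst; near=> n; rewrite expr0n gtn_eqF ?mulr0//.
  by near: n; exact: nbhs_infty_gt.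
have {r0 r_neq0} r0 : 0 < r by rewrite lt_neqAle eq_sym r_neq0.
pose s := Num.sqrt r.
have s0 : 0 < s by rewrite sqrtr_gt0.
have s1 : s < 1 by rewrite -sqrtr1 ltr_sqrt.
have sr : s ^+ 2 = r by rewrite sqr_sqrtr// ltW.
pose h := s^-1 - 1; have h0 : 0 < h by rewrite subr_gt0 invf_gt1.
have bern n : n%:R * h <= s^-1 ^+ n.
  elim: n => [|n IH]; first by rewrite mul0r.
  rewrite exprSr -natr1 mulrDl mul1r {2}/h.
  have : 1 <= s^-1 ^+ n by rewrite exprn_ege1// ltW// invf_gt1.
  have : 1 < s^-1 by rewrite invf_gt1.
  by rewrite /h in IH *; nra.
apply: (@squeeze_cvgr _ _ _ _ (cst 0) (fun n => h^-1 * s ^+ n)).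
- near=> n; apply/andP; split; first by rewrite mulr_ge0// exprn_ge0// ltW.
  rewrite -sr expr2 exprMn mulrA ler_wpM2r ?exprn_ge0 ?(ltW s0)//.
  by rewrite -ler_pdivlMr ?exprn_gt0// -exprVn ler_pdivlMl// mulrC.
- exact: cvg_cst.
- rewrite -[X in _ --> X](mulr0 h^-1); apply: cvgMr.
  by apply: cvg_expr; rewrite gtr0_norm.
Unshelve. all: by end_near.
Qed.

(* On [0, 1], v |-> 1 - (1 - v^n)^(n 2^n) increases to the indicator of [1/2, 1]. *)
Definition half_step (n : nat) (v : R) : R := 1 - (1 - v ^+ n) ^+ (n * 2 ^ n).

Lemma half_step_ge0_le1 n v : 0 <= v <= 1 -> 0 <= half_step n v <= 1.
Proof.
move=> /andP[v0 v1]; have h : 0 <= 1 - v ^+ n <= 1.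
  by rewrite subr_ge0 exprn_ile1//= lerBlDr lerDl exprn_ge0.
case/andP: h => h0 h1.
by rewrite /half_step subr_ge0 exprn_ile1//= lerBlDr lerDl exprn_ge0.
Qed.

(** The exponent m = n 2^n makes m v^n equal to n (2v)^n, which is at least n if v >= 1/2 and tends
    to 0 if v < 1/2. In the first case (1 - x)^m (1 + x)^m <= 1 with x = v^n, and Bernoulli's
    inequality for the second factor gives (1 - x)^m <= 1 / (n + 1); in the second, Bernoulli's
    inequality for (1 - x)^m suffices. *)
Lemma cvg_half_step v : 0 <= v <= 1 ->
  half_step n v @[n --> \oo] --> ((2^-1 <= v)%R%:R : R).
Proof.
move=> /[dup] /half_step_ge0_le1 h01 /andP[v0 v1]; have [v2|v2] := leP 2^-1 v.
- have lb n : 1 - n.+1%:R^-1 <= half_step n v.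
    rewrite /half_step lerD2l lerN2.
    pose x := v ^+ n; have x0 : 0 <= x by rewrite exprn_ge0.
    have x1 : x <= 1 by rewrite exprn_ile1.
    have bern m : 1 + m%:R * x <= (1 + x) ^+ m.
      elim: m => [|m IH]; first by rewrite mul0r addr0 expr0.
      rewrite exprSr -natr1; have : 0 <= m%:R * x ^+ 2 by rewrite mulr_ge0// exprn_ge0.
      by nra.
    rewrite -/x -[leRHS]div1r ler_pdivlMr ?ltr0n//.
    apply: (@le_trans _ _ ((1 - x) ^+ (n * 2 ^ n) * (1 + x) ^+ (n * 2 ^ n))).
      rewrite ler_wpM2l ?exprn_ge0 ?subr_ge0//.
      apply: le_trans (bern _); rewrite -natr1 addrC lerD2l natrM -mulrA ler_peMr//.
      by rewrite natrX -exprMn exprn_ege1// -ler_pdivrMl// mulr1.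
    by rewrite -exprMn exprn_ile1//; nra.
  apply: (@squeeze_cvgr _ _ _ _ (fun n : nat => 1 - n.+1%:R^-1) (cst 1)).
  + by apply: nearW => n; rewrite lb; case/andP: (h01 n).
  + rewrite -[X in _ --> X]subr0; apply: cvgB; first exact: cvg_cst.
    exact: cvg_harmonic.
  + exact: cvg_cst.
- have ub n : half_step n v <= n%:R * (2 * v) ^+ n.
    have x1 : v ^+ n <= 1 by rewrite exprn_ile1.
    have bern m : 1 - m%:R * v ^+ n <= (1 - v ^+ n) ^+ m.
      have x0 : 0 <= v ^+ n by rewrite exprn_ge0.
      elim: m => [|m IH]; first by rewrite mul0r subr0 expr0.
      rewrite exprSr -natr1.
      have : 0 <= m%:R * (v ^+ n) ^+ 2 by rewrite mulr_ge0// exprn_ge0.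
      by nra.
    rewrite /half_step lerBlDr -lerBlDl.
    by rewrite exprMn mulrA -natrX -natrM.
  apply: (@squeeze_cvgr _ _ _ _ (cst 0) (fun n => n%:R * (2 * v) ^+ n)).
  + by apply: nearW => n; rewrite ub andbT; case/andP: (h01 n).
  + exact: cvg_cst.
  + apply: cvg_natr_mul_exprn; rewrite mulr_ge0//=.
    by rewrite -ltr_pdivlMl// mulr1.
Qed.

(** The function (1 + sin(a (x - c))) / 2 takes values in [0, 1] and is at least 1/2 exactly where
    the sine is nonnegative, so [half_step] of it converges to the indicator of that periodic set.
    Letting a = 1 / (n + 1) tend to 0 stretches the period: eventually |a (x - c)| <= 1 < pi, and
    the sine has the sign of x - c. *)
Lemma trig_class_halfline K : bounded_class K ->
  (forall a b, K (fun x => cos (a * x + b))) -> forall c, K (\1_(`[c, +oo[%classic)).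
Proof.
move=> KK Kcos c.
pose v (a x : R) : R := 2^-1 * cos (a * x + (- (a * c) - pi / 2)) + 2^-1.
have vE a x : v a x = 2^-1 * sin (a * (x - c)) + 2^-1.
  by rewrite /v addrA -mulrN -mulrDr cosBpihalf.
have v01 a x : 0 <= v a x <= 1.
  by rewrite vE; move: (sin_geN1 (a * (x - c))) (sin_le1 (a * (x - c))); lra.
have pv a : trig_poly (v a).
  by apply: trig_poly_lin; [exact: trig_poly_cos|exact: trig_poly_cst].
have Kstep a : K (fun x => (2^-1 <= v a x)%R%:R : R).
  apply: (KK.2 (fun n x => half_step n (v a x)) _ 1).
  - move=> n; apply: (trig_poly_class KK Kcos).
    rewrite (_ : (fun _ => _) =
        (fun x => -1 * (1 - v a x ^+ n) ^+ (n * 2 ^ n) + 1)); last first.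
      by apply/funext => x; rewrite /half_step; ring.
    apply: trig_poly_lin; last exact: trig_poly_cst.
    apply: trig_polyX.
    rewrite (_ : (fun _ => _) = (fun x => -1 * v a x ^+ n + 1)); last first.
      by apply/funext => x; ring.
    by apply: trig_poly_lin; [exact: trig_polyX|exact: trig_poly_cst].
  - move=> n x; have /andP[h0 h1] := half_step_ge0_le1 n (v01 a x).
    by rewrite ger0_norm.
  - by move=> x; exact: cvg_half_step.
apply: (KK.2 (fun n x => (2^-1 <= v n.+1%:R^-1 x)%R%:R : R) _ 1) => //.
- by move=> n x; case: (2^-1 <= _); rewrite ?normr1 ?normr0.
move=> x; apply: cvg_near_cst; near=> n.
rewrite indicE vE lerDr pmulr_rge0//; congr ((nat_of_bool _)%:R); apply/idP/idP; last first.
  rewrite inE/= in_itv/= andbT => cx; apply: sin_ge0_pi.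
  rewrite mulr_ge0 ?subr_ge0//= ler_pdivrMl//.
  suff xn : x - c <= n.+1%:R.
    by rewrite (le_trans xn)// ler_peMr// (le_trans _ (pi_ge2 R)) ?ler1n.
  near: n; exists (Num.truncn `|x - c|).+1 => // n /= nx.
  rewrite (le_trans (ler_norm _))// (le_trans (ltW (truncnS_gt _)))// ler_nat.
  exact: leqW.
apply: contraLR; rewrite notin_setE/= in_itv/= andbT => /negP; rewrite -!ltNge => xc.
rewrite -[X in sin X]opprK sinN oppr_lt0; apply: sin_gt0_pi.
rewrite -mulrN opprB mulr_gt0 ?subr_gt0//= ltr_pdivrMl//.
suff xn : c - x <= n.+1%:R.
  by rewrite (le_lt_trans xn)// ltr_pMr// (lt_le_trans _ (pi_ge2 R)) ?ltr1n.
near: n; exists (Num.truncn `|c - x|).+1 => // n /= nx.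
rewrite (le_trans (ler_norm _))// (le_trans (ltW (truncnS_gt _)))// ler_nat.
exact: leqW.
Unshelve. all: by end_near.
Qed.

Lemma trig_class_indic K : bounded_class K ->
  (forall a b, K (fun x => cos (a * x + b))) ->
  forall A : set R, measurable A -> K (\1_A).
Proof.
move=> KK Kcos A mA.
have K1 : K (fun=> 1) by apply: (trig_poly_class KK Kcos); exact: trig_poly_cst.
have KB f g : K f -> K g -> K (fun x => g x - f x).
  move=> Kf Kg; rewrite (_ : (fun _ => _) = (fun x => -1 * f x + g x)).
    exact: KK.1.
  by apply/funext => x; ring.
suff : @RGenCInfty.G R `<=` [set A | K \1_A] ->
    <<s setT, @RGenCInfty.G R >> `<=` [set A | K \1_A].
  apply => [B [c ->]|]; first exact: trig_class_halfline.
  have : (@ocitv R).-sigma.-measurable A by exact: mA.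
  by rewrite RGenCInfty.measurableE.
move=> GK; apply: lambda_system_subset => //.
- move=> _ _ [x ->] [y ->]; exists (Num.max x y).
  apply/seteqP; split => z /=; rewrite !in_itv/= !andbT ge_max.
    by move=> [-> ->].
  by move=> /andP[].
- split => //=.
  + rewrite (_ : \1__ = (fun=> 1))//; apply/funext => x.
    by rewrite indicE in_setT.
  + move=> B C CB KB1 KC1.
    rewrite /= (_ : \1__ = (fun x => \1_B x - \1_C x)); first exact: KB.
    apply/funext => x; rewrite !indicE in_setD.
    have [Cx|Cx] := boolP (x \in C); last by rewrite andbT subr0.
    have -> : x \in B by rewrite inE; apply: CB; rewrite inE in Cx.
    by rewrite subrr.
  + move=> F ndF KF; apply: (KK.2 (fun n => \1_(F n)) _ 1) => //.
      by move=> n x; rewrite indicE; case: (_ \in _); rewrite ?normr1 ?normr0.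
    move=> x; have [[n _ Fnx]|nx] := pselect ((\bigcup_k F k) x).
      apply: cvg_near_cst; exists n => // m /= nm.
      rewrite !indicE !mem_set//; first by exists n.
      by have /subsetPset := ndF _ _ nm; apply.
    apply: cvg_near_cst; apply: nearW => m; rewrite !indicE !memNset//.
    by move=> Fmx; apply: nx; exists m.
Qed.

(** After the shift by [M] the function is nonnegative, as rounding by [Num.truncn] requires.
    Rounding down to multiples of 1 / (n + 1) gives a finite combination of indicators, within 1 /
    (n + 1) of the function. *)
Lemma indic_class K : bounded_class K ->
  (forall A : set R, measurable A -> K \1_A) -> forall f, bounded_measurable f -> K f.
Proof.
move=> KK Kind f [mf [M fM]].
have K1 : K (fun=> 1).
  by rewrite (_ : (fun=> 1) = \1_setT)//; [exact: Kind|apply/funext => x; rewrite indicE in_setT].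
have Kcst r : K (fun=> r).
  rewrite (_ : (fun _ => _) = (fun=> (r - 1) * 1 + 1)); first exact: KK.1.
  by apply/funext => x; ring.
have Ksum n (c : nat -> R) (g : nat -> R -> R) : (forall i, K (g i)) ->
    K (fun x => \sum_(i < n) c i * g i x).
  move=> Kg; elim: n => [|n IH].
    by under eq_fun do rewrite big_ord0; exact: Kcst.
  under eq_fun do rewrite big_ord_recr/= addrC.
  exact: KK.1.
pose g x := f x + M.
have g0 x : 0 <= g x by rewrite -lerBlDr sub0r; move: (fM x); rewrite ler_norml => /andP[].
have gM x : g x <= 2 * M.
  by rewrite /g mulr_natl mulr2n lerD2r; move: (fM x); rewrite ler_norml => /andP[].
have mg : measurable_fun setT g by exact: measurable_funD.
pose g_ n x : R := (Num.truncn (g x * n.+1%:R))%:R / n.+1%:R.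
have g_E n x : g_ n x <= g x < g_ n x + n.+1%:R^-1.
  rewrite /g_ ler_pdivrMr// -[X in _ + X]div1r -mulrDl ltr_pdivlMr// natr1.
  by rewrite truncn_itv// mulr_ge0.
have Kg_ n : K (g_ n).
  pose J := (Num.truncn (2 * M * n.+1%:R)).+1.
  pose A j : set R := [set x | Num.truncn (g x * n.+1%:R) = j].
  rewrite (_ : g_ n = (fun x => \sum_(j < J) (j%:R / n.+1%:R) * \1_(A j) x)).
    apply: (@Ksum J (fun j => j%:R / n.+1%:R) (fun j => \1_(A j))) => j; apply: Kind.
    rewrite (_ : A j = g @^-1` `[j%:R / n.+1%:R, j.+1%:R / n.+1%:R[%classic).
      by rewrite -[X in measurable X]setTI; exact: mg.
    apply/seteqP; split => x /=; rewrite in_itv/= ler_pdivrMr// ltr_pdivlMr//.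
      by move=> <-; rewrite truncn_itv// mulr_ge0.
    by move=> h; exact: truncn_def.
  apply/funext => x.
  have lJ : (Num.truncn (g x * n.+1%:R)%R < J)%N.
    by rewrite ltnS; apply: le_truncn; rewrite ler_wpM2r.
  rewrite (bigD1 (Ordinal lJ))//= [X in _ + X]big1 ?addr0.
    by rewrite indicE mem_set ?mulr1.
  move=> j /eqP jl; rewrite indicE memNset ?mulr0// => jE; apply: jl.
  by apply: val_inj => /=.
have Kg : K g.
  apply: (KK.2 g_ _ (2 * M)) => // [n x|x].
    rewrite ger0_norm ?divr_ge0//; apply: le_trans (gM x).
    by case/andP: (g_E n x).
  apply: (@squeeze_cvgr _ _ _ _ (fun n => g x - n.+1%:R^-1) (cst (g x))).
  - apply: nearW => n; case/andP: (g_E n x) => -> /ltW.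
    by rewrite lerBlDr => ->.
  - rewrite -[X in _ --> X]subr0; apply: cvgB; first exact: cvg_cst.
    exact: cvg_harmonic.
  - exact: cvg_cst.
rewrite (_ : f = (fun x => -1 * M + g x)); last by apply/funext => x; rewrite /g; ring.
exact: (KK.1 _ (fun=> M)).
Qed.

Lemma trig_class K : bounded_class K ->
  (forall a b, K (fun x => cos (a * x + b))) -> forall f, bounded_measurable f -> K f.
Proof. by move=> KK Kcos; apply: indic_class => //; exact: trig_class_indic. Qed.

End bounded_classes.

(** * Finite-dimensional laws from the expectations of cosines *)

Section finite_dimensional_laws.
Context d1 d2 (T1 : measurableType d1) (T2 : measurableType d2) (R : realType).
Context (P1 : probability T1 R) (P2 : probability T2 R) (I : Type).
Context (Y1 : I -> T1 -> R) (Y2 : I -> T2 -> R).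
Hypothesis mY1 : forall i, measurable_fun setT (Y1 i).
Hypothesis mY2 : forall i, measurable_fun setT (Y2 i).

Definition lincomb (T J : Type) (Y : J -> T -> R) (s : seq (R * J)) (w : T) : R :=
  \sum_(p <- s) p.1 * Y p.2 w.

Hypothesis cosE : forall s b,
  \int[P1]_w cos (lincomb Y1 s w + b) = \int[P2]_w cos (lincomb Y2 s w + b).

Lemma measurable_lincomb d (T : measurableType d) (J : Type) (Y : J -> T -> R) s :
  (forall j, measurable_fun setT (Y j)) -> measurable_fun setT (lincomb Y s).
Proof. by move=> mY; apply: measurable_sum => p; exact: measurable_funM. Qed.

Let bm_prod d (T : measurableType d) (Y : I -> T -> R) (s : seq (I * (R -> R))) :
  (forall i, measurable_fun setT (Y i)) ->
  all (fun p => `[< bounded_measurable p.2 >]) s ->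
  bounded_measurable (fun w => \prod_(p <- s) p.2 (Y p.1 w)).
Proof.
move=> mY; elim: s => [_|[i f] s IH /= /andP[/asboolP bf /IH bs]].
  under eq_fun do rewrite big_nil; exact: bounded_measurable_cst.
under eq_fun do rewrite big_cons; apply: bounded_measurableM => //.
exact: (bounded_measurable_comp bf (mY i)).
Qed.

Let bm_cos d (T : measurableType d) (Y : I -> T -> R) s b :
  (forall i, measurable_fun setT (Y i)) ->
  bounded_measurable (fun w => cos (lincomb Y s w + b)).
Proof.
move=> mY; apply: bounded_measurable_cos; apply: measurable_funD => //.
exact: measurable_lincomb.
Qed.

(** The factors are freed one at a time behind a leading cosine of an arbitrary combination with an
    arbitrary phase. If the next factor is itself a cosine, the product formula merges it into the
    leading one and the induction hypothesis applies; [trig_class] then passes from cosines to every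
    bounded measurable factor. *)
Lemma fdd_expectation (s2 : seq (I * (R -> R))) :
  all (fun p => `[< bounded_measurable p.2 >]) s2 -> forall s b,
  \int[P1]_w (cos (lincomb Y1 s w + b) * \prod_(p <- s2) p.2 (Y1 p.1 w)) =
  \int[P2]_w (cos (lincomb Y2 s w + b) * \prod_(p <- s2) p.2 (Y2 p.1 w)).
Proof.
elim: s2 => [_ s b|[i f] s2 IH /= /andP[/asboolP bf bs2]].
  under [LHS]eq_Rintegral do rewrite big_nil mulr1.
  by under [RHS]eq_Rintegral do rewrite big_nil mulr1; exact: cosE.
have {}IH := IH bs2.
pose F d (T : measurableType d) (Y : I -> T -> R) s b g w :=
  cos (lincomb Y s w + b) * (g (Y i w) * \prod_(p <- s2) p.2 (Y p.1 w)).
have bF d (T : measurableType d) (Y : I -> T -> R) s b g :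
    (forall i, measurable_fun setT (Y i)) -> bounded_measurable g ->
    bounded_measurable (F d T Y s b g).
  move=> mY bg; apply: bounded_measurableM; first exact: bm_cos.
  apply: bounded_measurableM; last exact: bm_prod.
  exact: (bounded_measurable_comp bg (mY i)).
pose K g := bounded_measurable g /\ forall s b,
  \int[P1]_w F _ _ Y1 s b g w = \int[P2]_w F _ _ Y2 s b g w.
suff [_ Kf] : K f.
  by move=> s b; under eq_Rintegral do rewrite big_cons; under [RHS]eq_Rintegral do rewrite
    big_cons; exact: Kf.
have FZ d (T : measurableType d) (P : probability T R) (Y : I -> T -> R) s b r g h :
    (forall i, measurable_fun setT (Y i)) -> bounded_measurable g -> bounded_measurable h ->
    \int[P]_w F _ _ Y s b (fun x => r * g x + h x) w =
    r * \int[P]_w F _ _ Y s b g w + \int[P]_w F _ _ Y s b h w.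
  move=> mY bg bh; rewrite -RintegralZl//; last exact/bounded_measurable_integrable/bF.
  rewrite -RintegralD//; last 2 first.
  - apply/bounded_measurable_integrable/bounded_measurableM; last exact: bF.
    exact: bounded_measurable_cst.
  - exact/bounded_measurable_integrable/bF.
  by apply: eq_Rintegral => w _; rewrite /F; ring.
apply: (@trig_class R K _ _ f bf).
- split=> [r g h [bg Kg] [bh Kh]|g_ g M Kg_ g_M cg].
    split; last by move=> s b; rewrite !FZ// Kg Kh.
    by apply: bounded_measurableD => //; apply: bounded_measurableM => //; exact:
      bounded_measurable_cst.
  have bg : bounded_measurable g.
    split.
      by apply: measurable_fun_cvg (fun n => (Kg_ n).1.1) _ => x _; exact: cg.
    exists M => x; have cn : `|g_ n x| @[n --> \oo] --> `|g x| by apply: cvg_norm; exact: cg.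
    rewrite -(cvg_lim (@Rhausdorff R) cn); apply: limr_le; first by apply/cvg_ex; eexists; exact:
      cn.
    by apply: nearW => n; exact: g_M.
  split => // s b.
  have cF d (T : measurableType d) (P : probability T R) (Y : I -> T -> R) :
      (forall i, measurable_fun setT (Y i)) ->
      \int[P]_w F _ _ Y s b (g_ n) w @[n --> \oo] --> \int[P]_w F _ _ Y s b g w.
    move=> mY; have [_ [N sN]] := bm_prod mY bs2.
    apply: (@Rintegral_bounded_cvg _ _ _ _ _ _ (M * N)).
    + by move=> n; exact: (bF _ _ _ _ _ _ mY (Kg_ n).1).1.
    + exact: (bF _ _ _ _ _ _ mY bg).1.
    + move=> n w; rewrite /F !normrM -[leRHS]mul1r ler_pM ?mulr_ge0//; first exact: cos_max.
      by rewrite ler_pM.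
    + apply: aeW => w; rewrite /F; apply: cvgM; first exact: cvg_cst.
      by apply: cvgM; [exact: cg|exact: cvg_cst].
  have := cF _ _ P1 Y1 mY1; under eq_fun do rewrite (Kg_ _).2.
  by move=> /(cvg_unique (@Rhausdorff R)); apply; exact: cF.
- move=> a c; split.
    by apply: bounded_measurable_cos; apply: measurable_funD => //; exact: measurable_funM.
  have E d (T : measurableType d) (P : probability T R) (Y : I -> T -> R) s b :
      (forall i, measurable_fun setT (Y i)) ->
      \int[P]_w F _ _ Y s b (fun x => cos (a * x + c)) w =
      2^-1 * \int[P]_w (cos (lincomb Y ((a, i) :: s) w + (b + c)) * \prod_(p <- s2) p.2 (Y p.1 w)) +
      2^-1 * \int[P]_w (cos (lincomb Y ((- a, i) :: s) w + (b - c)) * \prod_(p <- s2) p.2 (Y p.1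
        w)).
    move=> mY.
    have bc s' b' : bounded_measurable
        (fun w => cos (lincomb Y s' w + b') * \prod_(p <- s2) p.2 (Y p.1 w)).
      by apply: bounded_measurableM; [exact: bm_cos|exact: bm_prod].
    rewrite -!RintegralZl//; try exact/bounded_measurable_integrable/bc.
    rewrite -RintegralD//; try by apply/bounded_measurable_integrable/bounded_measurableM => //;
      exact: bounded_measurable_cst.
    apply: eq_Rintegral => w _; rewrite /F mulrA cos_mul_cos mulrDl -!mulrA.
    by congr (_ * (cos _ * _) + _ * (cos _ * _)); rewrite /lincomb big_cons /=; ring.
  by move=> s b; rewrite !E// !IH.
Qed.

(** An index may recur in the list, so that intersecting cylinders amounts to concatenating
    lists. *)
Fixpoint cylinder (J : Type) (s : seq (J * set R)) (y : J -> R) : Prop :=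
  if s is p :: s' then p.2 (y p.1) /\ cylinder s' y else True.

Lemma measurable_cylinder d (T : measurableType d) (J : Type) (Y : J -> T -> R)
    (s : seq (J * set R)) :
  (forall j, measurable_fun setT (Y j)) -> all (fun p => `[< measurable p.2 >]) s ->
  measurable [set w | cylinder s (Y^~ w)].
Proof.
move=> mY; elim: s => [|[j A] s IH] /=.
  by rewrite (_ : [set _ | _] = setT)//; apply/seteqP; split.
move=> /andP[/asboolP mA /IH ms].
rewrite (_ : [set _ | _] = (Y j @^-1` A) `&` [set w | cylinder s (Y^~ w)])//.
by apply: measurableI => //; rewrite -[X in measurable X]setTI; exact: mY.
Qed.

Lemma indic_cylinder (T J : Type) (Y : J -> T -> R) (s : seq (J * set R)) w :
  \1_[set w | cylinder s (Y^~ w)] w = \prod_(p <- s) (\1_(p.2) (Y p.1 w) : R).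
Proof.
elim: s => [|[j A] s IH]; first by rewrite big_nil indicE mem_set.
rewrite big_cons/= -IH !indicE -natrM mulnb; congr (nat_of_bool _)%:R.
apply/idP/andP; first by rewrite !inE.
by rewrite !inE => -[].
Qed.

Lemma fdd_cylinder (s : seq (I * set R)) : all (fun p => `[< measurable p.2 >]) s ->
  P1 [set w | cylinder s (Y1^~ w)] = P2 [set w | cylinder s (Y2^~ w)].
Proof.
move=> ms.
(* With the empty combination and phase 0 the leading cosine is 1, and only the product of
   indicators remains. *)
have PE d (T : measurableType d) (P : probability T R) (Y : I -> T -> R) :
    (forall i, measurable_fun setT (Y i)) ->
    P [set w | cylinder s (Y^~ w)] =
    (\int[P]_w (cos (lincomb Y [::] w + 0) *
      \prod_(p <- [seq (p.1, \1_(p.2) : R -> R) | p <- s]) p.2 (Y p.1 w)))%:E.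
  move=> mY; rewrite -[LHS]fineK; last first.
    by rewrite fin_num_measure//; exact: measurable_cylinder.
  congr EFin; rewrite /Rintegral -[in LHS](setIT [set _ | _]).
  rewrite -integral_indic//; last exact: measurable_cylinder.
  congr fine; apply: eq_integral => w _; congr EFin.
  rewrite indic_cylinder /lincomb big_nil addr0 cos0 mul1r big_map.
  by [].
rewrite !PE// fdd_expectation//.
elim: s ms {PE} => //= [[i A] s IH] /= /andP[/asboolP mA /IH ->]; rewrite andbT.
apply/asboolP; exact: bounded_measurable_indic.
Qed.

End finite_dimensional_laws.

(** * The space of continuous paths with its cylinder sigma-algebra *)

Section continuous_path_space.
Variable R : realType.

(** Every continuous process factors through this space, and [measurable_c0_path] for the coordinate
    process makes [c0_path] a measurable map from it to C_(0). Agreement on cylinders therefore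
    reaches the Borel sets of C_(0) without an analysis of those sets. *)
Definition cpath_pred : {pred R -> R} := fun f => `[< {within `[0, +oo[, continuous f} >].

Record cpath := MkCpath { cpath_fun :> R -> R ; _ : cpath_fun \in cpath_pred }.

HB.instance Definition _ := [isSub for cpath_fun].
HB.instance Definition _ := [Choice of cpath by <:].

Lemma cpath_pred0 : (fun=> 0) \in cpath_pred.
Proof. by apply/asboolP; exact: cst_continuous. Qed.

HB.instance Definition _ := isPointed.Build cpath (MkCpath cpath_pred0).

(* Times enter through their absolute values, so that any real is a legitimate index. *)
Definition cpath_cylinders : set (set cpath) :=
  [set A | exists2 s : seq (R * set R), all (fun p => `[< measurable p.2 >]) s
    & A = [set f : cpath | cylinder s (fun t => f `|t|)]].

Definition cpath_space := g_sigma_algebraType cpath_cylinders.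

Lemma cpath_cylinders_setI : setI_closed cpath_cylinders.
Proof.
move=> _ _ [s ms ->] [r mr ->]; exists (s ++ r); first by rewrite all_cat ms.
apply/seteqP; split => f /=.
  by move=> [fs fr]; elim: s fs {ms} => //= p s IH [? /IH].
by elim: s {ms} => //= p s IH [? /IH[]].
Qed.

Lemma continuous_process_eval :
  continuous_process `[0, +oo[ (fun t (f : cpath_space) => f t).
Proof.
split=> [t|f]; last exact/asboolP/(valP f).
rewrite /= in_itv/= andbT => t0 _ A mA; rewrite setTI; apply: sub_sigma_algebra.
exists [:: (t, A)]; first by rewrite /= andbT; exact/asboolP.
by apply/seteqP; split => f /=; rewrite ger0_norm// => -[].
Qed.

Section process_path.
Context d (T : measurableType d) (Y : R -> T -> R).
Hypothesis cY : continuous_process `[0, +oo[ Y.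

Definition process_cpath (w : T) : cpath_space := MkCpath (asboolT (cY.2 w)).

Lemma measurable_process_cpath : measurable_fun setT process_cpath.
Proof.
apply: (@measurability _ _ T cpath_space setT process_cpath cpath_cylinders) => // _ [_ [s ms ->]
  <-].
rewrite setTI; apply: (@measurable_cylinder R _ T R (fun t w => Y `|t| w)) => // t.
by apply: cY.1; rewrite /= in_itv/= normr_ge0.
Qed.

End process_path.

Lemma lipschitz_measurable (E : normedModType R) (f : E -> R) (L : R) :
  (forall x y, `|f x - f y| <= L * `|x - y|) -> measurable_fun setT (f : borel E -> R).
Proof.
(* The sign of [L] is free; its maximum with 1 is a Lipschitz constant by which one can divide. *)
move=> fL; have L0 : 0 <= Num.max L 1 by rewrite le_max ler01 orbT.
have cf : continuous f.
  move=> x; apply/cvgrPdist_le => e e0; apply/nbhs_ballP.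
  have L1 : 0 < Num.max L 1 by rewrite lt_max ltr01 orbT.
  exists (e / Num.max L 1) => /=; first by rewrite divr_gt0.
  move=> y; rewrite -ball_normE /ball_ /= => /ltW.
  rewrite ler_pdivlMr// => h; rewrite (le_trans (fL _ _))//.
  by rewrite (le_trans _ h)// mulrC ler_wpM2l// le_max lexx.
apply: (@measurability _ _ (borel E) R setT f (@RGenOpens.G R) (RGenOpens.measurableE R)) => _ [_
  [a [b ->]] <-].
rewrite setTI; apply: sub_sigma_algebra.
by move/continuousP : cf; apply; exact: interval_open.
Qed.

End continuous_path_space.

(** * Transfer of path laws between two probability spaces *)

Section law_transfer.
Context d1 d2 (T1 : measurableType d1) (T2 : measurableType d2) (R : realType).
Context (P1 : probability T1 R) (P2 : probability T2 R).
Context (Y1 : R -> T1 -> R) (Y2 : R -> T2 -> R).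
Hypothesis cY1 : continuous_process `[0, +oo[ Y1.
Hypothesis cY2 : continuous_process `[0, +oo[ Y2.
Hypothesis cosE : forall (s : seq (R * R)) b, all (fun p => 0 <= p.2) s ->
  \int[P1]_w cos (lincomb Y1 s w + b) = \int[P2]_w cos (lincomb Y2 s w + b).

Lemma cpath_law_unique (A : set (cpath_space R)) : measurable A ->
  P1 (process_cpath cY1 @^-1` A) = P2 (process_cpath cY2 @^-1` A).
Proof.
pose f1 : {mfun T1 >-> cpath_space R} := mfun_Sub (mem_set (measurable_process_cpath cY1)).
pose f2 : {mfun T2 >-> cpath_space R} := mfun_Sub (mem_set (measurable_process_cpath cY2)).
apply: (@measure_unique _ R (cpath_space R) (@cpath_cylinders R) (fun=> setT)
  erefl (@cpath_cylinders_setI R) _ _ (distribution P1 f1) (distribution P2 f2)).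
- by move=> _; exists [::] => //; apply/seteqP; split.
- by rewrite bigcup_const.
- move=> _ [s ms ->].
  apply: (@fdd_cylinder _ _ _ _ R P1 P2 R (fun t => Y1 `|t|) (fun t => Y2 `|t|)) => //.
  + by move=> t; apply: cY1.1; rewrite /= in_itv/= normr_ge0.
  + by move=> t; apply: cY2.1; rewrite /= in_itv/= normr_ge0.
  + move=> r b; have E T (Y : R -> T -> R) w : lincomb (fun t => Y `|t|) r w =
        lincomb Y [seq (p.1, `|p.2|) | p <- r] w.
      by rewrite /lincomb big_map.
    under eq_Rintegral do rewrite E; under [RHS]eq_Rintegral do rewrite E.
    by apply: cosE; rewrite all_map; apply/allP => p _ /=.
- by move=> _; rewrite (le_lt_trans (probability_le1 _ _))// ltry.
Qed.

(** By conversion, [c0_path] of a process is [c0_path] of the coordinate process taken at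
    [process_cpath], so [A] pulls back to a measurable set of continuous paths. *)
Lemma path_law_unique (A : set (borel (C0 R))) : measurable A ->
  path_law P1 cY1 A = path_law P2 cY2 A.
Proof.
move=> mA; have := measurable_c0_path (continuous_process_eval R).
move=> /(_ measurableT _ mA); rewrite setTI => /cpath_law_unique; exact.
Qed.

(** This carries to a second process the information that its paths are not lost by [c0_path]. A
    fixed time keeps the event measurable on the space of continuous paths, and countably many times
    will do later. *)
Lemma c0_path_eval_transfer t : 0 <= t ->
  {ae P1, forall w, c0_path Y1 w t = Y1 t w} -> {ae P2, forall w, c0_path Y2 w t = Y2 t w}.
Proof.
move=> t0.
pose ev t (f : cpath_space R) := f t.
pose A : set (cpath_space R) := [set f | c0_path ev f t = f t].
have mA : measurable A.
  have me : measurable_fun setT (fun f : cpath_space R => c0_path ev f t).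
    apply: (@measurableT_comp _ _ _ _ _ _ (fun f : borel (C0 R) => f t)).
      apply: (@lipschitz_measurable _ (C0 R) _ (1 + `|t|)) => f g.
      by rewrite mulrC; exact: (c0_norm_ub (f - g) t).
    exact: measurable_c0_path (continuous_process_eval R).
  have mt : measurable_fun setT (fun f : cpath_space R => f t).
    by apply: (continuous_process_eval R).1; rewrite /= in_itv/= t0.
  rewrite (_ : A = (fun f : cpath_space R => c0_path ev f t - f t) @^-1` [set 0]).
    by rewrite -[X in measurable X]setTI; apply: (measurable_funB me mt).
  by apply/seteqP; split => f /=; [move=> ->; rewrite subrr|move/subr0_eq].
have E d (T : measurableType d) (Y : R -> T -> R) (cY : continuous_process `[0, +oo[ Y) :
    ~` [set w | c0_path Y w t = Y t w] = process_cpath cY @^-1` (~` A) by [].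
have mE d (T : measurableType d) (Y : R -> T -> R) (cY : continuous_process `[0, +oo[ Y) :
    measurable (process_cpath cY @^-1` (~` A)).
  rewrite -[X in measurable X]setTI; apply: (measurable_process_cpath cY) => //.
  exact: measurableC.
move=> h1; apply/negligibleP; rewrite (E _ _ _ cY2); first exact: mE.
apply: (etrans (esym (cpath_law_unique (measurableC mA)))).
by move/negligibleP : h1; rewrite (E _ _ _ cY1); apply; exact: mE.
Qed.

End law_transfer.

(** * Integrals of functions of equally distributed variables *)

Section equality_in_law.
Context d1 d2 (T1 : measurableType d1) (T2 : measurableType d2) (R : realType).
Context (P1 : probability T1 R) (P2 : probability T2 R) (Z1 : T1 -> R) (Z2 : T2 -> R).
Hypotheses (mZ1 : measurable_fun setT Z1) (mZ2 : measurable_fun setT Z2).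
Hypothesis Z12 : forall B : set R, measurable B -> P1 (Z1 @^-1` B) = P2 (Z2 @^-1` B).

Lemma eq_law_ge0_integral (f : R -> \bar R) : measurable_fun setT f ->
  (forall x, 0 <= f x)%E -> (\int[P1]_w f (Z1 w) = \int[P2]_w f (Z2 w))%E.
Proof.
move=> mf f0.
pose z1 : {mfun T1 >-> R} := mfun_Sub (mem_set mZ1).
pose z2 : {mfun T2 >-> R} := mfun_Sub (mem_set mZ2).
transitivity (\int[distribution P1 z1]_x f x)%E; first by rewrite ge0_integral_distribution.
transitivity (\int[distribution P2 z2]_x f x)%E; last by rewrite ge0_integral_distribution.
by apply: eq_measure_integral => B mB _; exact: Z12.
Qed.

Lemma eq_law_integral (f : R -> \bar R) : measurable_fun setT f ->
  (\int[P1]_w f (Z1 w) = \int[P2]_w f (Z2 w))%E.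
Proof.
move=> mf; rewrite integralE [RHS]integralE.
have E d (T : measurableType d) (P : probability T R) (Z : T -> R) :
    (\int[P]_w (fun w => f (Z w))^\+ w = \int[P]_w f^\+ (Z w))%E /\
    (\int[P]_w (fun w => f (Z w))^\- w = \int[P]_w f^\- (Z w))%E.
  by split; apply: eq_integral => w _; rewrite ?funeposE ?funenegE.
rewrite !(E _ _ _ _).1 !(E _ _ _ _).2; congr (_ - _)%E; apply: eq_law_ge0_integral => //.
  exact: measurable_funepos.
exact: measurable_funeneg.
Qed.

End equality_in_law.

(** * Moments, exponential moments and tails of the normal law *)

Section normal_law.
Variable R : realType.
Notation mu := (@lebesgue_measure R).
Implicit Types (m s x : R) (f : R -> R).

Lemma integrable_normal_pdfM m s f : bounded_measurable f ->
  mu.-integrable setT (EFin \o (fun x => f x * normal_pdf m s x)).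
Proof.
move=> [mf [M fM]].
apply: le_integrable (integrableZl measurableT M (integrable_normal_pdf m s)) => //.
- apply/measurable_EFinP/measurable_funM => //; exact: measurable_normal_pdf.
- move=> x _ /=; rewrite lee_fin !normrM (ger0_norm (normal_pdf_ge0 _ _ _)).
  by rewrite ler_wpM2r ?normal_pdf_ge0// (le_trans (fM x))// ler_norm.
Qed.

Lemma Rintegral_normal_prob m s f : bounded_measurable f ->
  \int[normal_prob m s]_x f x = \int[mu]_x (f x * normal_pdf m s x).
Proof.
move=> bf; pose K f := bounded_measurable f /\
  \int[normal_prob m s]_x f x = \int[mu]_x (f x * normal_pdf m s x).
suff [] : K f by [].
apply: indic_class bf; last first.
  move=> A mA; split; first exact: bounded_measurable_indic.
  rewrite /Rintegral integral_indic//= setIT; congr fine.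
  rewrite /normal_prob integral_mkcond; apply: eq_integral => x _.
  by rewrite patchE indicE; case: ifP; rewrite ?mul1r ?mul0r.
split=> [r g h [bg Kg] [bh Kh]|g_ g M Kg_ g_M cg].
  have brg : bounded_measurable (fun x => r * g x).
    by apply: bounded_measurableM => //; exact: bounded_measurable_cst.
  split; first exact: bounded_measurableD.
  rewrite RintegralD ?RintegralZl//; try exact: bounded_measurable_integrable.
  rewrite Kg Kh -RintegralZl//; last exact: integrable_normal_pdfM.
  rewrite -RintegralD//.
  - by apply: eq_Rintegral => x _; ring.
  - by under [X in _.-integrable _ X]eq_fun do rewrite /= mulrA; exact: (integrable_normal_pdfM _
    _ brg).
  - exact: integrable_normal_pdfM.
have bg : bounded_measurable g.
  split.
    by apply: measurable_fun_cvg (fun n => (Kg_ n).1.1) _ => x _; exact: cg.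
  exists M => x; have cn : `|g_ n x| @[n --> \oo] --> `|g x| by apply: cvg_norm; exact: cg.
  rewrite -(cvg_lim (@Rhausdorff R) cn); apply: limr_le; first by apply/cvg_ex; eexists; exact: cn.
  by apply: nearW => n; exact: g_M.
split => //.
have c1 : \int[normal_prob m s]_x g_ n x @[n --> \oo] --> \int[normal_prob m s]_x g x.
  apply: (@Rintegral_bounded_cvg _ _ _ _ _ _ M) => //.
  + by move=> n; exact: (Kg_ n).1.1.
  + exact: bg.1.
  + by apply: aeW => x; exact: cg.
have c2 : \int[mu]_x (g_ n x * normal_pdf m s x) @[n --> \oo] -->
    \int[mu]_x (g x * normal_pdf m s x).
  apply: (@Rintegral_dominated_cvg _ _ R mu _ _ (fun x => M * normal_pdf m s x)).
  + by move=> n; apply: measurable_funM; [exact: (Kg_ n).1.1|exact: measurable_normal_pdf].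
  + by apply: measurable_funM; [exact: bg.1|exact: measurable_normal_pdf].
  + exact: (integrableZl measurableT M (integrable_normal_pdf m s)).
  + move=> n x; rewrite normrM (ger0_norm (normal_pdf_ge0 _ _ _)).
    by rewrite ler_wpM2r ?normal_pdf_ge0.
  + by apply: aeW => x; apply: cvgM; [exact: cg|exact: cvg_cst].
move: c1; under eq_fun do rewrite (Kg_ _).2.
by move=> /(cvg_unique (@Rhausdorff R)); apply.
Qed.

Lemma ge0_integral_normal_prob m s f : measurable_fun setT f -> (forall x, 0 <= f x) ->
  (\int[normal_prob m s]_x (f x)%:E = \int[mu]_x (f x * normal_pdf m s x)%:E)%E.
Proof.
move=> mf f0.
pose f_ n x := Num.min (f x) n%:R.
have mf_ n : measurable_fun setT (f_ n) by exact: measurable_minr.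
have f_0 n x : 0 <= f_ n x by rewrite le_min f0 ler0n.
have bf_ n : bounded_measurable (f_ n).
  by split => //; exists n%:R => x; rewrite ger0_norm// ge_min lexx orbT.
have f_nd x n k : (n <= k)%N -> f_ n x <= f_ k x.
  by move=> nk; rewrite le_min !ge_min lexx/= ler_nat nk orbT.
have cf_ x : f_ n x @[n --> \oo] --> f x.
  apply: cvg_near_cst; exists (Num.truncn (f x)).+1 => // n /= fn.
  by rewrite /f_ min_l// (le_trans (ltW (truncnS_gt _)))// ler_nat.
have -> : (\int[normal_prob m s]_x (f x)%:E =
    limn (fun n => \int[normal_prob m s]_x (f_ n x)%:E))%E.
  rewrite -monotone_convergence//.
  - by apply: eq_integral => x _; apply/esym/cvg_lim => //; apply: cvg_EFin; [exact: nearW|exact: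
    cf_].
  - by move=> n; apply/measurable_EFinP; exact: mf_.
  - by move=> n x _; rewrite lee_fin.
  - by move=> x _ n k nk; rewrite lee_fin f_nd.
have -> : (\int[mu]_x (f x * normal_pdf m s x)%:E =
    limn (fun n => \int[mu]_x (f_ n x * normal_pdf m s x)%:E))%E.
  rewrite -monotone_convergence//.
  - apply: eq_integral => x _; apply/esym/cvg_lim => //; apply: cvg_EFin; first exact: nearW.
    by apply: cvgM; [exact: cf_|exact: cvg_cst].
  - by move=> n; apply/measurable_EFinP; apply: measurable_funM; [exact: mf_|exact:
    measurable_normal_pdf].
  - by move=> n x _; rewrite lee_fin mulr_ge0// normal_pdf_ge0.
  - by move=> x _ n k nk; rewrite lee_fin ler_wpM2r ?normal_pdf_ge0 ?f_nd.
congr (limn _); apply/funext => n.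
have i1 := integrable_fin_num measurableT
  (bounded_measurable_integrable (normal_prob m s) (bf_ n)).
have i2 := integrable_fin_num measurableT (integrable_normal_pdfM m s (bf_ n)).
rewrite -[LHS](fineK i1) -[RHS](fineK i2).
by congr EFin; exact: Rintegral_normal_prob.
Qed.

Lemma is_derive_normal_pdf m s x : s != 0 ->
  is_derive x 1 (normal_pdf m s) (- (x - m) / s ^+ 2 * normal_pdf m s x).
Proof.
move=> s0; rewrite normal_pdfE//.
have h : is_derive x 1 (fun x => - (x - m) ^+ 2 / (s ^+ 2 *+ 2)) (- (x - m) / s ^+ 2).
  by apply: is_derive_eq; rewrite /GRing.scale/=; field.
have he : is_derive x 1 (normal_fun m s)
    (expR (- (x - m) ^+ 2 / (s ^+ 2 *+ 2)) * (- (x - m) / s ^+ 2)).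
  exact: is_derive1_comp.
by apply: is_derive_eq; rewrite /GRing.scale/= /normal_fun; ring.
Qed.

Lemma Rintegral_derive (F f : R -> R) a b : a < b -> continuous f ->
  (forall x, is_derive x 1 F (f x)) -> \int[mu]_(x in `[a, b]) f x = F b - F a.
Proof.
move=> ab cf dF.
have cF : continuous F.
  by move=> x; apply/differentiable_continuous/derivable1_diffP; exact: ex_derive.
rewrite /Rintegral (@continuous_FTC2 _ f F a b ab)//.
- exact: continuous_subspaceT.
- split => [x _| |]; first exact: ex_derive.
    by apply: cvg_at_right_filter; exact: cF.
  by apply: cvg_at_left_filter; exact: cF.
- by move=> x _; rewrite derive1E; exact: derive_val.
Qed.

Lemma Rintegral_symitv_cvg m (f : R -> R) : mu.-integrable setT (EFin \o f) ->
  \int[mu]_(x in `[m - n.+1%:R, m + n.+1%:R]) f x @[n --> \oo] --> \int[mu]_x f x.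
Proof.
move=> intf; have /measurable_EFinP mf := measurable_int mu intf.
under eq_fun do rewrite Rintegral_mkcond.
apply: (@Rintegral_dominated_cvg _ _ R mu _ _ (fun x => `|f x|)) => //.
- move=> n; have mI := measurable_itv `[m - n.+1%:R, m + n.+1%:R].
  exact: ((measurable_restrictT f mI).1 (measurable_funTS mf)).
- exact: (integrable_abse intf).
- by move=> n x; rewrite patchE; case: ifP => // _; rewrite normr0.
- apply: aeW => x; apply: cvg_near_cst; exists (Num.truncn `|x - m|) => // n /= nx.
  rewrite patchE ifT// inE/= in_itv/= -ler_distl (le_trans (ltW (truncnS_gt _)))//.
  by rewrite ler_nat.
Qed.

Lemma continuous_normal_pdfM (f : R -> R) m s : s != 0 -> continuous f ->
  continuous (fun x => f x * normal_pdf m s x).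
Proof. by move=> s0 cf x; apply: cvgM; [exact: cf|exact: continuous_normal_pdf]. Qed.

Lemma continuous_sqrB m : continuous (fun x : R => (x - m) ^+ 2).
Proof.
move=> x; apply: (@continuous_comp _ _ _ (fun x : R => x - m) (fun x => x ^+ 2)).
  by apply: cvgB; [exact: cvg_id|exact: cvg_cst].
exact: sqr_continuous.
Qed.

Lemma normal_pdf_sym m s x : normal_pdf m s (m - x) = normal_pdf m s (m + x) \/ s = 0.
Proof.
have [->|s0] := eqVneq s 0; [by right|left]; rewrite !normal_pdfE//.
by rewrite /normal_fun (_ : m - x - m = - (m + x - m)) ?sqrrN//; ring.
Qed.

Lemma Rintegral_normal_centered m s (n : nat) : s != 0 ->
  \int[mu]_(x in `[m - n.+1%:R, m + n.+1%:R]) ((x - m) * normal_pdf m s x) = 0.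
Proof.
move=> s0.
transitivity (- s ^+ 2 * normal_pdf m s (m + n.+1%:R)
  - (- s ^+ 2 * normal_pdf m s (m - n.+1%:R))); last first.
  by have [->|/eqP] := normal_pdf_sym m s n.+1%:R; [rewrite subrr|rewrite (negbTE s0)].
apply: (@Rintegral_derive (fun x => - s ^+ 2 * normal_pdf m s x)).
- by rewrite ltrD2l gtrN.
- have c1 : continuous (fun x : R => x - m).
    by move=> x; apply: cvgB; [exact: cvg_id|exact: cvg_cst].
  exact: (continuous_normal_pdfM s0 c1).
- move=> x; have := is_derive_normal_pdf m x s0 => h.
  by apply: is_derive_eq; rewrite /GRing.scale/=; field.
Qed.

(** The integrand has the antiderivative -s^2 (x - m) times the density. The boundary term is kept
    exactly: its sign gives integrability of the square, and its limit 0 gives the variance. *)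
Lemma Rintegral_normal_sqr m s (n : nat) : s != 0 ->
  \int[mu]_(x in `[m - n.+1%:R, m + n.+1%:R])
     ((x - m) ^+ 2 * normal_pdf m s x - s ^+ 2 * normal_pdf m s x) =
  - (2 * s ^+ 2 * n.+1%:R * normal_pdf m s (m + n.+1%:R)).
Proof.
move=> s0.
pose F x := - s ^+ 2 * ((x - m) * normal_pdf m s x).
transitivity (F (m + n.+1%:R) - F (m - n.+1%:R)); last first.
  rewrite /F; have [->|/eqP] := normal_pdf_sym m s n.+1%:R; last by rewrite (negbTE s0).
  ring.
apply: Rintegral_derive.
- by rewrite ltrD2l gtrN.
- have c1 := continuous_normal_pdfM (m := m) s0 (continuous_sqrB (m := m)).
  have cc : continuous (fun _ : R => s ^+ 2) by exact: cst_continuous.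
  have c2 := continuous_normal_pdfM (m := m) s0 cc.
  by move=> x; exact: continuousB (c1 x) (c2 x).
- move=> x; have := is_derive_normal_pdf m x s0 => h.
  by apply: is_derive_eq; rewrite /GRing.scale/=; field.
Qed.

Lemma integrable_normal_sqr m s : s != 0 ->
  mu.-integrable setT (EFin \o (fun x => (x - m) ^+ 2 * normal_pdf m s x)).
Proof.
move=> s0.
have f0 x : 0 <= (x - m) ^+ 2 * normal_pdf m s x.
  by rewrite mulr_ge0 ?sqr_ge0 ?normal_pdf_ge0.
have cf : continuous (fun x => (x - m) ^+ 2 * normal_pdf m s x).
  exact: (continuous_normal_pdfM s0 (continuous_sqrB (m := m))).
have mf : measurable_fun setT (fun x => (x - m) ^+ 2 * normal_pdf m s x).
  exact: continuous_measurable_fun.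
apply/integrableP; split; first exact/measurable_EFinP.
under eq_integral do rewrite /= ger0_norm//.
pose J (n : nat) : set R := `[m - n.+1%:R, m + n.+1%:R]%classic.
have UJ : \bigcup_n J n = setT.
  apply/seteqP; split => // x _; exists (Num.truncn `|x - m|) => //.
  by rewrite /J/= in_itv/= -ler_distl ltW// truncnS_gt.
rewrite -UJ.
have := @ge0_nondecreasing_set_cvg_integral _ (measurableTypeR R) R J
  (fun x => ((x - m) ^+ 2 * normal_pdf m s x)%:E) mu.
have ndJ : {homo J : n k / (n <= k)%N >-> (n <= k)%O}.
  move=> a b ab; apply/subsetPset => x; rewrite /J/= !in_itv/= -!ler_distl => /le_trans; apply.
  by rewrite ler_nat.
have mJ n : measurable_fun (J n) (fun x => ((x - m) ^+ 2 * normal_pdf m s x)%:E).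
  by apply: measurable_funTS; exact/measurable_EFinP.
have f0' n x : J n x -> (0 <= ((x - m) ^+ 2 * normal_pdf m s x)%:E)%E.
  by rewrite lee_fin.
move=> /(_ ndJ (fun n => measurable_itv _) mJ f0')/cvg_lim <-//.
apply: (@le_lt_trans _ _ (s ^+ 2)%:E); last exact: ltry.
apply: lime_le.
  apply: ereal_nondecreasing_is_cvgn.
  by apply: ge0_nondecreasing_set_nondecreasing_integral => // n; exact: measurable_itv.
apply: nearW => n.
have iJ (g : R -> R) : continuous g -> mu.-integrable (J n) (EFin \o g).
  move=> cg; apply: continuous_compact_integrable; first exact: segment_compact.
  exact: continuous_subspaceT.
have i1 := iJ _ cf.
have i0 := iJ _ (continuous_normal_pdf (m := m) s0).
have mJn : measurable (J n : set (measurableTypeR R)) by exact: measurable_itv.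
have i2 : mu.-integrable (J n) (EFin \o (fun x => s ^+ 2 * normal_pdf m s x)).
  have cc : continuous (fun _ : R => s ^+ 2) by exact: cst_continuous.
  by apply: iJ; exact: (continuous_normal_pdfM s0 cc).
have fin1 := integrable_fin_num mJn i1.
have fin0 := integrable_fin_num mJn i0.
rewrite -(fineK fin1) lee_fin.
have := Rintegral_normal_sqr m n s0; rewrite RintegralB//.
rewrite /Rintegral -/(J n) => h.
have le1 : fine (\int[mu]_(x in J n) (s ^+ 2 * normal_pdf m s x)%:E) <= s ^+ 2.
  rewrite -/(Rintegral _ _ _) RintegralZl// ler_piMr ?sqr_ge0//.
  rewrite /Rintegral -lee_fin (fineK fin0).
  rewrite -(integral_normal_pdf m s); apply: ge0_subset_integral => //.
  - by apply/measurable_EFinP; exact: measurable_normal_pdf.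
  - by move=> x _; rewrite lee_fin normal_pdf_ge0.
have : 0 <= 2 * s ^+ 2 * n.+1%:R * normal_pdf m s (m + n.+1%:R).
  by do 3 rewrite mulr_ge0 ?sqr_ge0 ?normal_pdf_ge0//.
by move: h le1; set u := fine _; set v := fine _; lra.
Qed.

Lemma integrable_normal_centered m s : s != 0 ->
  mu.-integrable setT (EFin \o (fun x => (x - m) * normal_pdf m s x)).
Proof.
move=> s0; have i1 := integrableD measurableT (integrable_normal_pdf m s) (integrable_normal_sqr
  m s0).
apply: le_integrable i1 => //.
  apply/measurable_EFinP/measurable_funM; last exact: measurable_normal_pdf.
  exact: measurable_funB.
move=> x _ /=; rewrite lee_fin -[X in _ <= `|X + _|]mul1r -mulrDl !normrM.
rewrite ler_wpM2r// [leRHS]ger0_norm ?addr_ge0 ?sqr_ge0//.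
rewrite -real_normK ?num_real//; move: `|x - m| (normr_ge0 (x - m)) => u u0.
by have := sqr_ge0 (u - 1); nra.
Qed.

Lemma Rintegral_normal_mean m s : s != 0 ->
  \int[mu]_x ((x - m) * normal_pdf m s x) = 0.
Proof.
move=> s0; have := @Rintegral_symitv_cvg m _ (integrable_normal_centered m s0).
under eq_fun do rewrite Rintegral_normal_centered//.
by move=> /(cvg_unique (@Rhausdorff R))/(_ (cvg_cst _)).
Qed.

Lemma Rintegral_normal_variance m s : s != 0 ->
  \int[mu]_x ((x - m) ^+ 2 * normal_pdf m s x) = s ^+ 2.
Proof.
move=> s0; have i1 := integrable_normal_sqr m s0.
have i2 := integrableZl measurableT (s ^+ 2) (integrable_normal_pdf m s).
have := @Rintegral_symitv_cvg m _ (integrableB measurableT i1 i2).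
under eq_fun do rewrite Rintegral_normal_sqr//.
rewrite RintegralB// RintegralZl//; last exact: integrable_normal_pdf.
have -> : \int[mu]_x normal_pdf m s x = 1 by rewrite /Rintegral integral_normal_pdf.
rewrite mulr1 => c1.
have c2 : - (2 * s ^+ 2 * n.+1%:R * normal_pdf m s (m + n.+1%:R)) @[n --> \oo] --> (0 : R).
  rewrite -oppr0; apply: cvgN.
  (* With N = n + 1 and y = N^2 / (2 s^2), the bound e^(-y) <= 1 / y turns the boundary term 2 s^2 N
     [normal_peak s] e^(-y) into at most C / N. *)
  pose C := 4 * s ^+ 2 * normal_peak s * s ^+ 2.
  apply: (@squeeze_cvgr _ _ _ _ (cst 0) (fun n => C * n.+1%:R^-1)).
  - apply: nearW => n; apply/andP; split.
      by rewrite /= mulr_ge0 ?normal_pdf_ge0// mulr_ge0// mulr_ge0// sqr_ge0.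
    rewrite normal_pdfE// /normal_fun addrAC subrr add0r mulNr expRN.
    set N : R := n.+1%:R; have N0 : 0 < N by rewrite /N ltr0n.
    have s2 : 0 < s ^+ 2 by rewrite exprn_even_gt0.
    have := expR_ge1Dx (N ^+ 2 / (s ^+ 2 *+ 2)).
    set e := expR _ => e1; have e0 : 0 < e by exact: expR_gt0.
    have ee : N ^+ 2 / (s ^+ 2 *+ 2) <= e by lra.
    have pk := normal_peak_gt0 s0.
    have NN : N ^+ 2 <= 2 * s ^+ 2 * e.
      by move: ee; rewrite ler_pdivrMr ?pmulrn_rgt0// => /le_trans; apply; lra.
    rewrite -subr_ge0 (_ : _ - _ = 2 * s ^+ 2 * normal_peak s * (N^-1 / e) * (2 * s ^+ 2 * e - N
      ^+ 2)).
      apply: mulr_ge0; last by rewrite subr_ge0.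
      apply: mulr_ge0; last by rewrite divr_ge0 ?invr_ge0 ?(ltW e0) ?(ltW N0).
      by rewrite mulr_ge0 ?(ltW pk)// mulr_ge0// ltW.
    by rewrite /C; field; rewrite !gt_eqF.
  - exact: cvg_cst.
  - by rewrite -[X in _ --> X](mulr0 C); apply: cvgMr; exact: cvg_harmonic.
exact: subr0_eq (cvg_unique (@Rhausdorff R) c1 c2).
Qed.

(** Since v <= t, the factor exp(x^2 / (4 t)) removes at most half of the exponent -x^2 / (2 v).
    What remains is at most sqrt 2 times the density of variance 2 v, and sqrt 2 <= 2. *)
Lemma ge0_integral_normal_expsqr (v t : R) : 0 < v -> v <= t ->
  (\int[normal_prob 0 (Num.sqrt v)]_x (expR (x ^+ 2 / (4 * t)))%:E <= 2%:E)%E.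
Proof.
move=> v0 vt; have t0 : 0 < t by rewrite (lt_le_trans v0).
set s := Num.sqrt v; have s0 : s != 0 by rewrite gt_eqF// sqrtr_gt0.
have s2 : s ^+ 2 = v by rewrite sqr_sqrtr// ltW.
have me : measurable_fun setT (fun x : R => expR (x ^+ 2 / (4 * t))).
  by apply: measurableT_comp => //; apply: measurable_funM => //; exact: measurable_funX.
rewrite ge0_integral_normal_prob//.
set r := Num.sqrt (2 * v).
have r0 : r != 0 by rewrite gt_eqF// sqrtr_gt0 mulr_gt0.
have r2 : r ^+ 2 = 2 * v by rewrite sqr_sqrtr// mulr_ge0// ltW.
apply: (@le_trans _ _ (\int[mu]_x (2 * normal_pdf 0 r x)%:E)%E); last first.
  under eq_integral do rewrite EFinM.
  rewrite integralZl//; last exact: integrable_normal_pdf.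
  by rewrite integral_normal_pdf mule1.
apply: ge0_le_integral => //.
- by move=> x _; rewrite lee_fin mulr_ge0 ?expR_ge0 ?normal_pdf_ge0.
- by apply/measurable_EFinP/measurable_funM => //; exact: measurable_normal_pdf.
- by apply/measurable_EFinP/measurable_funM => //; exact: measurable_normal_pdf.
move=> x _; rewrite lee_fin !normal_pdfE// /normal_fun !subr0 mulrCA -expRD.
rewrite [leRHS]mulrA ler_pM//.
- exact: normal_peak_ge0.
- have vp : 0 < v * pi *+ 2 by rewrite pmulrn_lgt0// mulr_gt0// pi_gt0.
  rewrite /normal_peak s2 r2 -!mulrA -[(2 * _) *+ 2]mulrnAr sqrtrM// invfM mulrA.
  rewrite ler_peMl ?invr_ge0//.
  have h2 : 0 < Num.sqrt 2 :> R by rewrite sqrtr_gt0.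
  by rewrite ler_pdivlMr// mul1r -[leRHS](@sqr_sqrtr R 2)// expr2 ler_peMl ?(ltW h2)//
    -[leLHS]sqrtr1 ler_sqrt ?ler1n.
- rewrite ler_expR s2 r2.
  have v4 : x ^+ 2 / (4 * t) <= x ^+ 2 / (4 * v).
    by rewrite ler_wpM2l ?sqr_ge0// lef_pV2 ?posrE ?mulr_gt0// ler_pM2l.
  apply: le_trans (lerD v4 (lexx _)) _.
  by rewrite le_eqVlt; apply/orP; left; apply/eqP; field; rewrite gt_eqF.
Qed.

(** One interval of length s = sqrt v is enough: on [s y, s (y + 1)] the density is at least its
    value at the right end, and the factor sqrt(2 pi) is bounded by 4. *)
Lemma normal_prob_tail (v y : R) : 0 < v -> 0 <= y ->
  ((expR (- (y + 1) ^+ 2 / 2) / 4)%:E <=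
    normal_prob 0 (Num.sqrt v) `[(Num.sqrt v * y)%R, +oo[)%E.
Proof.
move=> v0 y0; set s := Num.sqrt v; have s0 : 0 < s by rewrite sqrtr_gt0.
have s1 : s != 0 by rewrite gt_eqF.
pose J : set R := `[s * y, s * (y + 1)]%classic.
have mJ : measurable (J : set (measurableTypeR R)) by exact: measurable_itv.
apply: (@le_trans _ _ (\int[mu]_(x in J) (normal_pdf 0 s x)%:E)%E); last first.
  apply: ge0_subset_integral => //.
  - by apply/measurable_funTS/measurable_EFinP; exact: measurable_normal_pdf.
  - by move=> x _; rewrite lee_fin normal_pdf_ge0.
  - by move=> x; rewrite /J/= !in_itv/= andbT => /andP[].
apply: (@le_trans _ _ (\int[mu]_(x in J) (cst (expR (- (y + 1) ^+ 2 / 2) / (4 * s))%:E x))%E).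
  rewrite integral_cst//= /J lebesgue_measure_itv/= lte_fin ltr_pM2l// ltrDl ltr01.
  rewrite -EFinD -EFinM lee_fin.
  by rewrite le_eqVlt; apply/orP; left; apply/eqP; field.
apply: ge0_le_integral => //.
- by move=> x _; rewrite lee_fin divr_ge0 ?expR_ge0// mulr_ge0// ltW.
- by apply/measurable_funTS/measurable_EFinP; exact: measurable_normal_pdf.
move=> x; rewrite /J/= in_itv/= => /andP[x0 x1].
rewrite lee_fin normal_pdfE// mulrC; apply: ler_pM.
- by rewrite invr_ge0 mulr_ge0// ltW.
- exact: expR_ge0.
- rewrite /normal_peak lef_pV2 ?posrE ?mulr_gt0 ?sqrtr_gt0//; last first.
    by rewrite pmulrn_lgt0// mulr_gt0 ?pi_gt0// exprn_even_gt0.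
  rewrite -[leRHS]ger0_norm ?mulr_ge0 ?(ltW s0)// -sqrtr_sqr ler_wsqrtr//.
  have := pihalf_lt2 R; rewrite exprMn -mulr_natr.
  have : 0 <= s ^+ 2 by exact: sqr_ge0.
  by nra.
- rewrite ler_expR /normal_fun subr0 !mulNr lerN2 ler_pdivrMr ?pmulrn_lgt0 ?exprn_even_gt0//.
  have xx : x ^+ 2 <= (s * (y + 1)) ^+ 2.
    by rewrite ler_pXn2r ?nnegrE// ?(le_trans _ x0) ?mulr_ge0 ?addr_ge0// ltW.
  apply: le_trans xx _; rewrite exprMn.
  by rewrite le_eqVlt; apply/orP; left; apply/eqP; field.
Qed.

End normal_law.

(** * Variables with a Gaussian law, possibly degenerate *)

Section gaussian_law.
Variable R : realType.
Notation mu := (@lebesgue_measure R).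

Lemma integral_normal_prob (m s : R) (f : R -> R) : measurable_fun setT f ->
  (\int[normal_prob m s]_x (f x)%:E = \int[mu]_x (f x * normal_pdf m s x)%:E)%E.
Proof.
move=> mf; rewrite integralE [RHS]integralE.
have mp : measurable_fun setT (fun x => Num.max (f x) 0) by exact: measurable_maxr.
have mn : measurable_fun setT (fun x => Num.max (- f x) 0).
  by apply: measurable_maxr => //; exact: measurableT_comp.
congr (_ - _)%E.
- transitivity (\int[normal_prob m s]_x (Num.max (f x) 0)%:E)%E.
    by apply: eq_integral => x _; rewrite funeposE EFin_max.
  rewrite ge0_integral_normal_prob// => [|x]; last by rewrite le_max lexx orbT.
  apply: eq_integral => x _; rewrite funeposE -EFin_max; congr EFin.
  by rewrite maxr_pMl ?normal_pdf_ge0// mul0r.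
- transitivity (\int[normal_prob m s]_x (Num.max (- f x) 0)%:E)%E.
    by apply: eq_integral => x _; rewrite funenegE EFin_max.
  rewrite ge0_integral_normal_prob// => [|x]; last by rewrite le_max lexx orbT.
  apply: eq_integral => x _; rewrite funenegE -EFinN -EFin_max; congr EFin.
  by rewrite maxr_pMl ?normal_pdf_ge0// mul0r mulNr.
Qed.

Context d (T : measurableType d) (P : probability T R) (G : T -> R).
Hypothesis mG : measurable_fun setT G.

Lemma gaussian_law_integral (m v : R) (f : R -> R) : 0 < v ->
  has_law P G (gaussian_law m v) -> measurable_fun setT f ->
  (\int[P]_w (f (G w))%:E = \int[normal_prob m (Num.sqrt v)]_x (f x)%:E)%E.
Proof.
move=> v0 hG mf.
apply: (@eq_law_integral _ _ _ _ _ P (normal_prob m (Num.sqrt v)) G id mG _ _ (EFin \o f)) => //.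
  by move=> B mB; rewrite hG// /gaussian_law gt_eqF.
exact/measurable_EFinP.
Qed.

Lemma gaussian_law0_integral (m : R) (f : R -> R) :
  has_law P G (gaussian_law m 0) -> measurable_fun setT f ->
  (\int[P]_w (f (G w))%:E = (f m)%:E)%E.
Proof.
move=> hG mf.
transitivity (\int[P]_w (f m)%:E)%E.
  apply: (@eq_law_integral _ _ _ _ _ P P G (cst m) mG _ _ (EFin \o f)) => //.
  move=> B mB; rewrite hG// /gaussian_law eqxx diracE; case: (boolP (m \in B)) => mB'.
    rewrite (_ : _ @^-1` _ = setT) ?probability_setT//.
    by apply/seteqP; split => // w _ /=; rewrite inE in mB'.
  rewrite (_ : _ @^-1` _ = set0) ?measure0//.
  by apply/seteqP; split => // w /=; rewrite notin_setE in mB'.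
  exact/measurable_EFinP.
by rewrite integral_cst//= probability_setT mule1.
Qed.

(** [gaussian_process] only says that some mean and variance exist; here they are recovered from the
    first two moments. The Dirac case v = 0 is separate because it has no density. *)
Lemma gaussian_law_moments (m v t : R) : 0 <= v ->
  has_law P G (gaussian_law m v) -> P.-integrable setT (EFin \o G) ->
  \int[P]_w G w = 0 -> \int[P]_w (G w ^+ 2) = t -> m = 0 /\ v = t.
Proof.
rewrite le_eqVlt => /predU1P[<-|v0] hG iG EG EG2.
  have m0 : m = 0.
    by rewrite -EG /Rintegral (@gaussian_law0_integral m id).
  split => //; rewrite -EG2 /Rintegral (@gaussian_law0_integral m (fun x => x ^+ 2))//=.
    by rewrite m0 expr0n.
have s0 : Num.sqrt v != 0 by rewrite gt_eqF// sqrtr_gt0.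
have mB : measurable_fun setT (fun x : R => x - m) by exact: measurable_funB.
have m0 : m = 0.
  have : \int[P]_w (G w - m) = 0.
    rewrite /Rintegral (@gaussian_law_integral m v (fun x => x - m))//.
    by rewrite integral_normal_prob//; exact: Rintegral_normal_mean.
  rewrite RintegralB//; last exact: finite_measure_integrable_cst.
  rewrite EG Rintegral_cst//= probability_setT/= mulr1 sub0r => /eqP.
  by rewrite oppr_eq0 => /eqP.
split => //; rewrite -EG2 /Rintegral (@gaussian_law_integral m v (fun x => x ^+ 2))//.
rewrite integral_normal_prob// -[LHS](@sqr_sqrtr R) ?(ltW v0)//.
rewrite -(Rintegral_normal_variance 0 s0) m0.
by apply: eq_Rintegral => x _; rewrite subr0.
Qed.

Lemma gaussian_law_expsqr (v t : R) : 0 <= v <= t -> 0 < t ->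
  has_law P G (gaussian_law 0 v) ->
  (\int[P]_w (expR (G w ^+ 2 / (4 * t)))%:E <= 2%:E)%E.
Proof.
move=> /andP[v0 vt] t0 hG.
have me : measurable_fun setT (fun x : R => expR (x ^+ 2 / (4 * t))).
  by apply: measurableT_comp => //; apply: measurable_funM => //; exact: measurable_funX.
move: v0; rewrite le_eqVlt => /predU1P[v0|v0].
  rewrite -v0 in hG; rewrite (gaussian_law0_integral hG me).
  by rewrite expr0n/= mul0r expR0 lee_fin ler1n.
by rewrite (gaussian_law_integral v0 hG me); exact: ge0_integral_normal_expsqr.
Qed.

End gaussian_law.

(** * Finite sums of integrable functions *)

Section Rintegral_extra.
Context d (T : measurableType d) (R : realType) (mu : {measure set T -> \bar R}).

Lemma integrable_EFin_sum (I : Type) (s : seq I) (F : I -> T -> R) :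
  (forall i, mu.-integrable setT (EFin \o F i)) ->
  mu.-integrable setT (EFin \o (fun w => \sum_(i <- s) F i w)).
Proof.
move=> iF; elim: s => [|i s IH].
  rewrite (_ : EFin \o _ = cst 0%E); first exact: integrable0.
  by apply/funext => w /=; rewrite big_nil.
have := integrableD measurableT (iF i) IH.
by apply: eq_integrable => // w _; rewrite /= big_cons EFinD.
Qed.

Lemma Rintegral_sum (I : Type) (s : seq I) (F : I -> T -> R) :
  (forall i, mu.-integrable setT (EFin \o F i)) ->
  \int[mu]_w (\sum_(i <- s) F i w) = \sum_(i <- s) \int[mu]_w F i w.
Proof.
move=> iF; elim: s => [|i s IH].
  by under eq_Rintegral do rewrite big_nil; rewrite /Rintegral integral0 big_nil.
rewrite big_cons -IH -RintegralD//; last exact: integrable_EFin_sum.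
by under eq_Rintegral do rewrite big_cons.
Qed.

Lemma integrable_EFinZl r (f : T -> R) : mu.-integrable setT (EFin \o f) ->
  mu.-integrable setT (EFin \o (fun w => r * f w)).
Proof. exact: integrableZl. Qed.

End Rintegral_extra.

(** * Linear combinations and innovations of the process X *)

Section gaussian_OU.
Context d (T : measurableType d) (R : realType) (P : probability T R).
Context (X : R -> T -> R) (cX : continuous_process setT X) (hX : OU_process P X).

Lemma OU_measurable t : measurable_fun setT (X t).
Proof. exact: cX.1. Qed.

(** At equal times the covariance says that the square has integral 1, and for a nonnegative
    measurable function a finite integral is integrability. Products and [X] itself are then
    dominated by squares. *)
Lemma OU_integrable_sqr t : P.-integrable setT (EFin \o (fun w => X t w ^+ 2)).
Proof.
have mX := OU_measurable t.
apply/integrableP; split; first by apply/measurable_EFinP; exact: measurable_funX.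
have [_ _ _ /(_ t t)] := hX.
rewrite unlock subrr normr0 mulr0 expR0 => EX.
rewrite (_ : (\int[P]_x _ = 1)%E) ?ltry//.
rewrite -EX; apply: eq_integral => w _ /=.
by rewrite ger0_norm ?sqr_ge0// expr2.
Qed.

Lemma OU_integrable_mul t s : P.-integrable setT (EFin \o (fun w => X t w * X s w)).
Proof.
have := integrableD measurableT (OU_integrable_sqr t) (OU_integrable_sqr s).
apply: le_integrable => //.
  by apply/measurable_EFinP/measurable_funM; exact: OU_measurable.
move=> w _ /=; rewrite lee_fin [leRHS]ger0_norm ?addr_ge0 ?sqr_ge0// normrM.
rewrite -(real_normK (num_real (X t w))) -(real_normK (num_real (X s w))).
by have := sqr_ge0 (`|X t w| - `|X s w|);
  have := sqr_ge0 (`|X t w|); have := sqr_ge0 (`|X s w|); nra.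
Qed.

Lemma OU_integrable t : P.-integrable setT (EFin \o X t).
Proof.
have := integrableD measurableT (finite_measure_integrable_cst P 1 measurableT)
  (OU_integrable_sqr t).
apply: le_integrable => //; first by apply/measurable_EFinP; exact: OU_measurable.
move=> w _ /=; rewrite lee_fin [leRHS]ger0_norm ?addr_ge0 ?sqr_ge0//.
rewrite -(real_normK (num_real (X t w))).
by have := sqr_ge0 (`|X t w| - 1); have := sqr_ge0 (`|X t w|); nra.
Qed.

Lemma OU_mean t : \int[P]_w X t w = 0.
Proof. by have [_ _ /(_ t) + _] := hX; rewrite unlock /Rintegral => ->. Qed.

Lemma OU_covariance t s : \int[P]_w (X t w * X s w) = expR (- 2 * `|t - s|).
Proof. by have [_ _ _ /(_ t s)] := hX; rewrite unlock /Rintegral => ->. Qed.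

Lemma lincombM (s : seq (R * R)) w :
  lincomb X s w ^+ 2 = \sum_(p <- s) \sum_(q <- s) (p.1 * q.1) * (X p.2 w * X q.2 w).
Proof.
rewrite expr2 /lincomb mulr_suml; apply: eq_bigr => p _.
by rewrite mulr_sumr; apply: eq_bigr => q _; ring.
Qed.

Lemma OU_lincomb_integrable s : P.-integrable setT (EFin \o lincomb X s).
Proof.
by apply: integrable_EFin_sum => p; apply: integrable_EFinZl; exact: OU_integrable.
Qed.

Lemma OU_lincomb_mean s : \int[P]_w lincomb X s w = 0.
Proof.
rewrite Rintegral_sum ?big1// => p; last by apply: integrable_EFinZl; exact: OU_integrable.
by rewrite RintegralZl ?OU_mean ?mulr0//; exact: OU_integrable.
Qed.

Lemma OU_lincomb_variance (s : seq (R * R)) : \int[P]_w (lincomb X s w ^+ 2) =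
  \sum_(p <- s) \sum_(q <- s) (p.1 * q.1) * expR (- 2 * `|p.2 - q.2|).
Proof.
have i2 p q := integrable_EFinZl (p.1 * q.1) (OU_integrable_mul p.2 q.2).
under eq_Rintegral do rewrite lincombM.
rewrite Rintegral_sum => [|p]; last by apply: integrable_EFin_sum => q; exact: i2.
apply: eq_bigr => p _; rewrite Rintegral_sum => [|q]; last exact: i2.
apply: eq_bigr => q _; rewrite RintegralZl ?OU_covariance//; exact: OU_integrable_mul.
Qed.

Lemma OU_lincomb_law s :
  has_law P (lincomb X s) (gaussian_law 0 (\int[P]_w (lincomb X s w ^+ 2))).
Proof.
have [gX _ _ _] := hX.
have [m [v [v0 hG]]] := gX (size s) (fun i => (nth (0, 0) s i).2) (fun i => (nth (0, 0) s i).1).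
have E : (fun w => \sum_(i < size s) (nth (0, 0) s i).1 * X (nth (0, 0) s i).2 w) = lincomb X s.
  by apply/funext => w; rewrite /lincomb (big_nth (0, 0)) big_mkord.
rewrite E in hG.
have mL : measurable_fun setT (lincomb X s) by apply: measurable_lincomb; exact: OU_measurable.
have [m0 vE] := gaussian_law_moments mL v0 hG (OU_lincomb_integrable s) (OU_lincomb_mean s) erefl.
by rewrite -vE -m0.
Qed.

(* Equal to e^(-v/2), but only its multiplicativity is used. *)
Definition gauss_cos (v : R) : R := \int[P]_w cos (Num.sqrt v * X 0 w).

Lemma OU_scaled_law a : has_law P (fun w => a * X 0 w) (gaussian_law 0 (a ^+ 2)).
Proof.
have := OU_lincomb_law [:: (a, 0)].
rewrite OU_lincomb_variance !big_seq1/= subrr normr0 mulr0 expR0 mulr1 expr2.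
by rewrite (_ : lincomb X _ = (fun w => a * X 0 w))//; apply/funext => w; rewrite /lincomb big_seq1.
Qed.

(** [X 0] is standard normal, so [G] has the law of s times [X 0] with s = sqrt v. Replacing s by -s
    does not change the variance, hence not the law, so the expectation of the sine vanishes and the
    phase comes out as the factor cos b. *)
Lemma gauss_cosE d' (T' : measurableType d') (P' : probability T' R) (G : T' -> R) v b :
  0 <= v -> measurable_fun setT G -> has_law P' G (gaussian_law 0 v) ->
  \int[P']_w cos (G w + b) = cos b * gauss_cos v.
Proof.
move=> v0 mG hG.
have mX a : measurable_fun setT (fun w => a * X 0 w).
  by apply: measurable_funM => //; exact: OU_measurable.
have eqL d1 (T1 : measurableType d1) (P1 : probability T1 R) (G1 : T1 -> R) f a :
    measurable_fun setT G1 -> has_law P1 G1 (gaussian_law 0 (a ^+ 2)) ->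
    measurable_fun setT f -> \int[P1]_w f (G1 w) = \int[P]_w f (a * X 0 w).
  move=> mG1 hG1 mf; congr fine.
  apply: (@eq_law_integral _ _ _ _ _ P1 P G1 (fun w => a * X 0 w) _ _ _ (EFin \o f)) => //.
    by move=> B mB; rewrite hG1// OU_scaled_law.
  exact/measurable_EFinP.
pose s := Num.sqrt v; have s2 : s ^+ 2 = v by rewrite sqr_sqrtr.
have mc c : measurable_fun setT (fun x : R => cos (x + c)).
  by have [] := @bounded_measurable_cos _ R R (fun x => x + c) (measurable_funD (@measurable_id _
    _ _) (measurable_cst _)).
rewrite (eqL _ _ P' G (fun x => cos (x + b)) s) ?s2//.
have ms : measurable_fun setT (fun x : R => sin x).
  by have [] := @bounded_measurable_sin _ R R id (@measurable_id _ _ _).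
have sin0 : \int[P]_w sin (s * X 0 w) = 0.
  have := eqL _ _ P (fun w => s * X 0 w) sin (- s) (mX s).
  rewrite sqrrN => /(_ (OU_scaled_law s) ms) h.
  have : \int[P]_w sin (s * X 0 w) = - \int[P]_w sin (s * X 0 w).
    rewrite [in LHS]h -[RHS]mulN1r -RintegralZl//; last first.
      by apply: bounded_measurable_integrable; exact: bounded_measurable_sin.
    by apply: eq_Rintegral => w _; rewrite mulNr sinN mulN1r.
  by move=> /eqP; rewrite -subr_eq0 opprK -mulr2n mulrn_eq0/= => /eqP.
under eq_Rintegral do rewrite cosD mulrC [X in _ - X]mulrC.
have ic := bounded_measurable_integrable P (bounded_measurable_cos (mX s)).
have is_ := bounded_measurable_integrable P (bounded_measurable_sin (mX s)).
rewrite RintegralB//; try exact: integrable_EFinZl.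
by rewrite !RintegralZl// sin0 mulr0 subr0.
Qed.

Lemma gauss_cos0 : gauss_cos 0 = 1.
Proof.
rewrite /gauss_cos; under eq_Rintegral do rewrite sqrtr0 mul0r cos0.
by rewrite Rintegral_cst//= probability_setT mulr1.
Qed.

Lemma gauss_cos_cvg (v_ : nat -> R) v : v_ n @[n --> \oo] --> v ->
  gauss_cos (v_ n) @[n --> \oo] --> gauss_cos v.
Proof.
move=> vv; apply: (@Rintegral_bounded_cvg _ _ _ _ _ _ 1).
- move=> n; apply: (bounded_measurable_cos _).1; apply: measurable_funM => //.
  exact: OU_measurable.
- apply: (bounded_measurable_cos _).1; apply: measurable_funM => //.
  exact: OU_measurable.
- by move=> n w; exact: cos_max.
- apply: aeW => w; apply: (cvg_comp _ cos); last exact: continuous_cos.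
  apply: cvgM; last exact: cvg_cst.
  by apply: (cvg_comp _ Num.sqrt vv); exact: sqrt_continuous.
Qed.

Definition innovation (h : R) (k : nat) (w : T) : R :=
  X (k.+1%:R * h) w - expR (- 2 * h) * X (k%:R * h) w.

Lemma innovationM h j k w : innovation h j w * innovation h k w =
  (X (j.+1%:R * h) w * X (k.+1%:R * h) w +
   (- expR (- 2 * h)) * (X (j.+1%:R * h) w * X (k%:R * h) w)) +
  ((- expR (- 2 * h)) * (X (j%:R * h) w * X (k.+1%:R * h) w) +
   expR (- 2 * h) ^+ 2 * (X (j%:R * h) w * X (k%:R * h) w)).
Proof. by rewrite /innovation; ring. Qed.

Lemma integrable_innovationM h j k :
  P.-integrable setT (EFin \o (fun w => innovation h j w * innovation h k w)).
Proof.
have i1 t s := OU_integrable_mul t s.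
have i2 c t s := integrable_EFinZl c (OU_integrable_mul t s).
rewrite (funext (innovationM h j k)).
exact: (integrableD measurableT (integrableD measurableT (i1 _ _) (i2 _ _ _))
  (integrableD measurableT (i2 _ _ _) (i2 _ _ _))).
Qed.

(** Along the grid the covariance is geometric with ratio r = e^(-2h). For j < k the four products
    have expectations r^(m+1), -r^(m+1), -r^(m+3) and r^(m+3), where m = k - j - 1, and these
    cancel; for j = k there remains 1 - r^2. *)
Lemma innovation_covariance h j k : 0 <= h ->
  \int[P]_w (innovation h j w * innovation h k w) =
  (j == k)%:R * (1 - expR (- 4 * h)).
Proof.
move=> h0.
pose r := expR (- 2 * h).
have i1 t s := OU_integrable_mul t s.
have i2 c t s := integrable_EFinZl c (OU_integrable_mul t s).
under eq_Rintegral do rewrite innovationM -/r.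
rewrite RintegralD//; last 2 first.
- exact: (integrableD measurableT (i1 _ _) (i2 _ _ _)).
- exact: (integrableD measurableT (i2 _ _ _) (i2 _ _ _)).
rewrite !RintegralD// !RintegralZl// !OU_covariance.
rewrite -!mulrBl !normrM (ger0_norm h0).
have r4 : expR (- 4 * h) = r ^+ 2.
  by rewrite /r -expRM_natl; congr expR; ring.
have rr : expR (- 2 * (1 * h)) = r by rewrite mul1r.
have [->|jk] := eqVneq j k.
  rewrite mul1r !subrr normr0 mul0r mulr0 expR0 -natrB// subSnn distrC -natrB// subSnn normr1.
  by rewrite rr r4; ring.
rewrite mul0r.
wlog : j k jk / (j < k)%N.
  move=> H; case: (ltngtP j k) => [/H|kj|/eqP]; [exact|..]; last by rewrite (negbTE jk).
  rewrite -[RHS](H k j) 1?eq_sym// addrACA [X in _ + X = _]addrC [in LHS]addrACA.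
  by rewrite !(distrC k%:R) !(distrC k.+1%:R); ring.
move=> {}jk.
have D a b : (a <= b)%N -> `|a%:R - b%:R : R| = (b - a)%:R.
  by move=> ab; rewrite distrC -natrB// normr_nat.
rewrite !D; try lia.
pose m := (k - j.+1)%N.
have -> : (k.+1 - j.+1 = m.+1)%N by rewrite /m; lia.
have -> : (k.+1 - j = m.+2)%N by rewrite /m; lia.
have -> : (k - j = m.+1)%N by rewrite /m; lia.
have rS n : expR (- 2 * (n.+1%:R * h)) = expR (- 2 * (n%:R * h)) * r.
  by rewrite -expRD -natr1; congr expR; ring.
by rewrite !rS; ring.
Qed.

Lemma innovation_sum_law h M (c : nat -> R) : 0 <= h ->
  has_law P (fun w => \sum_(k < M) c k * innovation h k w)
    (gaussian_law 0 ((1 - expR (- 4 * h)) * \sum_(k < M) c k ^+ 2)).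
Proof.
move=> h0.
pose s := [seq (c k, k.+1%:R * h) | k <- iota 0 M] ++
  [seq (- (expR (- 2 * h)) * c k, k%:R * h) | k <- iota 0 M].
have sE w : \sum_(k < M) c k * innovation h k w = lincomb X s w.
  rewrite /lincomb big_cat /= !big_map /= -big_split /=.
  rewrite -(big_mkord xpredT (fun k => c k * innovation h k w)) /index_iota subn0.
  by apply: eq_bigr => k _; rewrite /innovation; ring.
rewrite (funext sE).
have -> : (1 - expR (- 4 * h)) * \sum_(k < M) c k ^+ 2 = \int[P]_w (lincomb X s w ^+ 2).
  pose F j k w := (c j * c k) * (innovation h j w * innovation h k w).
  have iF j k : P.-integrable setT (EFin \o F j k).
    by apply: integrable_EFinZl; exact: integrable_innovationM.
  have E w : lincomb X s w ^+ 2 = \sum_(j <- iota 0 M) \sum_(k <- iota 0 M) F j k w.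
    rewrite -sE -(big_mkord xpredT (fun k => c k * innovation h k w)) /index_iota subn0.
    rewrite expr2 mulr_suml; apply: eq_bigr => j _; rewrite mulr_sumr.
    by apply: eq_bigr => k _; rewrite /F; ring.
  under eq_Rintegral do rewrite E.
  rewrite Rintegral_sum => [|j]; last exact: integrable_EFin_sum.
  rewrite -(big_mkord xpredT (fun k => c k ^+ 2)) /index_iota subn0 mulr_sumr.
  rewrite big_seq [RHS]big_seq; apply: eq_bigr => j jM.
  rewrite Rintegral_sum// (bigD1_seq j) ?iota_uniq//= [X in _ = _ + X]big1 ?addr0 => [|k kj].
    rewrite RintegralZl//; last exact: integrable_innovationM.
    by rewrite innovation_covariance// eqxx mul1r; ring.
  rewrite RintegralZl//; last exact: integrable_innovationM.
  by rewrite innovation_covariance// eq_sym (negbTE kj) mul0r mulr0.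
exact: OU_lincomb_law.
Qed.

End gaussian_OU.

(** * Riemann sums of a continuous function *)

Section riemann_sums.
Variable R : realType.
Notation mu := (@lebesgue_measure R).
Variable f : R -> R.
Hypothesis cf : continuous f.

Lemma continuous_segment_modulus (a e : R) : 0 < e ->
  exists2 d, 0 < d & forall t s, 0 <= t <= a -> `|t - s| < d -> `|f t - f s| <= e.
Proof.
move=> e0.
have /compact_near_coveringP/(_ R 0^'+
   (fun d t => forall s, `|t - s| < d -> `|f t - f s| <= e)) := @segment_compact R 0 a.
move=> /(_ _)[x _|r /= r0 rP].
  have e2 : 0 < e / 2 by rewrite divr_gt0.
  have /cvgrPdist_le/(_ _ e2)/nbhs_ballP[r /= r0 rP] := @cf x.
  have r2 : 0 < r / 2 by rewrite divr_gt0.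
  near=> x' d => s x's.
  have xx' : `|x - x'| < r / 2 by near: x'; exact: (@nbhsx_ballx _ _ x _ r2).
  have d2 : d < r / 2 by near: d; exact: nbhs_right_lt.
  have h1 : `|f x - f x'| <= e / 2.
    by apply: rP; rewrite /ball/= (lt_le_trans xx')// ler_pdivrMr// ler_pMr// ler1n.
  have h2 : `|f x - f s| <= e / 2.
    apply: rP; rewrite /ball/= (splitr r) (le_lt_trans (ler_distD x' _ _))//.
    by rewrite ltrD// (lt_trans x's).
  by rewrite (splitr e) (le_trans (ler_distD (f x) _ _))// lerD// distrC.
exists (r / 2); first by rewrite divr_gt0.
move=> t s ta ts; apply: (rP (r / 2)) => //.
  rewrite /= sub0r normrN gtr0_norm ?divr_gt0//.
  by rewrite ltr_pdivrMr// ltr_pMr// ltr1n.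
by rewrite divr_gt0.
Unshelve. all: by end_near.
Qed.

Lemma continuous_itv_integrable a b : mu.-integrable `[a, b] (EFin \o f).
Proof.
apply: continuous_compact_integrable; first exact: segment_compact.
exact: continuous_subspaceT.
Qed.

Lemma Rintegral_increment (a b c : R) : 0 <= a <= b ->
  \int[mu]_(s in `[0, b]) f s - \int[mu]_(s in `[0, a]) f s - c * (b - a) =
  \int[mu]_(s in `]a, b]) (f s - c).
Proof.
move=> /andP[a0 ab].
have i1 : mu.-integrable `]a, b] (EFin \o f).
  by apply: integrableS (continuous_itv_integrable a b) => //; exact: subset_itv_oc_cc.
have i2 : mu.-integrable `]a, b] (EFin \o cst c).
  apply: (@integrableS _ _ _ mu `[a, b]) => //; first exact: subset_itv_oc_cc.
  apply: continuous_compact_integrable; first exact: segment_compact.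
  by apply: continuous_subspaceT; exact: cst_continuous.
rewrite RintegralB// Rintegral_itvB ?bnd_simp//; last exact: continuous_itv_integrable.
congr (_ - _); rewrite Rintegral_cst//= lebesgue_measure_itv/= lte_fin.
by case: ltgtP ab => // -> _; rewrite subrr.
Qed.

Lemma Rintegral_increment_le (a b c e : R) : 0 <= a <= b ->
  (forall s, a <= s <= b -> `|f s - c| <= e) ->
  `|\int[mu]_(s in `[0, b]) f s - \int[mu]_(s in `[0, a]) f s - c * (b - a)|
    <= e * (b - a).
Proof.
move=> /[dup] ab0 /andP[a0 ab] fe; rewrite Rintegral_increment//.
have cs c' : mu.-integrable `]a, b] (EFin \o cst c').
  apply: (@integrableS _ _ _ mu `[a, b]) => //; first exact: subset_itv_oc_cc.
  apply: continuous_compact_integrable; first exact: segment_compact.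
  by apply: continuous_subspaceT; exact: cst_continuous.
have i1 : mu.-integrable `]a, b] (EFin \o (fun s => f s - c)).
  have i0 : mu.-integrable `]a, b] (EFin \o f).
    by apply: integrableS (continuous_itv_integrable a b) => //; exact: subset_itv_oc_cc.
  exact: (integrableB _ i0 (cs c)).
apply: le_trans (le_normr_Rintegral _ i1) _ => //.
have -> : e * (b - a) = \int[mu]_(s in `]a, b]) (cst e s).
  rewrite Rintegral_cst//= lebesgue_measure_itv/= lte_fin.
  by case: ltgtP ab => // -> _; rewrite subrr.
apply: le_Rintegral => //.
  exact: (integrable_abse i1).
move=> s /=; rewrite in_itv/= => /andP[/ltW as_ sb]; apply: fe.
by rewrite as_.
Qed.

(** The last grid point [(j N)%:R * h N] falls short of [kappa * t]. The sum is compared with the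
    integral up to that point, cell by cell, and continuity of the primitive [F] covers the
    remainder. *)
Lemma riemann_sum_cvg (kappa t : R) : 0 < kappa -> 0 <= t ->
  (kappa / N.+1%:R) * (\sum_(k < Num.truncn (t * N.+1%:R)) f (k%:R * (kappa / N.+1%:R)))
    @[N --> \oo] --> \int[mu]_(s in `[0, kappa * t]) f s.
Proof.
move=> k0; rewrite le_eqVlt => /predU1P[<-|t0].
  rewrite mulr0 set_itv1 Rintegral_set1; apply: cvg_near_cst; apply: nearW => N.
  by rewrite mul0r truncn0 big_ord0 mulr0.
have kt0 : 0 < kappa * t by rewrite mulr_gt0.
pose F u := \int[mu]_(s in `[0, u]) f s.
pose h N : R := kappa / N.+1%:R.
have h0 N : 0 < h N by rewrite divr_gt0.
pose j N := Num.truncn (t * N.+1%:R).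
have jh N : (j N)%:R * h N <= kappa * t < (j N)%:R * h N + h N.
  have /andP[l u] : (j N)%:R <= t * N.+1%:R < (j N).+1%:R.
    by rewrite truncn_itv// mulr_ge0 ?(ltW t0).
  have -> : kappa * t = t * N.+1%:R * h N by rewrite /h; field.
  by rewrite -[X in _ + X]mul1r -mulrDl natr1 ler_pM2r// ltr_pM2r// l.
have ch : h N @[N --> \oo] --> 0.
  by rewrite -[X in _ --> X](mulr0 kappa); apply: cvgMr; exact: cvg_harmonic.
have cjh : (j N)%:R * h N @[N --> \oo] --> kappa * t.
  apply: (@squeeze_cvgr _ _ _ _ (fun N => kappa * t - h N) (cst (kappa * t))).
  - by apply: nearW => N; have /andP[-> /ltW] := jh N; rewrite lerBlDr => ->.
  - by rewrite -[X in _ --> X]subr0; apply: cvgB => //; exact: cvg_cst.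
  - exact: cvg_cst.
have cF : F ((j N)%:R * h N) @[N --> \oo] --> F (kappa * t).
  have kt1 : 0 < kappa * t + 1 by rewrite addr_gt0.
  have /(continuous_within_itvP _ kt1)[+ _ _] :=
    parameterized_integral_continuous (ltW kt1) (continuous_itv_integrable _ _).
  move=> /(_ (kappa * t)); rewrite in_itv/= kt0 ltrDl ltr01 => /(_ isT).
  exact: cvg_comp cjh.
pose S N := h N * \sum_(k < j N) f (k%:R * h N).
suff cS : F ((j N)%:R * h N) - S N @[N --> \oo] --> 0.
  have SE : S = (fun N => F ((j N)%:R * h N) - (F ((j N)%:R * h N) - S N)).
    by apply/funext => N; rewrite opprB addrC subrK.
  rewrite -[X in X @ _ --> _]/S SE -[X in _ --> X]subr0; exact: cvgB.
apply/cvgrPdist_le => e e0.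
have e1 : 0 < e / (kappa * t) by rewrite divr_gt0.
have [r r0 rP] := continuous_segment_modulus (kappa * t) e1.
have : \forall N \near \oo, h N < r.
  by move/cvgrPdist_lt : ch => /(_ _ r0); apply: filterS => N; rewrite sub0r normrN gtr0_norm.
apply: filterS => N hr; rewrite sub0r normrN.
(* The oscillation on a cell is at most e / (kappa t), so the accumulated error is proportional to
   the time covered, which is at most kappa t. *)
have step (i : nat) : (i <= j N)%N ->
    `|F (i%:R * h N) - h N * \sum_(k < i) f (k%:R * h N)| <= e / (kappa * t) * (i%:R * h N).
  elim: i => [_|i IH ij].
    by rewrite big_ord0 mulr0 subr0 mul0r mulr0 /F set_itv1 Rintegral_set1 normr0.
  rewrite big_ord_recr/= -natr1 [(_ + 1) * h N]mulrDl mul1r.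
  have ih0 : 0 <= i%:R * h N by rewrite mulr_ge0// ltW.
  have ab : 0 <= i%:R * h N <= i%:R * h N + h N by rewrite ih0 lerDl ltW.
  have ik : i%:R * h N <= kappa * t.
    by have /andP[+ _] := jh N; apply: le_trans; rewrite ler_pM2r// ler_nat ltnW.
  have fe s : i%:R * h N <= s <= i%:R * h N + h N ->
      `|f s - f (i%:R * h N)| <= e / (kappa * t).
    move=> /andP[s1 s2]; rewrite distrC; apply: rP; first by rewrite ih0.
    by rewrite distrC ger0_norm ?subr_ge0// (le_lt_trans _ hr)// lerBlDl.
  have := Rintegral_increment_le ab fe.
  rewrite -!/(F _) [_ + h N - _]addrAC subrr add0r => inc.
  rewrite mulrDr [e / _ * (_ + _)]mulrDr.
  have := lerD (IH (ltnW ij)) inc; apply: le_trans.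
  apply: le_trans (ler_normD _ _); rewrite le_eqVlt; apply/orP; left; apply/eqP.
  congr `| _ |; ring.
apply: le_trans (step _ (leqnn _)) _.
rewrite -[leRHS](divfK (lt0r_neq0 kt0)) ler_pM2l//.
by have /andP[] := jh N.
Qed.

End riemann_sums.

(** * Limits of partial sums of Gaussian noise on a grid *)

Section grid_processes.
Variable R : realType.

Lemma cvg_sum_seq (I : eqType) (s : seq I) (u : nat -> I -> R) (l : I -> R) :
  (forall i, i \in s -> u n i @[n --> \oo] --> l i) ->
  \sum_(i <- s) u n i @[n --> \oo] --> \sum_(i <- s) l i.
Proof.
elim: s => [_|i s IH ul].
  by rewrite big_nil; under eq_fun do rewrite big_nil; exact: cvg_cst.
rewrite big_cons; under eq_fun do rewrite big_cons; apply: cvgD.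
  by apply: ul; rewrite mem_head.
by apply: IH => j js; apply: ul; rewrite in_cons js orbT.
Qed.

Lemma sum_ord_lt (M n : nat) (F : nat -> R) : (n <= M)%N ->
  \sum_(k < n) F k = \sum_(k < M) (k < n)%N%:R * F k.
Proof.
move=> nM; rewrite (big_ord_widen M F nM) big_mkcond/=.
by apply: eq_bigr => k _; case: (k < n)%N; rewrite ?mul1r ?mul0r.
Qed.

Lemma truncn_grid_cvg (t : R) : 0 <= t ->
  (Num.truncn (t * N.+1%:R))%:R / N.+1%:R @[N --> \oo] --> t.
Proof.
move=> t0; apply: (@squeeze_cvgr _ _ _ _ (fun N => t - N.+1%:R^-1) (cst t)).
- apply: nearW => N; rewrite ler_pdivrMr// lerBlDr -[X in _ + X]div1r -mulrDl.
  rewrite ler_pdivlMr// natr1.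
  have /andP[-> /ltW ->] // : (Num.truncn (t * N.+1%:R))%:R <= t * N.+1%:R
      < (Num.truncn (t * N.+1%:R)).+1%:R.
  by rewrite truncn_itv// mulr_ge0.
- by rewrite -[X in _ --> X]subr0; apply: cvgB; [exact: cvg_cst|exact: cvg_harmonic].
- exact: cvg_cst.
Qed.

Context d (T : measurableType d) (P : probability T R).
Context (Y : R -> T -> R) (Z : nat -> nat -> T -> R) (v : nat -> R) (psi : R -> R).
Hypothesis psi_cvg : forall (v_ : nat -> R) v, v_ n @[n --> \oo] --> v ->
  psi (v_ n) @[n --> \oo] --> psi v.
Hypothesis mZ : forall N k, measurable_fun setT (Z N k).
Hypothesis mY : forall t, 0 <= t -> measurable_fun setT (Y t).
Hypothesis cosZ : forall N M (c : nat -> R) b,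
  \int[P]_w cos (\sum_(k < M) c k * Z N k w + b) =
  cos b * psi (v N * \sum_(k < M) c k ^+ 2).
Hypothesis vN : N.+1%:R * v N @[N --> \oo] --> (1 : R).
Hypothesis ZY : forall t, 0 <= t -> {ae P, forall w,
  \sum_(k < Num.truncn (t * N.+1%:R)) Z N k w @[N --> \oo] --> Y t w}.

Let S N (t : R) w := \sum_(k < Num.truncn (t * N.+1%:R)) Z N k w.

(** One scheme for both the Brownian motion and the noise driving X. A combination of partial sums
    is a single combination of the noises [Z N k], whose k-th coefficient adds the weights of the
    times lying beyond cell k. Its sum of squares counts common cells, that is minima of truncated
    times, and [v N] turns these counts into the minima of the times. *)
Lemma grid_process_cos (s : seq (R * R)) b : all (fun p => 0 <= p.2) s ->
  \int[P]_w cos (lincomb Y s w + b) =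
  cos b * psi (\sum_(p <- s) \sum_(q <- s) (p.1 * q.1) * Num.min p.2 q.2).
Proof.
move=> s0.
pose n N t := Num.truncn (t * N.+1%:R : R).
pose M N := \max_(p <- s) n N p.2.
have nM N p : p \in s -> (n N p.2 <= M N)%N.
  by move=> ps; exact: (leq_bigmax_seq p).
pose c N k : R := \sum_(p <- s) p.1 * (k < n N p.2)%N%:R.
have SE N w : lincomb (S N) s w = \sum_(k < M N) c N k * Z N k w.
  rewrite /lincomb big_seq.
  under eq_bigr => p ps do rewrite /S (sum_ord_lt (fun k => Z N k w) (nM N p ps)) mulr_sumr.
  rewrite -big_seq exchange_big/=; apply: eq_bigr => k _.
  by rewrite /c mulr_suml; apply: eq_bigr => p _; rewrite mulrA.
have cE N : \sum_(k < M N) c N k ^+ 2 =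
    \sum_(p <- s) \sum_(q <- s) (p.1 * q.1) * (minn (n N p.2) (n N q.2))%:R.
  transitivity (\sum_(k < M N) \sum_(p <- s) \sum_(q <- s)
     (p.1 * q.1) * ((k < minn (n N p.2) (n N q.2))%N%:R * 1)).
    apply: eq_bigr => k _; rewrite expr2 /c mulr_suml; apply: eq_bigr => p _.
    rewrite mulr_sumr; apply: eq_bigr => q _.
    by rewrite leq_min mulr1 -mulnb natrM; ring.
  rewrite exchange_big/= big_seq [RHS]big_seq; apply: eq_bigr => p ps.
  rewrite exchange_big/= big_seq [RHS]big_seq; apply: eq_bigr => q qs.
  rewrite -mulr_sumr -(@sum_ord_lt _ _ (fun=> 1)) ?sumr_const ?card_ord//.
  by rewrite geq_min nM.
have cv : v N * \sum_(k < M N) c N k ^+ 2 @[N --> \oo] -->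
    \sum_(p <- s) \sum_(q <- s) (p.1 * q.1) * Num.min p.2 q.2.
  under eq_fun do rewrite cE mulr_sumr.
  have E N (p : R * R) : v N * \sum_(q <- s) p.1 * q.1 * (minn (n N p.2) (n N q.2))%:R =
     \sum_(q <- s) p.1 * q.1 * (N.+1%:R * v N * Num.min ((n N p.2)%:R / N.+1%:R) ((n N q.2)%:R /
       N.+1%:R)).
    rewrite mulr_sumr; apply: eq_bigr => q _.
    by rewrite -minr_pMl// -natr_min; field.
  rewrite (_ : (fun N => _) = (fun N => \sum_(p <- s) \sum_(q <- s) p.1 * q.1 *
      (N.+1%:R * v N * Num.min ((n N p.2)%:R / N.+1%:R) ((n N q.2)%:R / N.+1%:R)))); last first.
    by apply/funext => N; apply: eq_bigr => p _; exact: E.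
  apply: cvg_sum_seq => p ps; apply: cvg_sum_seq => q qs; apply: cvgMr.
  rewrite -[X in _ --> X]mul1r; apply: cvgM => //.
  have cp := truncn_grid_cvg (allP s0 p ps); have cq := truncn_grid_cvg (allP s0 q qs).
  rewrite minr_absE; under eq_fun do rewrite minr_absE.
  by apply: cvgMl; apply: cvgB; [exact: cvgD|apply: cvg_norm; exact: cvgB].
have mL (F : R -> T -> R) : (forall t, 0 <= t -> measurable_fun setT (F t)) ->
    measurable_fun setT (lincomb F s).
  move=> mF; rewrite (_ : lincomb F s = lincomb (fun t => F `|t|) s).
    by apply: measurable_lincomb => t; exact: mF.
  apply/funext => w; rewrite /lincomb !big_seq; apply: eq_bigr => p ps.
  by rewrite ger0_norm//; exact: (allP s0).
have mS N t : 0 <= t -> measurable_fun setT (S N t).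
  by move=> _; exact: measurable_sum.
have aeL : {ae P, forall w, lincomb (S N) s w @[N --> \oo] --> lincomb Y s w}.
  rewrite /lincomb; elim: s s0 {n M nM c SE cE cv mL} => [_|p s IH /= /andP[p0 /IH]].
    apply: aeW => w; rewrite big_nil; under eq_fun do rewrite big_nil; exact: cvg_cst.
  apply: filterS2 (ZY p0) => w c1 c2; rewrite big_cons.
  under eq_fun do rewrite big_cons; apply: cvgD => //.
  by apply: cvgM => //; exact: cvg_cst.
have c1 : \int[P]_w cos (lincomb (S N) s w + b) @[N --> \oo] -->
    \int[P]_w cos (lincomb Y s w + b).
  apply: (@Rintegral_bounded_cvg _ _ _ _ _ _ 1).
  - move=> N; apply: (bounded_measurable_cos _).1; apply: measurable_funD => //.
    exact/mL/mS.
  - apply: (bounded_measurable_cos _).1; apply: measurable_funD => //.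
    exact: mL.
  - by move=> N w; exact: cos_max.
  - apply: filterS aeL => w cw; apply: (cvg_comp _ cos); last exact: continuous_cos.
    by apply: cvgD => //; exact: cvg_cst.
have E2 N : \int[P]_w cos (lincomb (S N) s w + b) = cos b * psi (v N * \sum_(k < M N) c N k ^+ 2).
  by rewrite -cosZ; apply: eq_Rintegral => w _; rewrite SE.
move: c1; under eq_fun do rewrite E2.
move=> /(cvg_unique (@Rhausdorff R)); apply.
by apply: cvgMr; exact: psi_cvg.
Qed.

End grid_processes.

(** * Expectations of products and cosines of independent variables *)

Section independence.
Context d (T : measurableType d) (R : realType) (P : probability T R).

Lemma bounded_measurable_lim (g_ : nat -> R -> R) (g : R -> R) M :
  (forall n, bounded_measurable (g_ n)) -> (forall n x, `|g_ n x| <= M) ->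
  (forall x, g_ ^~ x @ \oo --> g x) -> bounded_measurable g.
Proof.
move=> bg_ g_M cg; split.
  by apply: measurable_fun_cvg (fun n => (bg_ n).1) _ => x _; exact: cg.
exists M => x; have cn : `|g_ n x| @[n --> \oo] --> `|g x| by apply: cvg_norm; exact: cg.
rewrite -(cvg_lim (@Rhausdorff R) cn); apply: limr_le; first by apply/cvg_ex; eexists; exact: cn.
by apply: nearW => n; exact: g_M.
Qed.

(** Induction on the number j of leading coordinates whose functions are arbitrary, the others being
    indicators: j = 0 is independence on boxes, and [indic_class] frees one more coordinate at each
    step. *)
Lemma indep_expectation (n : nat) (Z : 'I_n -> T -> R) (g : 'I_n -> R -> R) :
  (forall i, measurable_fun setT (Z i)) -> mutually_independent P Z ->
  (forall i, bounded_measurable (g i)) ->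
  \int[P]_w (\prod_(i < n) g i (Z i w)) = \prod_(i < n) \int[P]_w g i (Z i w).
Proof.
move=> mZ indZ.
have bc (f : R -> R) i : bounded_measurable f -> bounded_measurable (fun w => f (Z i w)).
  by move=> bf; exact: (bounded_measurable_comp bf (mZ i)).
suff H j : forall g : 'I_n -> R -> R, (forall i, bounded_measurable (g i)) ->
    (forall i : 'I_n, (j <= i)%N -> exists2 A, measurable A & g i = \1_A) ->
    \int[P]_w (\prod_(i < n) g i (Z i w)) = \prod_(i < n) \int[P]_w g i (Z i w).
  by move=> bg; apply: (H n) => // i; rewrite leqNgt ltn_ord.
elim: j => [|j IH] {}g bg gA.
  have /choice[A AP] : forall i, exists A, measurable A /\ g i = \1_A.
    by move=> i; have [A mA gE] := gA i (leq0n _); exists A.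
  have mZA i : measurable (Z i @^-1` A i).
    by rewrite -[X in measurable X]setTI; apply: mZ => //; exact: (AP i).1.
  have gE i w : g i (Z i w) = \1_(Z i @^-1` A i) w by rewrite (AP i).2.
  have -> : \int[P]_w (\prod_(i < n) g i (Z i w)) =
      \int[P]_w (\1_[set w | forall i, A i (Z i w)] w).
    apply: eq_Rintegral => w _.
    have [h|h] := pselect (forall i, A i (Z i w)).
      rewrite indicE mem_set// big1// => i _.
      by have hi : (Z i @^-1` A i) w := h i; rewrite gE indicE mem_set.
    rewrite indicE memNset//; have [i hi] : exists i, ~ A i (Z i w).
      by apply/existsNP.
    by rewrite (bigD1 i)//= gE indicE memNset// mul0r.
  rewrite /Rintegral integral_indic//; last first.
    rewrite (_ : [set _ | _] = \bigcap_(i in [set: 'I_n]) (Z i @^-1` A i)).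
      by apply: fin_bigcap_measurable => // i _; exact: mZA.
    by apply/seteqP; split => w /= h i; [move=> _|]; exact: h.
  rewrite setIT; apply: etrans (congr1 fine (indZ A (fun i => (AP i).1))) _ => /=.
  apply: eq_bigr => i _; under eq_integral do rewrite gE.
  by rewrite integral_indic// setIT.
have [jn|nj] := ltnP j n; last first.
  by apply: IH => // i ij; apply: gA; move: (ltn_ord i); rewrite ltnNge (leq_trans nj ij).
pose i0 := Ordinal jn.
have bprod : bounded_measurable (fun w => \prod_(i < n | i != i0) g i (Z i w)).
  by apply: bounded_measurable_prod => i; exact: bc.
pose C := \prod_(i < n | i != i0) \int[P]_w g i (Z i w).
pose K f := bounded_measurable f /\
  \int[P]_w (f (Z i0 w) * \prod_(i < n | i != i0) g i (Z i w)) = \int[P]_w f (Z i0 w) * C.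
suff [_ Kg] : K (g i0).
  by rewrite (bigD1 i0)//= -/C -Kg; apply: eq_Rintegral => w _; rewrite (bigD1 i0).
have iF f : bounded_measurable f -> P.-integrable setT
    (EFin \o (fun w => f (Z i0 w) * \prod_(i < n | i != i0) g i (Z i w))).
  by move=> bf; apply/bounded_measurable_integrable/bounded_measurableM => //; exact: bc.
apply: indic_class (bg i0); last first.
  move=> A mA; split; first exact: bounded_measurable_indic.
  pose g' i := if i == i0 then \1_A else g i.
  have g'E i : i != i0 -> g' i = g i by move=> /negbTE i0'; rewrite /g' i0'.
  have g'0 : g' i0 = \1_A by rewrite /g' eqxx.
  have -> : \int[P]_w (\1_A (Z i0 w) * \prod_(i < n | i != i0) g i (Z i w)) =
      \int[P]_w (\prod_(i < n) g' i (Z i w)).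
    apply: eq_Rintegral => w _; rewrite [RHS](bigD1 i0)//= g'0; congr (_ * _).
    by apply: eq_bigr => i /g'E ->.
  rewrite IH.
  - rewrite (bigD1 i0)//= g'0; congr (_ * _).
    by apply: eq_bigr => i /g'E ->.
  - by move=> i; rewrite /g'; case: eqP => // _; exact: bounded_measurable_indic.
  - move=> i ij; rewrite /g'; case: eqP => [_|/eqP ii0]; first by exists A.
    by apply: gA; rewrite ltn_neqAle ij andbT eq_sym.
split => [r f h [bf Kf] [bh Kh]|f_ f M Kf_ f_M cf].
  have bZ : bounded_measurable (fun x => r * f x).
    by apply: bounded_measurableM => //; exact: bounded_measurable_cst.
  split; first exact: bounded_measurableD.
  transitivity (r * \int[P]_w (f (Z i0 w) * \prod_(i < n | i != i0) g i (Z i w)) +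
    \int[P]_w (h (Z i0 w) * \prod_(i < n | i != i0) g i (Z i w))).
    rewrite -RintegralZl//; last exact: iF.
    rewrite -RintegralD//; [|exact/integrable_EFinZl/iF|exact: iF].
    by apply: eq_Rintegral => w _; ring.
  have iZ u : bounded_measurable u -> P.-integrable setT (EFin \o (fun w => u (Z i0 w))).
    by move=> bu; apply: bounded_measurable_integrable; exact: bc.
  rewrite Kf Kh RintegralD ?RintegralZl//; try exact: iZ.
    by ring.
  exact: (iZ _ bZ).
have bf := bounded_measurable_lim (fun n => (Kf_ n).1) f_M cf.
split => //; have [_ [N gN]] := bprod.
have c1 : \int[P]_w (f_ k (Z i0 w) * \prod_(i < n | i != i0) g i (Z i w)) @[k --> \oo] -->
    \int[P]_w (f (Z i0 w) * \prod_(i < n | i != i0) g i (Z i w)).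
  apply: (@Rintegral_bounded_cvg _ _ _ _ _ _ (M * N)).
  - by move=> k; exact: (bounded_measurableM (bc _ i0 (Kf_ k).1) bprod).1.
  - exact: (bounded_measurableM (bc _ i0 bf) bprod).1.
  - by move=> k w; rewrite normrM ler_pM.
  - by apply: aeW => w; apply: cvgM; [exact: cf|exact: cvg_cst].
have c2 : \int[P]_w f_ k (Z i0 w) @[k --> \oo] --> \int[P]_w f (Z i0 w).
  apply: (@Rintegral_bounded_cvg _ _ _ _ _ _ M) => //.
  - by move=> k; exact: (bc _ i0 (Kf_ k).1).1.
  - exact: (bc _ i0 bf).1.
  - by apply: aeW => w; exact: cf.
move: c1; under eq_fun do rewrite (Kf_ _).2.
by move=> /(cvg_unique (@Rhausdorff R)); apply; exact: cvgMl.
Qed.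

(** The last summand is split off by cos(S + b + Z) = cos(S + b) cos Z + cos(S + b + pi/2) sin Z,
    and the sine term has expectation 0. For the induction to go through, the statement carries
    arbitrary functions of the remaining variables as factors, among which cos Z and sin Z are then
    placed. *)
Lemma indep_cos (n : nat) (Z : nat -> T -> R) (q : nat -> R) b :
  (forall i, measurable_fun setT (Z i)) ->
  mutually_independent P (fun i : 'I_n => Z i) ->
  (forall i, (i < n)%N -> \int[P]_w cos (Z i w) = q i) ->
  (forall i, (i < n)%N -> \int[P]_w sin (Z i w) = 0) ->
  \int[P]_w cos (\sum_(i < n) Z i w + b) = cos b * \prod_(i < n) q i.
Proof.
move=> mZ indZ cosZ sinZ.
have HI (g : nat -> R -> R) : (forall i, bounded_measurable (g i)) ->
    \int[P]_w (\prod_(0 <= i < n) g i (Z i w)) = \prod_(0 <= i < n) \int[P]_w g i (Z i w).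
  move=> bg; rewrite big_mkord -(indep_expectation (g := fun i : 'I_n => g i))//.
  by apply: eq_Rintegral => w _; rewrite big_mkord.
suff H j : (j <= n)%N -> forall b (g : nat -> R -> R), (forall i, bounded_measurable (g i)) ->
    \int[P]_w (cos (\sum_(0 <= i < j) Z i w + b) * \prod_(j <= i < n) g i (Z i w)) =
    cos b * \prod_(0 <= i < j) q i * \prod_(j <= i < n) \int[P]_w g i (Z i w).
  have := H n (leqnn n) b (fun _ _ => 0) (fun _ => bounded_measurable_cst _ _).
  rewrite [in X in _ = X -> _](@big_geq _ _ _ n n)// mulr1 big_mkord => <-.
  by apply: eq_Rintegral => w _; rewrite big_geq// mulr1 big_mkord.
elim: j => [_|j IH jn] {}b g bg.
  rewrite big_geq// mulr1 -HI// -RintegralZl//.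
    by apply: eq_Rintegral => w _; rewrite [X in cos (X + _)]big_geq// add0r.
  apply/bounded_measurable_integrable/bounded_measurable_prod => i.
  exact: (bounded_measurable_comp (bg i) (mZ i)).
pose upd (f : R -> R) i := if i == j then f else g i.
have bupd f : bounded_measurable f -> forall i, bounded_measurable (upd f i).
  by move=> bf i; rewrite /upd; case: ifP.
have updE f (F : (R -> R) -> nat -> R) :
    \prod_(j <= i < n) F (upd f i) i = F f j * \prod_(j.+1 <= i < n) F (g i) i.
  rewrite big_ltn// /upd eqxx; congr (_ * _).
  by apply: eq_big_nat => i /andP[ji _]; rewrite gtn_eqF.
have bcos : bounded_measurable (@cos R) by exact: (bounded_measurable_cos (@measurable_id _ _ _)).
have bsin : bounded_measurable (@sin R) by exact: (bounded_measurable_sin (@measurable_id _ _ _)).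
have bF b' f : bounded_measurable f -> bounded_measurable (fun w =>
    cos (\sum_(0 <= i < j) Z i w + b') * \prod_(j <= i < n) upd f i (Z i w)).
  move=> bf; apply: bounded_measurableM.
    by apply: bounded_measurable_cos; apply: measurable_funD => //; exact: measurable_sum.
  apply: bounded_measurable_prod => i; exact: (bounded_measurable_comp (bupd _ bf i) (mZ i)).
have i1 := bounded_measurable_integrable P (bF b _ bcos).
have i2 := bounded_measurable_integrable P (bF (b + pi / 2) _ bsin).
transitivity (\int[P]_w
   (cos (\sum_(0 <= i < j) Z i w + b) * \prod_(j <= i < n) upd (@cos R) i (Z i w)) +
   \int[P]_w
   (cos (\sum_(0 <= i < j) Z i w + (b + pi / 2)) * \prod_(j <= i < n) upd (@sin R) i (Z i w))).
  rewrite -RintegralD//; apply: eq_Rintegral => w _.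
  rewrite !(updE _ (fun f i => f (Z i w))) big_nat_recr//= addrAC cosD addrA cosDpihalf.
  by ring.
rewrite !(IH (ltnW jn))//; try exact: bupd.
rewrite !(updE _ (fun f i => \int[P]_w f (Z i w))) cosZ// sinZ// big_nat_recr//=.
by ring.
Qed.

End independence.

(** * Expectations of cosines for Brownian motion *)

Section brownian_cosines.
Context dX (TX : measurableType dX) (R : realType) (PX : probability TX R).
Context (X : R -> TX -> R) (cX : continuous_process setT X) (hX : OU_process PX X).
Context d (T : measurableType d) (P : probability T R).
Context (W : R -> T -> R) (cW : continuous_process `[0, +oo[ W) (hW : brownian_motion P W).
Notation psi := (gauss_cos PX X).

(** N(0, v) is realised as the law of sqrt v times [X 0], where scaling is plain multiplication;
    this also covers v = 0. *)
Lemma gaussian_law_scale (G : T -> R) v c : 0 <= v ->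
  has_law P G (gaussian_law 0 v) -> has_law P (fun w => c * G w) (gaussian_law 0 (c ^+ 2 * v)).
Proof.
move=> v0 hG B mB.
have s2 : Num.sqrt v ^+ 2 = v by rewrite sqr_sqrtr.
have mc : measurable ((fun x : R => c * x) @^-1` B).
  rewrite -[X in measurable X]setTI.
  by have : measurable_fun setT (fun x : R => c * x); [exact: measurable_funM|apply].
have := hG _ mc; rewrite -{1}s2 -(OU_scaled_law cX hX)// => ->.
have -> : c ^+ 2 * v = (c * Num.sqrt v) ^+ 2 by rewrite exprMn s2.
rewrite -(OU_scaled_law cX hX)//; congr (PX _).
by apply/seteqP; split => w /=; rewrite mulrA.
Qed.

Lemma brownian_measurable t : 0 <= t -> measurable_fun setT (W t).
Proof. by move=> t0; apply: cW.1; rewrite /= in_itv/= t0. Qed.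

Lemma brownian_scaled_cos s t c b : 0 <= s <= t ->
  \int[P]_w cos (c * (W t w - W s w) + b) = cos b * psi (c ^+ 2 * (t - s)).
Proof.
move=> st; have [_ /(_ s t st) hG _] := hW; have /andP[s0 st'] := st.
have t0 : 0 <= t by rewrite (le_trans s0).
have ts0 : 0 <= t - s by rewrite subr_ge0.
apply: (gauss_cosE cX hX); first by rewrite mulr_ge0 ?sqr_ge0.
- apply: measurable_funM => //; apply: measurable_funB; exact: brownian_measurable.
- exact: gaussian_law_scale ts0 hG.
Qed.

Lemma brownian_increments_cos (t : nat -> R) (c : nat -> R) n b : 0 <= t 0%N ->
  (forall i, t i <= t i.+1) ->
  \int[P]_w cos (\sum_(i < n) c i * (W (t i.+1) w - W (t i) w) + b) =
  cos b * \prod_(i < n) psi (c i ^+ 2 * (t i.+1 - t i)).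
Proof.
move=> t0 tt; have ti0 i : 0 <= t i by elim: i => // i; move/le_trans; apply.
have [_ _ /(_ n t t0 tt) indW] := hW.
have mi i : measurable_fun setT (W (t i.+1) \- W (t i)).
  by apply: measurable_funB; exact: brownian_measurable.
apply: (@indep_cos _ _ _ _ _ (fun i w => c i * (W (t i.+1) w - W (t i) w))
  (fun i => psi (c i ^+ 2 * (t i.+1 - t i)))).
- by move=> i; apply: measurable_funM => //; exact: mi.
- move=> B mB.
  have mc (i : 'I_n) : measurable ((fun x : R => c i * x) @^-1` B i).
    rewrite -[X in measurable X]setTI.
    by have : measurable_fun setT (fun x : R => c i * x); [exact: measurable_funM|apply].
  exact: indW mc.
- move=> i _; have := @brownian_scaled_cos (t i) (t i.+1) (c i) 0.
  by rewrite ti0 tt cos0 mul1r => <-//; apply: eq_Rintegral => w _; rewrite addr0.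
- move=> i _; have := @brownian_scaled_cos (t i) (t i.+1) (c i) (- (pi / 2)).
  rewrite ti0 tt cosN cos_pihalf mul0r => <-//; apply: eq_Rintegral => w _.
  by rewrite cosBpihalf.
Qed.

(** W itself supplies the independent Gaussian variables: W(u + v) - W(0) is one increment of
    variance u + v, and also the sum of two independent ones of variances u and v. *)
Lemma gauss_cosD u v : 0 <= u -> 0 <= v -> psi (u + v) = psi u * psi v.
Proof.
(* The times are 0, u, u + v, and then constant, since [brownian_motion] takes an infinite
   nondecreasing sequence. *)
move=> u0 v0; pose t n : R := if n is n'.+1 then (if n' is _.+1 then u + v else u) else 0.
have := @brownian_increments_cos t (fun=> 1) 2 0 (lexx _).
rewrite cos0 mul1r !big_ord_recl !big_ord0 /= mulr1 !expr1n !mul1r subr0 [u + v - u]addrAC subrr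
  add0r => <-.
- have := @brownian_scaled_cos 0 (u + v) 1 0.
  rewrite lexx addr_ge0// cos0 mul1r expr1n mul1r subr0 => <-//.
  apply: eq_Rintegral => w _; congr cos; rewrite !big_ord_recl !big_ord0/=; ring.
- by move=> [|[|i]] /=; rewrite ?lerDl.
Qed.

Lemma gauss_cos_sum (c : nat -> R) n : (forall i, 0 <= c i) ->
  psi (\sum_(i < n) c i) = \prod_(i < n) psi (c i).
Proof.
move=> c0; elim: n => [|n IH]; first by rewrite !big_ord0 gauss_cos0.
by rewrite !big_ord_recr/= gauss_cosD ?IH// sumr_ge0.
Qed.

(** By continuity W is the limit of its values on the grid of mesh 1 / (N + 1). Passing through the
    grid spares sorting the times of [s] and yields the same formula as for the noise driving X. *)
Lemma brownian_cos (s : seq (R * R)) b : all (fun p => 0 <= p.2) s ->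
  \int[P]_w cos (lincomb W s w + b) =
  cos b * psi (\sum_(p <- s) \sum_(q <- s) (p.1 * q.1) * Num.min p.2 q.2).
Proof.
pose t N k : R := k%:R / N.+1%:R.
have t0 N k : 0 <= t N k by rewrite divr_ge0.
have tS N k : t N k <= t N k.+1 by rewrite ler_pM2r ?invr_gt0// ler_nat.
apply: (@grid_process_cos R _ _ P W (fun N k w => W (t N k.+1) w - W (t N k) w)
  (fun N => N.+1%:R^-1)).
- by move=> v_ v; exact: gauss_cos_cvg.
- by move=> N k; apply: measurable_funB; exact: brownian_measurable.
- exact: brownian_measurable.
- move=> N M c b'.
  rewrite (@brownian_increments_cos (t N) c)// mulr_sumr (gauss_cos_sum (c := fun i => N.+1%:R^-1
    * c i ^+ 2)); last first.
    by move=> i; rewrite mulr_ge0 ?sqr_ge0.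
  congr (_ * _); apply: eq_bigr => i _; congr psi.
  by rewrite /t -natr1; field.
- by under eq_fun do rewrite divff//; exact: cvg_cst.
- move=> u u0; have [W0 _ _] := hW; apply: filterS W0 => w W0.
  have E N : \sum_(k < Num.truncn (u * N.+1%:R)) (W (t N k.+1) w - W (t N k) w) =
      W ((Num.truncn (u * N.+1%:R))%:R / N.+1%:R) w.
    elim: (Num.truncn _) => [|n IH]; first by rewrite big_ord0 mul0r W0.
    by rewrite big_ord_recr/= IH addrC subrK.
  under eq_fun do rewrite E.
  move: u0; rewrite le_eqVlt => /predU1P[<-|u0].
    by under eq_fun do rewrite mul0r truncn0 mul0r; exact: cvg_cst.
  have /continuous_within_itvcyP[cW1 _] := cW.2 w.
  have := cW1 u; rewrite in_itv/= u0 => /(_ isT).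
  by apply: cvg_comp; apply: truncn_grid_cvg; exact: ltW.
Qed.

End brownian_cosines.

(** * The rescaled driving noise of X as a Brownian motion *)

Section coupled_motion.
Context d (T : measurableType d) (R : realType) (P : probability T R).
Context (X : R -> T -> R) (cX : continuous_process setT X) (hX : OU_process P X).
Notation mu := (@lebesgue_measure R).
Notation psi := (gauss_cos P X).

(* The driving noise of dX = -2 X dt + 2 dB is B(t) = (X(t) - X(0)) / 2 + int_0^t X;
   this is B under Brownian scaling. *)
Definition coupled_motion (kappa t : R) (w : T) : R :=
  integrated_process kappa X t w + (Num.sqrt kappa)^-1 * ((X (kappa * t) w - X 0 w) / 2).

Lemma OU_continuous w : continuous (X^~ w).
Proof.
by move: (cX.2 w); rewrite continuous_open_subspace; [move=> h x; exact: (h x (in_setT x))|exact: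
  openT].
Qed.

Lemma continuous_coupled_motion kappa :
  continuous_process `[0, +oo[ (coupled_motion kappa).
Proof.
have [mI cI] := continuous_integrated_process kappa cX.
have mX t := OU_measurable cX t.
split => [t t0|w].
  apply: measurable_funD; first exact: mI.
  by apply: measurable_funM => //; apply: measurable_funM => //; exact: measurable_funB.
pose g t := (Num.sqrt kappa)^-1 * ((X (kappa * t) w - X 0 w) / 2).
have cg : continuous g.
  move=> t; apply: cvgMr; apply: cvgMl; apply: cvgB; last exact: cvg_cst.
  apply: (cvg_comp (fun t : R => kappa * t) (X^~ w)); last exact: OU_continuous.
  by apply: cvgMr; exact: cvg_id.
have cg' : {within `[0, +oo[, continuous g} by exact: continuous_subspaceT.
by move=> x; apply: cvgD; [exact: cI|exact: cg'].
Qed.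

Lemma exp_difference_quotient_cvg (a : R) : 0 < a ->
  (1 - expR (- (a / N.+1%:R))) / (a / N.+1%:R) @[N --> \oo] --> (1 : R).
Proof.
move=> a0.
have aN0 N : 0 < a / N.+1%:R by rewrite divr_gt0.
apply: (@squeeze_cvgr _ _ _ _ (fun N => (1 + a / N.+1%:R)^-1) (cst 1)).
- apply: nearW => N; set x := a / _; have x0 : 0 < x by exact: aN0.
  have e1 : 1 - x <= expR (- x) by have := expR_ge1Dx (- x); rewrite addrC.
  have e2 : expR (- x) <= (1 + x)^-1.
    by rewrite expRN lef_pV2 ?posrE ?expR_gt0 ?addr_gt0// expR_ge1Dx.
  apply/andP; split; last by rewrite ler_pdivrMr// mul1r lerBlDr addrC -lerBlDr.
  rewrite ler_pdivlMr// lerBrDr (le_trans (lerD (lexx _) e2))//.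
  by rewrite le_eqVlt; apply/orP; left; apply/eqP; field; rewrite gt_eqF// addr_gt0.
- have c1 : 1 + a / N.+1%:R @[N --> \oo] --> (1 : R).
    rewrite -[X in _ --> X]addr0 -(mulr0 a); apply: cvgD; first exact: cvg_cst.
    by apply: cvgMr; exact: cvg_harmonic.
  by rewrite -[X in _ --> X]invr1; apply: cvgV => //; exact: oner_neq0.
- exact: cvg_cst.
Qed.

(** Discrete form of 2 B(t) = X(t) - X(0) + 2 int_0^t X: the coefficient 1 - e^(-2h) is equivalent
    to 2h, which makes the last term a Riemann sum. *)
Lemma innovation_sum_telescope h n w : \sum_(k < n) innovation X h k w =
  X (n%:R * h) w - X 0 w + (1 - expR (- 2 * h)) * \sum_(k < n) X (k%:R * h) w.
Proof.
elim: n => [|n IH]; first by rewrite !big_ord0 mul0r mulr0 subrr addr0.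
by rewrite !big_ord_recr/= IH /innovation; ring.
Qed.

Definition coupled_noise (kappa : R) (N k : nat) (w : T) : R :=
  (Num.sqrt kappa)^-1 / 2 * innovation X (kappa / N.+1%:R) k w.

(** The variance of one [coupled_noise]. It is equivalent to 1 / (N + 1), the variance of a Brownian
    increment over one cell. *)
Definition coupled_var (kappa : R) (N : nat) : R :=
  (1 - expR (- 4 * (kappa / N.+1%:R))) / (4 * kappa).

Lemma coupled_noise_cvg kappa t w : 0 < kappa -> 0 <= t ->
  \sum_(k < Num.truncn (t * N.+1%:R)) coupled_noise kappa N k w @[N --> \oo] -->
  coupled_motion kappa t w.
Proof.
move=> k0 t0.
pose j N := Num.truncn (t * N.+1%:R); pose h N : R := kappa / N.+1%:R.
have h0 N : 0 < h N by rewrite divr_gt0.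
have E N : \sum_(k < j N) coupled_noise kappa N k w = (Num.sqrt kappa)^-1 * (
   (1 - expR (- (2 * kappa / N.+1%:R))) / (2 * kappa / N.+1%:R) *
     (h N * \sum_(k < j N) X (k%:R * h N) w)
   + (X ((j N)%:R * h N) w - X 0 w) / 2).
  rewrite /coupled_noise -mulr_sumr innovation_sum_telescope -/(h N).
  have -> : - 2 * h N = - (2 * kappa / N.+1%:R) by rewrite /h; ring.
  set e := expR _; set x := X _ _; set y := X _ _; set S := \sum_(_ < _) _.
  rewrite /h; field.
  by rewrite !gt_eqF// sqrtr_gt0.
rewrite (_ : (fun N => _) = (fun N => (Num.sqrt kappa)^-1 * (
   (1 - expR (- (2 * kappa / N.+1%:R))) / (2 * kappa / N.+1%:R) *
     (h N * \sum_(k < j N) X (k%:R * h N) w)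
   + (X ((j N)%:R * h N) w - X 0 w) / 2))); last by apply/funext => N; exact: E.
rewrite /coupled_motion /integrated_process -mulrDr; apply: cvgMr; apply: cvgD.
  rewrite -[X in _ --> X]mul1r; apply: cvgM.
    by apply: exp_difference_quotient_cvg; rewrite mulr_gt0.
  exact: (riemann_sum_cvg (@OU_continuous w) k0 t0).
apply: cvgMl; apply: cvgB; last exact: cvg_cst.
apply: (cvg_comp (fun N => (j N)%:R * h N) (X^~ w)); last exact: OU_continuous.
rewrite (_ : (fun N => _) = (fun N => kappa * ((j N)%:R / N.+1%:R))).
  by apply: cvgMr; exact: truncn_grid_cvg.
by apply/funext => N; rewrite /h; ring.
Qed.

Lemma coupled_noise_law kappa N M (c : nat -> R) : 0 < kappa ->
  has_law P (fun w => \sum_(k < M) c k * coupled_noise kappa N k w)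
    (gaussian_law 0 (coupled_var kappa N * \sum_(k < M) c k ^+ 2)).
Proof.
move=> k0; have h0 : 0 <= kappa / N.+1%:R by rewrite divr_ge0// ltW.
have := innovation_sum_law cX hX M (fun k => c k * ((Num.sqrt kappa)^-1 / 2)) h0.
under eq_fun do under eq_bigr do rewrite -mulrA.
rewrite (_ : _ * \sum_(k < M) _ = coupled_var kappa N * \sum_(k < M) c k ^+ 2)//.
under eq_bigr do rewrite exprMn.
rewrite -mulr_suml /coupled_var expr_div_n exprVn sqr_sqrtr ?(ltW k0)//.
by field; rewrite gt_eqF.
Qed.

Lemma coupled_var_ge0 kappa N : 0 < kappa -> 0 <= coupled_var kappa N.
Proof.
move=> k0; rewrite divr_ge0 ?mulr_ge0 ?(ltW k0)// subr_ge0 expR_le1.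
by rewrite mulNr oppr_le0 mulr_ge0// divr_ge0// ltW.
Qed.

Lemma coupled_var_le kappa N : 0 < kappa -> coupled_var kappa N <= N.+1%:R^-1.
Proof.
move=> k0; rewrite ler_pdivrMr ?mulr_gt0// lerBlDr.
have -> : N.+1%:R^-1 * (4 * kappa) = 4 * (kappa / N.+1%:R) by ring.
move: (kappa / N.+1%:R) => x; rewrite -lerBlDl.
by apply: le_trans (expR_ge1Dx _); rewrite mulNr.
Qed.

Lemma measurable_coupled_noise kappa N k : measurable_fun setT (coupled_noise kappa N k).
Proof.
apply: measurable_funM => //; apply: measurable_funB; first exact: OU_measurable.
by apply: measurable_funM => //; exact: OU_measurable.
Qed.

Lemma coupled_motion_cos kappa (s : seq (R * R)) b : 0 < kappa ->
  all (fun p => 0 <= p.2) s ->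
  \int[P]_w cos (lincomb (coupled_motion kappa) s w + b) =
  cos b * psi (\sum_(p <- s) \sum_(q <- s) (p.1 * q.1) * Num.min p.2 q.2).
Proof.
move=> k0; apply: (@grid_process_cos R _ _ P _ (coupled_noise kappa) (coupled_var kappa)).
- by move=> v_ v; exact: gauss_cos_cvg.
- by move=> N k; exact: measurable_coupled_noise.
- by move=> t t0; apply: (continuous_coupled_motion kappa).1; rewrite /= in_itv/= t0.
- move=> N M c b'; apply: (gauss_cosE cX hX).
  + by rewrite mulr_ge0 ?coupled_var_ge0// sumr_ge0// => i _; exact: sqr_ge0.
  + by apply: measurable_sum => k; apply: measurable_funM => //; exact: measurable_coupled_noise.
  + exact: coupled_noise_law.
- have k4 : 0 < 4 * kappa by rewrite mulr_gt0.
  rewrite (_ : (fun N => _) = (fun N =>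
      (1 - expR (- (4 * kappa / N.+1%:R))) / (4 * kappa / N.+1%:R))).
    exact: exp_difference_quotient_cvg.
  apply/funext => N; rewrite /coupled_var (_ : - 4 * _ = - (4 * kappa / N.+1%:R)); last by ring.
  have N0 : N.+1%:R != 0 :> R by rewrite pnatr_eq0.
  have kn0 : kappa != 0 by rewrite gt_eqF.
  by set e := expR _; field; rewrite nat1r N0 kn0.
- by move=> t t0; apply: aeW => w; exact: coupled_noise_cvg.
Qed.

(** The approximating sums are Gaussian with variance at most t, because [coupled_var] is at most 1
    / (N + 1) and there are at most t (N + 1) cells. Their exponential moments are bounded by 2, and
    Fatou's lemma passes this to the limit. *)
Lemma coupled_motion_expsqr (t : R) : 0 < t ->
  (\int[P]_w (expR (coupled_motion 1 t w ^+ 2 / (4 * t)))%:E <= 2%:E)%E.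
Proof.
move=> t0.
pose G N w := \sum_(k < Num.truncn (t * N.+1%:R)) coupled_noise 1 N k w.
pose e (x : R) : R := expR (x ^+ 2 / (4 * t)).
have ce : continuous e.
  move=> x; apply: (cvg_comp (fun x : R => x ^+ 2 / (4 * t)) expR); last exact: continuous_expR.
  by apply: cvgMl; exact: sqr_continuous.
have mG N : measurable_fun setT (G N).
  by apply: measurable_sum => k; exact: measurable_coupled_noise.
have me N : measurable_fun setT (fun w => (e (G N w))%:E).
  by apply/measurable_EFinP; apply: measurableT_comp => //; exact: continuous_measurable_fun.
have eG N : (\int[P]_w (e (G N w))%:E <= 2%:E)%E.
  pose n := Num.truncn (t * N.+1%:R).
  have := @coupled_noise_law 1 N n (fun=> 1) ltr01.
  under eq_fun do under eq_bigr do rewrite mul1r.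
  move=> hG; apply: (gaussian_law_expsqr (mG N) _ t0 hG).
  rewrite mulr_ge0 ?coupled_var_ge0//; last by rewrite sumr_ge0.
  under eq_bigr do rewrite expr1n; rewrite sumr_const card_ord.
  have := @coupled_var_le 1 N ltr01 => vN.
  have /andP[nN _] : n%:R <= t * N.+1%:R < n.+1%:R.
    by rewrite truncn_itv// mulr_ge0// ltW.
  rewrite /=.
  apply: le_trans (ler_pM (coupled_var_ge0 N ltr01) (ler0n _ _) vN nN) _.
  by rewrite le_eqVlt; apply/orP; left; apply/eqP; field.
have e0 N w : setT w -> (0 <= (e (G N w))%:E)%E by move=> _; rewrite lee_fin expR_ge0.
have := fatou P measurableT me e0.
have -> : (\int[P]_x limn_einf (fun N => (e (G N x))%:E) =
    \int[P]_w (expR (coupled_motion 1 t w ^+ 2 / (4 * t)))%:E)%E.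
  apply: eq_integral => w _.
  have cG : (e (G N w))%:E @[N --> \oo] --> (e (coupled_motion 1 t w))%:E.
    apply: cvg_EFin; first exact: nearW.
    apply: (cvg_comp (fun N => G N w) e); last exact: ce.
    exact: coupled_noise_cvg ltr01 (ltW t0).
  by have [-> _] := cvg_limn_einf_sup cG.
move=> /le_trans; apply; rewrite limn_einf_lim; apply: lime_le; first exact: is_cvg_einfs.
apply: nearW => n; apply: le_trans (eG n); apply: ereal_inf_lbound.
by exists n => /=.
Qed.

End coupled_motion.

(** * Deterministic chaining over dyadic times *)

Section dyadic_chaining.
Variable R : realType.

(** Level 0 holds the values at integers, from which a chain starts. At higher levels only steps
    from an even to the next odd multiple occur, the only nonzero ones met when a time rounded down
    is refined by one binary digit. *)
Definition dyadic_increment (x : R -> R) (m k : nat) : R :=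
  if m is m'.+1 then x ((k.*2.+1)%:R / 2 ^+ m) - x ((k.*2)%:R / 2 ^+ m) else x k%:R.

Lemma truncn_double (y : R) : 0 <= y ->
  Num.truncn (2 * y) = (Num.truncn y).*2 \/ Num.truncn (2 * y) = (Num.truncn y).*2.+1.
Proof.
move=> y0; set k := Num.truncn y.
have /andP[k1 k2] : k%:R <= y < k.+1%:R by rewrite truncn_itv.
have [h|h] := ltP (2 * y) (k.*2.+1)%:R; [left|right]; apply: truncn_def.
  by rewrite h andbT -muln2 natrM mulrC ler_pM2l.
by rewrite h/= (_ : k.*2.+2 = (2 * k.+1)%N) ?natrM ?ltr_pM2l//; lia.
Qed.

(** Twice (3/4)^2 is 9/8 > 1, and 24 (1 + 1/8)^m >= 24 + 3 m absorbs the linear factor. The right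
    side is a square so that its root is a summable geometric sequence. *)
Lemma geometric_bound (m : nat) : (1 + 3 * m%:R) / 2 ^+ m <= 24 * ((3 / 4) ^+ m) ^+ 2 :> R.
Proof.
have bern : 24 + 3 * m%:R <= 24 * (9 / 8) ^+ m :> R.
  elim: m => [|m IH]; first by rewrite expr0; lra.
  rewrite exprSr -natr1; have : 0 <= m%:R :> R by [].
  by lra.
rewrite ler_pdivrMr ?exprn_gt0// -exprM mulnC exprM -mulrA -exprMn.
rewrite (_ : (3 / 4) ^+ 2 * 2 = 9 / 8 :> R); last by field.
by apply: le_trans bern; lra.
Qed.

(* The increments at level m are at most 20 (3/4)^m sqrt(V + 1 + 2 ln(t + 2)), whence 80. *)
Lemma dyadic_chaining_bound (x : R -> R) (V t : R) : continuous x -> 0 <= t -> 0 <= V ->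
  (forall m k, expR (dyadic_increment x m k ^+ 2 * 2 ^+ m / 16) <=
     V * (2 ^+ m.+1 * (k.+1%:R * k.+2%:R))) ->
  `|x t| <= 80 * Num.sqrt (V + 1 + 2 * ln (t + 2)).
Proof.
move=> cx t0 V0 xV.
set A := V + 1 + 2 * ln (t + 2).
have t2 : 0 < t + 2 by rewrite ltr_wpDl.
have ln0 : 0 <= ln (t + 2) by rewrite ln_ge0// -lerBlDr (le_trans _ t0)//; lra.
have A1 : 1 <= A by rewrite /A; lra.
have A0 : 0 <= A by rewrite (le_trans ler01).
have ln2 : ln 2 <= 1 :> R.
  by have := @le_ln1Dx R 1; rewrite (_ : 1 + 1 = 2 :> R)//; apply; lra.
have Vp : 0 < V.
  rewrite lt_neqAle V0 andbT; apply/eqP => V00; have := xV 0%N 0%N.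
  by rewrite -V00 mul0r leNgt expR_gt0.
have inc m k : k%:R <= 2 ^+ m * t -> `|dyadic_increment x m k| <= 20 * (3 / 4) ^+ m * Num.sqrt A.
  move=> kt; set u := dyadic_increment x m k.
  have p2 : 0 < 2 ^+ m :> R by rewrite exprn_gt0.
  have p21 : 1 <= 2 ^+ m :> R by rewrite exprn_ege1// ler1n.
  have lnk j : (j <= 2)%N -> (0 < j)%N -> ln (k + j)%:R <= m%:R + ln (t + 2) :> R.
    move=> j2 j0; apply: (@le_trans _ _ (ln (2 ^+ m * (t + 2)))).
      rewrite ler_ln ?posrE ?ltr0n ?addn_gt0 ?j0 ?orbT ?mulr_gt0//.
      rewrite natrD mulrDr lerD// (@le_trans _ _ 2) ?ler_nat// ler_peMl//.
    rewrite lnM ?posrE// lerD2r lnXn// -[ln 2 *+ _]mulr_natl ler_piMr//.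
  (* The logarithm of the hypothesis: ln V <= V, the power of 2 costs at most m + 1, and [k.+1] and
     [k.+2] are at most 2^m (t + 2). *)
  have u1 : u ^+ 2 * 2 ^+ m / 16 <= (1 + 3 * m%:R) * A.
    rewrite -ler_expR (le_trans (xV m k))// -ler_ln ?posrE ?expR_gt0//; last first.
      by rewrite !mulr_gt0// exprn_gt0.
    rewrite expRK !lnM ?posrE ?mulr_gt0 ?exprn_gt0// lnXn// -[ln 2 *+ _]mulr_natl.
    have h1 := lnk 1%N isT isT; have h2 := lnk 2%N isT isT.
    rewrite addn1 in h1; rewrite addn2 in h2.
    have h3 : ln V <= V by rewrite ltW// ln_sublinear.
    have h4 : m.+1%:R * ln 2 <= m.+1%:R :> R by rewrite ler_piMr.
    have m0 : 0 <= m%:R :> R by [].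
    have h5 : m%:R <= m%:R * A by rewrite ler_peMr.
    rewrite -natr1 in h4 *.
    rewrite /A in h5 *; lra.
  (* The constant is 16 times the 24 of [geometric_bound], and 384 <= 20^2. *)
  have u2 : u ^+ 2 <= (20 * (3 / 4) ^+ m * Num.sqrt A) ^+ 2.
    rewrite [leRHS]exprMn sqr_sqrtr// exprMn.
    have := geometric_bound m; rewrite ler_pdivrMr// => gb.
    have : u ^+ 2 * 2 ^+ m <= 16 * ((1 + 3 * m%:R) * A) by lra.
    rewrite -ler_pdivlMr// => /le_trans; apply.
    rewrite ler_pdivrMr//.
    have gbA := ler_wpM2r A0 gb.
    have : 0 <= ((3 / 4) ^+ m) ^+ 2 * 2 ^+ m * A by rewrite mulr_ge0// mulr_ge0 ?sqr_ge0 ?(ltW p2).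
    by move: gbA; set q := ((3 / 4) ^+ m) ^+ 2; nra.
  rewrite -(@ler_pXn2r _ 2)// ?nnegrE ?mulr_ge0 ?exprn_ge0//.
  by rewrite real_normK// num_real.
pose D M : R := (Num.truncn (2 ^+ M * t))%:R / 2 ^+ M.
have tr M : (Num.truncn (2 ^+ M * t))%:R <= 2 ^+ M * t < (Num.truncn (2 ^+ M * t)).+1%:R.
  by rewrite truncn_itv// mulr_ge0// exprn_ge0.
have bound M : `|x (D M)| <= 80 * Num.sqrt A * (1 - (3 / 4) ^+ M.+1).
  elim: M => [|M IH].
    have := inc 0%N (Num.truncn t); rewrite !expr0 mul1r /= => /(_ _).
    have := tr 0%N; rewrite expr0 mul1r => /andP[-> _] /(_ isT) h.
    rewrite /D expr0 mul1r divr1 expr1; have := sqrtr_ge0 A; lra.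
  have E : `|x (D M.+1) - x (D M)| <= 20 * (3 / 4) ^+ M.+1 * Num.sqrt A.
    have DM : D M = ((Num.truncn (2 ^+ M * t)).*2)%:R / 2 ^+ M.+1.
      by rewrite /D exprS -muln2 natrM; field.
    have y0 : 0 <= 2 ^+ M * t by rewrite mulr_ge0// exprn_ge0.
    rewrite DM {1}/D exprS -mulrA; have [->|->] := truncn_double y0.
      by rewrite subrr normr0 mulr_ge0// mulr_ge0// exprn_ge0.
    rewrite -exprS; apply: (inc M.+1).
    have /andP[+ _] := tr M; move/le_trans; apply.
    by rewrite ler_wpM2r// exprS ler_peMl ?exprn_ge0// ler1n.
  have -> : x (D M.+1) = x (D M) + (x (D M.+1) - x (D M)) by rewrite addrC subrK.
  apply: le_trans (ler_normD _ _) _; apply: le_trans (lerD IH E) _.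
  rewrite [X in _ <= _ * (1 - X)]exprS le_eqVlt; apply/orP; left; apply/eqP.
  by field.
have cD : D M @[M --> \oo] --> t.
  apply: (@squeeze_cvgr _ _ _ _ (fun M => t - (2^-1) ^+ M) (cst t)).
  - apply: nearW => M; have /andP[l u] := tr M.
    have p2 : 0 < 2 ^+ M :> R by rewrite exprn_gt0.
    rewrite /D ler_pdivrMr// [t * _]mulrC l andbT ler_pdivlMr// mulrBl exprVn mulVf ?gt_eqF//.
    by rewrite lerBlDr natr1 mulrC ltW.
  - rewrite -[X in _ --> X]subr0; apply: cvgB; first exact: cvg_cst.
    by apply: cvg_expr; rewrite gtr0_norm// invf_lt1// ltr1n.
  - exact: cvg_cst.
have cn : `|x (D M)| @[M --> \oo] --> `|x t|.
  by apply: cvg_norm; apply: (cvg_comp D x cD); exact: cx.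
rewrite -(cvg_lim (@Rhausdorff R) cn); apply: limr_le; first by apply/cvg_ex; eexists; exact: cn.
apply: nearW => M; apply: le_trans (bound M) _.
by rewrite ler_piMr ?mulr_ge0 ?sqrtr_ge0// lerBlDr lerDl exprn_ge0.
Qed.

End dyadic_chaining.

(** * An integrable random envelope for X and its driving noise *)

Section path_envelope.
Context d (T : measurableType d) (R : realType) (P : probability T R).

Lemma nneseries_term (u : nat -> \bar R) n : (forall k, (0 <= u k)%E) ->
  (u n <= \sum_(k <oo) u k)%E.
Proof.
move=> u0; apply: le_trans (nneseries_lim_ge n.+1 _) => //.
by rewrite big_nat_recr//= leeDr// sume_ge0.
Qed.

Lemma weighted_series_integral (b : nat -> R) (e : nat -> T -> \bar R) :
  (forall n, 0 <= b n) -> (forall N, \sum_(0 <= n < N) b n <= 1) ->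
  (forall n, measurable_fun setT (e n)) -> (forall n w, 0 <= e n w)%E ->
  (forall n, \int[P]_w e n w <= 2%:E)%E ->
  (\int[P]_w (\sum_(n <oo) (b n)%:E * e n w) <= 2%:E)%E.
Proof.
move=> b0 b1 me e0 e2.
rewrite integral_nneseries//; last 2 first.
- by move=> n; exact: emeasurable_funM.
- by move=> n w _; rewrite mule_ge0// lee_fin.
have be n : (\int[P]_w ((b n)%:E * e n w) = (b n)%:E * \int[P]_w e n w)%E.
  by rewrite ge0_integralZl_EFin.
have i0 n : (0 <= \int[P]_w e n w)%E by exact: integral_ge0.
under eq_eseriesr do rewrite be.
apply: lime_le.
  by apply: is_cvg_nneseries => n _ _; rewrite mule_ge0// lee_fin.
apply: nearW => N.
apply: (@le_trans _ _ (\sum_(0 <= n < N) (b n * 2)%:E)%E).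
  by apply: lee_sum => n _; rewrite EFinM lee_wpmul2l// lee_fin.
by rewrite sumEFin lee_fin -mulr_suml -[leRHS]mul1r ler_wpM2r.
Qed.

Lemma weighted_series_measurable (b : nat -> R) (e : nat -> T -> \bar R) :
  (forall n, 0 <= b n) -> (forall n, measurable_fun setT (e n)) ->
  (forall n w, 0 <= e n w)%E ->
  measurable_fun setT (fun w => \sum_(n <oo) (b n)%:E * e n w)%E.
Proof.
move=> b0 me e0; apply: ge0_emeasurable_sum => n; last by move=> _; exact: emeasurable_funM.
by move=> w _ _; rewrite mule_ge0// lee_fin.
Qed.

(** The logarithm of an inverse weight is the price of controlling a term by the whole series.
    Geometric weights for the levels cost a multiple of m, absorbed by the variances of order
    2^(-m); the weights 1 / ((k+1)(k+2)) for the positions cost only a logarithm of k, so that the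
    envelope of |X(t)|^2 grows like ln t. *)
Definition half_weight (n : nat) : R := (2 ^+ n.+1)^-1.
Definition telescoping_weight (n : nat) : R := (n.+1%:R * n.+2%:R)^-1.

Lemma half_weight_ge0 n : 0 <= half_weight n.
Proof. by rewrite invr_ge0 exprn_ge0. Qed.

Lemma telescoping_weight_ge0 n : 0 <= telescoping_weight n.
Proof. by rewrite invr_ge0. Qed.

Lemma half_weight_sum N : \sum_(0 <= n < N) half_weight n <= 1.
Proof.
suff -> : \sum_(0 <= n < N) half_weight n = 1 - (2 ^+ N)^-1.
  by rewrite lerBlDr lerDl invr_ge0 exprn_ge0.
elim: N => [|N IH]; first by rewrite big_geq// expr0 invr1 subrr.
rewrite big_nat_recr//= IH /half_weight exprS.
by field; rewrite expf_neq0.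
Qed.

Lemma telescoping_weight_sum N : \sum_(0 <= n < N) telescoping_weight n <= 1.
Proof.
suff -> : \sum_(0 <= n < N) telescoping_weight n = 1 - N.+1%:R^-1.
  by rewrite lerBlDr lerDl invr_ge0.
elim: N => [|N IH]; first by rewrite big_geq// invr1 subrr.
rewrite big_nat_recr//= IH /telescoping_weight -!natr1.
have N0 : 0 <= N%:R :> R by [].
by field; rewrite !gt_eqF// ?ltr_wpDl// addr_gt0// ltr_wpDl.
Qed.

Context (X : R -> T -> R) (cX : continuous_process setT X) (hX : OU_process P X).

(** Over a step h = 2^(-m) the variance is 2 (1 - e^(-2h)) <= 4h, and level 0 has variance 1 <=
    4. *)
Lemma dyadic_increment_lincomb m k : exists2 s : seq (R * R),
  (fun w => dyadic_increment (X^~ w) m k) = lincomb X s &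
  \int[P]_w (lincomb X s w ^+ 2) <= 4 / 2 ^+ m.
Proof.
case: m => [|m].
  exists [:: (1, k%:R)]; first by apply/funext => w; rewrite /lincomb big_seq1 mul1r.
  rewrite (OU_lincomb_variance cX hX) !big_seq1/= subrr normr0 mulr0 expR0 expr0; lra.
exists [:: (1, (k.*2.+1)%:R / 2 ^+ m.+1); (- 1, (k.*2)%:R / 2 ^+ m.+1)].
  by apply/funext => w; rewrite /lincomb big_cons big_seq1 mul1r mulN1r.
have p2 : 0 < 2 ^+ m.+1 :> R by rewrite exprn_gt0.
rewrite (OU_lincomb_variance cX hX) !(big_cons, big_nil)/= !subrr normr0 mulr0 expR0.
have d1 : `|(k.*2.+1)%:R / 2 ^+ m.+1 - (k.*2)%:R / 2 ^+ m.+1| = (2 ^+ m.+1)^-1 :> R.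
  by rewrite -mulrBl -natrB// subSnn mul1r gtr0_norm// invr_gt0.
have d2 : `|(k.*2)%:R / 2 ^+ m.+1 - (k.*2.+1)%:R / 2 ^+ m.+1| = (2 ^+ m.+1)^-1 :> R.
  by rewrite distrC.
rewrite d1 d2.
have := expR_ge1Dx (- 2 * (2 ^+ m.+1)^-1 : R).
by move: (expR _) => e; lra.
Qed.

Lemma dyadic_increment_expsqr m k :
  (\int[P]_w (expR (dyadic_increment (X^~ w) m k ^+ 2 * 2 ^+ m / 16))%:E <= 2%:E)%E.
Proof.
have [s sE sv] := dyadic_increment_lincomb m k.
have t0 : 0 < 4 / 2 ^+ m :> R by rewrite divr_gt0// exprn_gt0.
have mL : measurable_fun setT (lincomb X s) by apply: measurable_lincomb; exact: OU_measurable.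
have hL := OU_lincomb_law cX hX s.
have := gaussian_law_expsqr mL _ t0 hL.
rewrite sv andbT Rintegral_ge0 => [/(_ isT)|w _]; last exact: sqr_ge0.
apply: le_trans; rewrite le_eqVlt; apply/orP; left; apply/eqP.
apply: eq_integral => w _; congr (expR _)%:E; rewrite -sE.
by field; rewrite expf_neq0.
Qed.

Lemma measurable_dyadic_increment m k :
  measurable_fun setT (fun w => dyadic_increment (X^~ w) m k).
Proof.
have [s -> _] := dyadic_increment_lincomb m k.
by apply: measurable_lincomb; exact: OU_measurable.
Qed.

Lemma measurable_expsqr (f : T -> R) (c : R) : measurable_fun setT f ->
  measurable_fun setT (fun w => (expR (f w ^+ 2 * c))%:E).
Proof.
move=> mf; apply/measurable_EFinP/measurableT_comp => //.
by apply: measurable_funM => //; exact: measurable_funX.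
Qed.

Lemma le_weighted_exp (V : \bar R) (b y : R) : (0 <= V)%E -> (V < +oo)%E -> 0 < b ->
  (b%:E * (expR y)%:E <= V)%E -> expR y <= fine V * b^-1.
Proof.
case: V => //= V _ _ b0; rewrite -EFinM lee_fin => h.
by rewrite ler_pdivlMr// mulrC.
Qed.

(* Q is a weighted sum of exponentials of squares of Gaussian variables, each of expectation
   at most 2; as each term is at most Q, each variable is controlled by Q and the logarithm of
   its weight. *)
Lemma OU_path_envelope : exists Q : T -> R, [/\ forall w, 0 <= Q w,
  P.-integrable setT (EFin \o Q) & {ae P, forall w,
    (forall t, 0 <= t -> `|X t w| <= 80 * Num.sqrt (Q w + 1 + 2 * ln (t + 2))) /\
    (forall n : nat, coupled_motion X 1 n.+1%:R w ^+ 2 <=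
       4 * n.+1%:R * (Q w + 2 * ln n.+2%:R))}].
Proof.
pose e m k w : \bar R := (expR (dyadic_increment (X^~ w) m k ^+ 2 * 2 ^+ m / 16))%:E.
pose S m w : \bar R := (\sum_(k <oo) (telescoping_weight k)%:E * e m k w)%E.
pose V w : \bar R := (\sum_(m <oo) (half_weight m)%:E * S m w)%E.
pose e' n w : \bar R := (expR (coupled_motion X 1 n.+1%:R w ^+ 2 / (4 * n.+1%:R)))%:E.
pose V' w : \bar R := (\sum_(n <oo) (telescoping_weight n)%:E * e' n w)%E.
have me m k : measurable_fun setT (e m k).
  rewrite /e; under eq_fun do rewrite -mulrA.
  by apply: measurable_expsqr; exact: measurable_dyadic_increment.
have me' n : measurable_fun setT (e' n).
  apply: measurable_expsqr; apply: (continuous_coupled_motion cX 1).1.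
  by rewrite /= in_itv/= ler0n.
have e0 m k w : (0 <= e m k w)%E by rewrite lee_fin expR_ge0.
have e'0 n w : (0 <= e' n w)%E by rewrite lee_fin expR_ge0.
have b0 := telescoping_weight_ge0; have a0 := half_weight_ge0.
have S0 m w : (0 <= S m w)%E by apply: nneseries_ge0 => k _ _; rewrite mule_ge0// lee_fin.
have mS m : measurable_fun setT (S m) by exact: weighted_series_measurable.
have V0 w : (0 <= V w)%E by apply: nneseries_ge0 => k _ _; rewrite mule_ge0// lee_fin.
have mV : measurable_fun setT V by exact: weighted_series_measurable.
have V'0 w : (0 <= V' w)%E by apply: nneseries_ge0 => k _ _; rewrite mule_ge0// lee_fin.
have mV' : measurable_fun setT V' by exact: weighted_series_measurable.
have iS m : (\int[P]_w S m w <= 2%:E)%E.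
  apply: weighted_series_integral => //; first exact: telescoping_weight_sum.
  by move=> k; exact: dyadic_increment_expsqr.
have iV : (\int[P]_w V w <= 2%:E)%E.
  by apply: weighted_series_integral => //; exact: half_weight_sum.
have iV' : (\int[P]_w V' w <= 2%:E)%E.
  apply: weighted_series_integral => //; first exact: telescoping_weight_sum.
  by move=> n; apply: coupled_motion_expsqr.
have iVV : P.-integrable setT (V \+ V')%E.
  apply/integrableP; split; first exact: emeasurable_funD.
  under eq_integral do rewrite gee0_abs ?adde_ge0//.
  rewrite ge0_integralD//; apply: (@le_lt_trans _ _ (2%:E + 2%:E)%E); first exact: leeD.
  by rewrite ltry.
exists (fun w => fine (V w + V' w)%E); split.
- by move=> w; rewrite fine_ge0// adde_ge0.
- apply: le_integrable iVV => //.
    apply/measurable_EFinP; apply: (measurableT_comp (fine_measurable measurableT)).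
    exact: emeasurable_funD.
  move=> w _ /=; rewrite ger0_norm ?fine_ge0 ?adde_ge0// gee0_abs ?adde_ge0//.
  by case: (V w + V' w)%E (adde_ge0 (V0 w) (V'0 w)).
(* Integrability makes both series finite almost surely; where they are finite, [fine] is their
   actual sum. *)
- have := integrable_ae measurableT iVV; apply: filterS => w /(_ I) fin.
  have VVoo : (V w + V' w < +oo)%E by rewrite -ge0_fin_numE// adde_ge0.
  set q := fine (V w + V' w)%E.
  have q0 : 0 <= q by rewrite fine_ge0// adde_ge0.
  split=> [t t0|n].
    apply: (@dyadic_chaining_bound R (X^~ w) q t _ t0 q0) => [x|m k].
      exact: (OU_continuous cX).
    have b0' : 0 < half_weight m * telescoping_weight k.
      by rewrite mulr_gt0// invr_gt0 ?exprn_gt0 ?mulr_gt0.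
    have h : ((half_weight m * telescoping_weight k)%:E * e m k w <= V w + V' w)%E.
      apply: (@le_trans _ _ (V w)); last by rewrite leeDl.
      apply: le_trans (nneseries_term m _); last first.
        by move=> j; rewrite mule_ge0// lee_fin.
      rewrite EFinM -muleA lee_wpmul2l ?lee_fin//.
      by apply: (@nneseries_term (fun k => (telescoping_weight k)%:E * e m k w)%E k) => j;
        rewrite mule_ge0// lee_fin.
    have := le_weighted_exp (adde_ge0 (V0 w) (V'0 w)) VVoo b0' h.
    by rewrite /half_weight /telescoping_weight -invfM invrK.
  have b0' : 0 < telescoping_weight n by rewrite invr_gt0 mulr_gt0.
  have h : ((telescoping_weight n)%:E * e' n w <= V w + V' w)%E.
    apply: (@le_trans _ _ (V' w)); last by rewrite leeDr.
    by apply: (@nneseries_term (fun k => (telescoping_weight k)%:E * e' k w)%E n) => j; rewrite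
      mule_ge0// lee_fin.
  have := le_weighted_exp (adde_ge0 (V0 w) (V'0 w)) VVoo b0' h.
  rewrite -/q /telescoping_weight invrK => he.
  have qp : 0 < q.
    rewrite lt_neqAle q0 andbT; apply/eqP => q00.
    by move: he; rewrite -q00 mul0r leNgt expR_gt0.
  rewrite mulrC -ler_pdivrMr ?mulr_gt0// -ler_expR (le_trans he)//.
  rewrite -ler_ln ?posrE ?expR_gt0 ?mulr_gt0// expRK !lnM ?posrE ?mulr_gt0//.
  have h3 : ln q <= q by rewrite ltW// ln_sublinear.
  have h4 : ln n.+1%:R <= ln n.+2%:R :> R by rewrite ler_ln ?posrE// ler_nat.
  lra.
Qed.

End path_envelope.

Lemma sqr_le_sqrt (R : rcfType) (a b : R) : 0 <= a -> a ^+ 2 <= b -> a <= Num.sqrt b.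
Proof. by move=> a0 ab; rewrite -[a]ger0_norm// -sqrtr_sqr ler_wsqrtr. Qed.

(** * Paths of sublinear growth belong to C_(0) *)

Section sublinear_paths.
Context d (T : measurableType d) (R : realType).
Implicit Types Y : R -> T -> R.

Lemma c0_pathE Y w t : (fun t => if 0 <= t then Y t w else 0) \in c0_pred R ->
  0 <= t -> c0_path Y w t = Y t w.
Proof.
move=> Yw t0; rewrite /c0_path.
rewrite [LHS](_ : _ = val (insubd (0 : C0 R) (fun t => if 0 <= t then Y t w else 0)) t)//.
by rewrite insubdK// t0.
Qed.

(* The bound is K (1 + kappa t)^(3/4). *)
Lemma sublinear_c0_pred Y w (kappa K : R) : {within `[0, +oo[, continuous (Y^~ w)} ->
  Y 0 w = 0 -> 0 < kappa -> 0 <= K ->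
  (forall t, 0 <= t -> `|Y t w| <=
     K * (Num.sqrt (1 + kappa * t) * Num.sqrt (Num.sqrt (1 + kappa * t)))) ->
  (fun t => if 0 <= t then Y t w else 0) \in c0_pred R.
Proof.
move=> cY Y0 k0 K0 YK; apply/(c0_path_predP cY); split => // m.
pose M := K * m.+1%:R * kappa; have M0 : 0 <= M by rewrite mulr_ge0 ?mulr_ge0// ltW.
(* With y = 1 + kappa r and q = sqrt y, the bound q >= L gives both q >= 2 and sqrt q >= 2 M, hence
   M q sqrt q <= q^2 / 2 <= q^2 - 1 = kappa r. *)
pose L := 2 + 4 * M ^+ 2; have L0 : 0 <= L by rewrite addr_ge0// mulr_ge0// sqr_ge0.
exists (Num.truncn (L ^+ 2 / kappa)).+1 => r rN.
have rL : L ^+ 2 / kappa < ratr r by rewrite (lt_trans _ rN)// truncnS_gt.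
have r0 : 0 <= ratr r :> R.
  by rewrite (le_trans _ (ltW rL))// divr_ge0 ?sqr_ge0// ltW.
rewrite subr_le0 (le_trans (YK _ r0))//.
set y := 1 + kappa * ratr r.
have y0 : 0 <= y by rewrite addr_ge0// mulr_ge0// ltW.
set q := Num.sqrt y.
have q2 : q ^+ 2 = y by rewrite sqr_sqrtr.
have qL : L <= q.
  apply: sqr_le_sqrt => //; rewrite /y.
  move: rL; rewrite ltr_pdivrMr// mulrC => /ltW h; lra.
have q0 : 0 <= q by rewrite sqrtr_ge0.
have qq : 2 * M <= Num.sqrt q.
  apply: sqr_le_sqrt; first by rewrite mulr_ge0.
  by rewrite (le_trans _ qL)// /L exprMn; lra.
have -> : ratr r = (q ^+ 2 - 1) / kappa by rewrite q2 /y; field; rewrite gt_eqF.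
rewrite -mulrA -invfM ler_pdivlMr ?mulr_gt0//.
have q2' : 2 <= q by apply: le_trans qL; rewrite lerDl mulr_ge0// sqr_ge0.
have sq : Num.sqrt q ^+ 2 = q by rewrite sqr_sqrtr.
set s := Num.sqrt q in qq sq *.
have s0 : 0 <= s by exact: sqrtr_ge0.
have -> : K * (q * s) * (kappa * m.+1%:R) = M * (q * s) by rewrite /M; ring.
have h1 : 2 * M * (q * s) <= s * (q * s) by rewrite ler_wpM2r// mulr_ge0.
have h2 : s * (q * s) = q ^+ 2 by rewrite -sq; ring.
nra.
Qed.

End sublinear_paths.

(** * Pathwise estimates on the event where the envelope holds *)

Section path_estimates.
Context d (T : measurableType d) (R : realType) (X : R -> T -> R).
Hypothesis cX : continuous_process setT X.
Notation mu := (@lebesgue_measure R).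
Variables (w : T) (Q : R).
Hypothesis Q0 : 0 <= Q.
Hypothesis XQ : forall t, 0 <= t -> `|X t w| <= 80 * Num.sqrt (Q + 1 + 2 * ln (t + 2)).
Hypothesis BQ : forall n : nat, coupled_motion X 1 n.+1%:R w ^+ 2 <=
  4 * n.+1%:R * (Q + 2 * ln n.+2%:R).

Let A t : R := Q + 1 + 2 * ln (t + 2).

Let ln2 : ln 2 <= 1 :> R.
Proof. by have := @le_ln1Dx R 1; rewrite (_ : 1 + 1 = 2 :> R)//; apply; lra. Qed.

Let A_ge1 t : 0 <= t -> 1 <= A t.
Proof.
move=> t0; have h : 0 <= ln (t + 2) by rewrite ln_ge0//; lra.
by have := Q0; rewrite /A; lra.
Qed.

Let A_le s t : 0 <= s <= t -> A s <= A t.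
Proof.
by move=> /andP[s0 st]; rewrite lerD2l ler_pM2l// ler_ln ?posrE ?lerD2r//; lra.
Qed.

Let X_le s t : 0 <= s <= t -> `|X s w| <= 80 * Num.sqrt (A t).
Proof.
move=> /[dup] st /andP[s0 _]; rewrite (le_trans (XQ s0))// ler_wpM2l// ler_wsqrtr//.
exact: A_le.
Qed.

(** With q = sqrt(1 + t) >= 1, ln q <= q gives ln(t + 2) <= 1 + 2q, whence A t <= Q + 3 + 4q <= (Q +
    7) q. The logarithm is traded for a quarter power, which still leaves sublinear growth. *)
Let A_sqrt t : 0 <= t -> Num.sqrt (A t) <= Num.sqrt (Q + 7) * Num.sqrt (Num.sqrt (1 + t)).
Proof.
move=> t0; have t1 : 1 <= 1 + t by lra.
set q := Num.sqrt (1 + t); have q1 : 1 <= q by rewrite -[leLHS]sqrtr1 ler_wsqrtr.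
have q2 : q ^+ 2 = 1 + t by rewrite sqr_sqrtr//; lra.
rewrite -sqrtrM ?addr_ge0// ler_wsqrtr//.
have lq : ln (t + 2) <= 1 + 2 * q.
  apply: (@le_trans _ _ (ln (2 * q ^+ 2))).
    by rewrite ler_ln ?posrE ?q2; lra.
  rewrite lnM ?posrE ?exprn_gt0//; last by lra.
  rewrite lnXn ?(lt_le_trans ltr01)// -[ln q *+ _]mulr_natl lerD// ler_pM2l//.
  by rewrite ltW// ln_sublinear// (lt_le_trans ltr01).
have h : Q <= Q * q by rewrite ler_peMr.
by have := Q0; rewrite /A; lra.
Qed.

(* The bound on X alone is not sublinear for the integral; the bound on the noise at integer
   times is, and X is used only between them. *)
Lemma integral_OU_bound t : 0 <= t -> `|\int[mu]_(s in `[0, t]) X s w| <=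
  162 * Num.sqrt (Q + 7) * (Num.sqrt (1 + t) * Num.sqrt (Num.sqrt (1 + t))).
Proof.
move=> t0; set a := Num.sqrt (A t); have a0 : 0 <= a by exact: sqrtr_ge0.
pose S u := \int[mu]_(s in `[0, u]) X s w.
pose n := Num.truncn t.
have /andP[nt tn] : n%:R <= t < n.+1%:R by rewrite truncn_itv.
have t1 : 1 <= 1 + t by lra.
set q := Num.sqrt (1 + t); have q1 : 1 <= q by rewrite -[leLHS]sqrtr1 ler_wsqrtr.
have St : `|S t - S n%:R| <= 80 * a.
  have ab : (0:R) <= n%:R <= t by rewrite ler0n nt.
  have fe s : n%:R <= s <= t -> `|X s w - 0| <= 80 * a.
    by move=> /andP[ns st]; rewrite subr0; apply: X_le; rewrite st andbT (le_trans _ ns).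
  have := Rintegral_increment_le (OU_continuous cX (w := w)) ab fe.
  rewrite mul0r subr0 => /le_trans; apply.
  by rewrite ler_piMr ?mulr_ge0//; move: tn; rewrite -natr1; lra.
have Sn : `|S n%:R| <= 2 * q * a + 80 * a.
  case: n nt tn {St} => [_ _|n nt tn].
    by rewrite /S set_itv1 Rintegral_set1 normr0 addr_ge0 ?mulr_ge0// sqrtr_ge0.
  have BE : S n.+1%:R = coupled_motion X 1 n.+1%:R w - (X n.+1%:R w - X 0 w) / 2.
    by rewrite /coupled_motion /integrated_process sqrtr1 invr1 !mul1r addrK.
  have B1 : `|coupled_motion X 1 n.+1%:R w| <= 2 * q * a.
    rewrite -(@ler_pXn2r _ 2)// ?nnegrE ?mulr_ge0 ?sqrtr_ge0// real_normK ?num_real//.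
    apply: le_trans (BQ n) _.
    rewrite !exprMn [q ^+ 2]sqr_sqrtr ?(le_trans ler01)// sqr_sqrtr; last first.
      by rewrite (le_trans ler01)// A_ge1.
    have h1 : Q + 2 * ln n.+2%:R <= A t.
      rewrite /A -addrA lerD2l.
      have : ln n.+2%:R <= ln (t + 2).
        rewrite ler_ln ?posrE//; last by lra.
        by rewrite -natr1; lra.
      lra.
    have h2 : n.+1%:R <= 1 + t by lra.
    have h3 := A_ge1 t0.
    have n0 : 0 <= n.+1%:R :> R by [].
    have := ler_pM n0 _ h2 h1; rewrite addr_ge0 ?mulr_ge0 ?ln_ge0 ?ler1n// => /(_ isT).
    by rewrite expr2; lra.
  have X1 : `|X n.+1%:R w| <= 80 * a by apply: X_le; rewrite nt andbT.
  have X0 : `|X 0 w| <= 80 * a by apply: X_le; rewrite lexx.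
  rewrite BE (le_trans (ler_normB _ _))// lerD// normrM.
  have -> : `|2^-1| = 2^-1 :> R by rewrite ger0_norm.
  have := ler_normB (X n.+1%:R w) (X 0 w); lra.
(* 80 for the last partial unit interval, 80 for the endpoint values of X and 2 for the noise; all
   carry the factor q since q >= 1. *)
have Sbound : `|S t| <= 162 * q * a.
  have -> : S t = (S t - S n%:R) + S n%:R by rewrite subrK.
  apply: le_trans (ler_normD _ _) _; nra.
have := A_sqrt t0; rewrite -/a -/q => aq.
apply: le_trans Sbound _.
have -> : 162 * Num.sqrt (Q + 7) * (q * Num.sqrt q) = 162 * q * (Num.sqrt (Q + 7) * Num.sqrt q).
  by ring.
by rewrite ler_wpM2l// mulr_ge0// (le_trans ler01).
Qed.

Variable kappa : R.
Hypothesis k1 : 1 <= kappa.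

Let k0 : 0 < kappa. Proof. exact: lt_le_trans ltr01 k1. Qed.
Let sk0 : 0 < Num.sqrt kappa. Proof. by rewrite sqrtr_gt0. Qed.
Let sk1 : (Num.sqrt kappa)^-1 <= 1.
Proof. by rewrite invf_le1// -[leLHS]sqrtr1 ler_wsqrtr. Qed.
Let ski : 0 <= (Num.sqrt kappa)^-1. Proof. by rewrite invr_ge0 ltW. Qed.

Lemma integrated_process_bound t : 0 <= t -> `|integrated_process kappa X t w| <=
  162 * Num.sqrt (Q + 7) * (Num.sqrt (1 + kappa * t) * Num.sqrt (Num.sqrt (1 + kappa * t))).
Proof.
move=> t0; rewrite /integrated_process normrM (ger0_norm ski).
have kt0 : 0 <= kappa * t by rewrite mulr_ge0// ltW.
by apply: le_trans (integral_OU_bound kt0); rewrite ler_piMl.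
Qed.

Lemma coupling_gap t : 0 <= t ->
  `|integrated_process kappa X t w - coupled_motion X kappa t w| <=
  (Num.sqrt kappa)^-1 * (80 * Num.sqrt (A (kappa * t))).
Proof.
move=> t0; rewrite /coupled_motion opprD addrA subrr add0r normrN normrM (ger0_norm ski).
have kt0 : 0 <= kappa * t by rewrite mulr_ge0// ltW.
have X1 : `|X (kappa * t) w| <= 80 * Num.sqrt (A (kappa * t)) by apply: X_le; rewrite kt0 lexx.
have X0 : `|X 0 w| <= 80 * Num.sqrt (A (kappa * t)) by apply: X_le; rewrite lexx.
rewrite ler_wpM2l// normrM [`|2^-1|]ger0_norm//.
by have := ler_normB (X (kappa * t) w) (X 0 w); lra.
Qed.

Lemma coupled_motion_bound t : 0 <= t -> `|coupled_motion X kappa t w| <=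
  242 * Num.sqrt (Q + 7) * (Num.sqrt (1 + kappa * t) * Num.sqrt (Num.sqrt (1 + kappa * t))).
Proof.
move=> t0; have kt0 : 0 <= kappa * t by rewrite mulr_ge0// ltW.
have h1 := integrated_process_bound t0; have h2 := coupling_gap t0.
have h3 := A_sqrt kt0.
set q := Num.sqrt (1 + kappa * t) in h1 h3 *.
have q1 : 1 <= q by rewrite -[leLHS]sqrtr1 ler_wsqrtr//; lra.
have h4 : (Num.sqrt kappa)^-1 * (80 * Num.sqrt (A (kappa * t))) <=
    80 * Num.sqrt (Q + 7) * (q * Num.sqrt q).
  apply: (@le_trans _ _ (80 * Num.sqrt (A (kappa * t)))).
    by rewrite ler_piMl ?mulr_ge0 ?sqrtr_ge0.
  rewrite -mulrA ler_pM2l// (le_trans h3)// ler_wpM2l ?sqrtr_ge0//.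
  by rewrite ler_peMl ?sqrtr_ge0.
have -> : coupled_motion X kappa t w = integrated_process kappa X t w -
  (integrated_process kappa X t w - coupled_motion X kappa t w) by rewrite opprB addrC subrK.
apply: le_trans (ler_normB _ _) _; lra.
Qed.

Lemma integrated_process_c0 :
  (fun t => if 0 <= t then integrated_process kappa X t w else 0) \in c0_pred R.
Proof.
apply: (@sublinear_c0_pred _ _ _ (integrated_process kappa X) w kappa (162 * Num.sqrt (Q + 7)))
  => //.
- exact: (continuous_integrated_process kappa cX).2.
- by rewrite /integrated_process mulr0 set_itv1 Rintegral_set1 mulr0.
- exact: integrated_process_bound.
Qed.

Lemma coupled_motion_c0 :
  (fun t => if 0 <= t then coupled_motion X kappa t w else 0) \in c0_pred R.
Proof.
apply: (@sublinear_c0_pred _ _ _ (coupled_motion X kappa) w kappa (242 * Num.sqrt (Q + 7))) => //.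
- exact: (continuous_coupled_motion cX kappa).2.
- by rewrite /coupled_motion /integrated_process mulr0 set_itv1 Rintegral_set1 mulr0 subrr mul0r
  mulr0 addr0.
- exact: coupled_motion_bound.
Qed.

Let L : R := ln (1 + kappa).

(** A lower bound uniform in kappa >= 1 lets additive constants be absorbed into multiples of the
    logarithm. *)
Lemma log_scale_ge : 4^-1 <= ln (1 + kappa) :> R.
Proof.
have kk := k1.
rewrite -ler_expR lnK ?posrE; last by lra.
apply: (@le_trans _ _ 2); last by lra.
have := expR_ge1Dx (- 4^-1 : R); rewrite expRN.
have e0 := expR_gt0 (4^-1 : R); set e := expR _ in e0 *.
move=> h; have : e * (1 + - 4^-1) <= e * e^-1 by rewrite ler_pM2l.
by rewrite divff ?gt_eqF//; lra.
Qed.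

Lemma envelope_log (y : R) : 0 <= y -> y <= 2 * (1 + kappa) ->
  Num.sqrt (A y) <= (2 * Q + 12) * Num.sqrt L.
Proof.
move=> y0 yk.
have [kk Q0'] := (k1, Q0); have L0 : 4^-1 <= L by exact: log_scale_ge.
set l := Num.sqrt L.
have l2 : l ^+ 2 = L by rewrite sqr_sqrtr//; lra.
have l1 : 2^-1 <= l.
  by apply: sqr_le_sqrt; lra.
rewrite -[leRHS]ger0_norm; last by rewrite mulr_ge0//; lra.
rewrite -sqrtr_sqr ler_wsqrtr// exprMn l2 /A.
have : ln (y + 2) <= 2 + L.
  apply: (@le_trans _ _ (ln (2 * 2 * (1 + kappa)))).
    by rewrite ler_ln ?posrE; lra.
  rewrite !lnM ?posrE; [have := ln2; rewrite -/L; lra|lra..].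
nra.
Qed.

(** As kappa t + 2 <= 2 (1 + kappa)(1 + t), the logarithm in the gap splits into L, a constant and
    at most t. The growth in t is absorbed by the weight 1 + t of the norm, so that sqrt L alone
    carries the dependence on kappa. *)
Lemma coupling_norm_bound :
  `|c0_path (integrated_process kappa X) w - c0_path (coupled_motion X kappa) w| <=
  Num.sqrt (L / kappa) * (80 * (2 * Q + 14)).
Proof.
have [kk Q0'] := (k1, Q0); have L0 : 4^-1 <= L by exact: log_scale_ge.
set l := Num.sqrt L.
have l2 : l ^+ 2 = L by rewrite sqr_sqrtr//; lra.
have l1 : 2^-1 <= l by apply: sqr_le_sqrt; lra.
rewrite sqrtrM; last by lra.
rewrite -/l sqrtrV; last by rewrite ltW.
apply: c0_norm_le => t t0; have t0' := ltW t0.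
rewrite [leLHS](_ : _ = `|c0_path (integrated_process kappa X) w t - c0_path (coupled_motion X
  kappa) w t|)//.
rewrite (c0_pathE integrated_process_c0)// (c0_pathE coupled_motion_c0)//.
apply: le_trans (coupling_gap t0') _.
have sA : Num.sqrt (A (kappa * t)) <= (2 * Q + 14) * l * (1 + t).
  have kt0 : 0 <= kappa * t by rewrite mulr_ge0// ltW.
  rewrite -[leRHS]ger0_norm; last by rewrite !mulr_ge0//; have := Q0; lra.
  rewrite -sqrtr_sqr ler_wsqrtr// !exprMn l2 /A.
  have lt : ln (kappa * t + 2) <= 2 + L + t.
    apply: (@le_trans _ _ (ln (2 * (1 + kappa) * (1 + t)))).
      by rewrite ler_ln ?posrE; nra.
    have [k1' t1'] : 0 < 1 + kappa /\ 0 < 1 + t by split; lra.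
    rewrite !lnM ?posrE ?mulr_gt0//.
    have := @le_ln1Dx R t; rewrite -/L; have := ln2; lra.
  have h1 : Q + 5 + 2 * L <= (2 * Q + 14) ^+ 2 * L by nra.
  have h2 : 1 + t <= (1 + t) ^+ 2 by nra.
  have h3 : (Q + 5 + 2 * L) * (1 + t) <= (2 * Q + 14) ^+ 2 * L * (1 + t) ^+ 2.
    by apply: ler_pM => //; lra.
  apply: le_trans h3; nra.
rewrite [leRHS](_ : _ = (Num.sqrt kappa)^-1 * (80 * ((2 * Q + 14) * l * (1 + t)))); last by ring.
by rewrite ler_wpM2l// ler_pM2l.
Qed.

End path_estimates.

(** The power 3/4 is weakened to 1 + kappa t <= (1 + kappa)(1 + t). The dependence on kappa is
    crude, but the bound serves only integrability. *)
Lemma c0_path_norm_le d (T : measurableType d) (R : realType) (Y : R -> T -> R) w (kappa K : R) :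
  (fun t => if 0 <= t then Y t w else 0) \in c0_pred R -> 0 < kappa -> 0 <= K ->
  (forall t, 0 <= t -> `|Y t w| <=
     K * (Num.sqrt (1 + kappa * t) * Num.sqrt (Num.sqrt (1 + kappa * t)))) ->
  `|c0_path Y w| <= K * (1 + kappa).
Proof.
move=> Yw k0 K0 YK; apply: c0_norm_le => t t0.
rewrite (c0_pathE Yw (ltW t0)) (le_trans (YK _ (ltW t0)))// -mulrA ler_wpM2l//.
have kt0 : 0 <= kappa * t by rewrite mulr_ge0// ltW.
set q := Num.sqrt _; have q1 : 1 <= q by rewrite -[leLHS]sqrtr1 ler_wsqrtr// lerDl.
apply: (@le_trans _ _ (q ^+ 2)); last by rewrite sqr_sqrtr; nra.
rewrite expr2 ler_wpM2l ?(le_trans ler01)//.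
rewrite -[leRHS]ger0_norm ?(le_trans ler01)// -sqrtr_sqr ler_wsqrtr//.
by rewrite expr2 ler_peMl// (le_trans ler01).
Qed.

(** * Integrals of Lipschitz functions against path laws *)

Section path_law_integrals.
Context d (T : measurableType d) (R : realType) (P : probability T R).
Variables (Y : R -> T -> R) (cY : continuous_process `[0, +oo[ Y).

Lemma measurable_path_comp (phi : C0 R -> R) (L : R) :
  (forall f g, `|phi f - phi g| <= L * `|f - g|) ->
  measurable_fun setT (fun w => phi (c0_path Y w)).
Proof.
move=> phiL; exact: (measurableT_comp (lipschitz_measurable phiL) (measurable_c0_path cY)).
Qed.

Lemma path_law_integral (phi : C0 R -> R) (L : R) :
  (forall f g, `|phi f - phi g| <= L * `|f - g|) ->
  P.-integrable setT (fun w => (phi (c0_path Y w))%:E) ->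
  (\int[path_law P cY]_f (phi f)%:E = \int[P]_w (phi (c0_path Y w))%:E)%E.
Proof.
move=> phiL iphi; rewrite /path_law.
apply: (@integral_distribution _ _ T (borel (C0 R)) R P (path_rv cY) (EFin \o phi)) => //.
by apply/measurable_EFinP; exact: lipschitz_measurable phiL.
Qed.

Lemma ge0_path_law_integral (phi : C0 R -> R) (L : R) :
  (forall f g, `|phi f - phi g| <= L * `|f - g|) -> (forall f, 0 <= phi f) ->
  (\int[path_law P cY]_f (phi f)%:E = \int[P]_w (phi (c0_path Y w))%:E)%E.
Proof.
move=> phiL phi0; rewrite /path_law.
apply: (@ge0_integral_distribution _ _ T (borel (C0 R)) R P (path_rv cY) (EFin \o phi)) => //.
by apply/measurable_EFinP; exact: lipschitz_measurable phiL.
Qed.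

Lemma integrable_path_comp (phi : C0 R -> R) (M : T -> R) :
  (forall f g, `|phi f - phi g| <= `|f - g|) ->
  P.-integrable setT (EFin \o M) -> (forall w, 0 <= M w) ->
  {ae P, forall w, `|c0_path Y w| <= M w} ->
  P.-integrable setT (fun w => (phi (c0_path Y w))%:E).
Proof.
move=> phiL iM M0 YM.
have mphi : measurable_fun setT (fun w => phi (c0_path Y w)).
  by apply: (@measurable_path_comp phi 1) => f g; rewrite mul1r.
apply/integrableP; split; first exact/measurable_EFinP.
pose r := `|phi 0|.
have iM' : P.-integrable setT (EFin \o (fun w => r + M w)).
  rewrite (_ : _ \o _ = ((EFin \o cst r) \+ (EFin \o M))%E).
    by apply: integrableD => //; apply: bounded_measurable_integrable; exact:
      bounded_measurable_cst.
  by apply/funext => w.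
have [mM _] := integrableP _ _ _ iM'.
apply: (@le_lt_trans _ _ (\int[P]_w (r + M w)%:E)%E); last first.
  have /integrableP[_] := iM'; congr (_ < _)%E.
  by apply: eq_integral => w _; rewrite /= ger0_norm// addr_ge0 ?normr_ge0.
apply: ae_ge0_le_integral => //.
- by apply/measurable_EFinP; exact: measurableT_comp.
- by move=> w _; rewrite lee_fin addr_ge0 ?normr_ge0.
- have [N [mN PN sN]] := YM; exists N; split => // w /= nw; apply: sN => /= YMw; apply: nw => _.
  rewrite lee_fin -[phi (c0_path Y w)](subrK (phi 0)) (le_trans (ler_normD _ _))//.
  by rewrite /r addrC lerD2l (le_trans (phiL _ _))// subr0.
Qed.

End path_law_integrals.

(** * Expectations of affine functions of the envelope *)

Section affine_integrals.
Context d (T : measurableType d) (R : realType) (P : probability T R).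
Variables (f : T -> R) (f_int : P.-integrable setT (EFin \o f)).

Lemma integrable_affine (a b : R) : P.-integrable setT (EFin \o (fun w => a * (b + f w))).
Proof.
rewrite (_ : _ \o _ = (fun w => a%:E * ((EFin \o cst b) \+ (EFin \o f)) w)%E).
  apply: integrableZl => //; apply: integrableD => //.
  by apply: bounded_measurable_integrable; exact: bounded_measurable_cst.
by apply/funext => w.
Qed.

Lemma integral_affine (a b : R) :
  (\int[P]_w (a * (b + f w))%:E = (a * (b + \int[P]_w f w))%:E)%E.
Proof.
have ic : P.-integrable setT (EFin \o (cst b : T -> R)).
  by apply: bounded_measurable_integrable; exact: bounded_measurable_cst.
rewrite -[LHS]fineK; last exact: (integrable_fin_num measurableT (integrable_affine _ _)).
congr EFin; change (\int[P]_w (a * (b + f w)) = a * (b + \int[P]_w f w)).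
rewrite RintegralZl//; last by have := integrable_affine 1 b; under eq_fun do rewrite /= mul1r.
by rewrite RintegralD// Rintegral_cst//= probability_setT/= mulr1.
Qed.

End affine_integrals.

(** * The upper bound *)

Section coupling.
Context dX (TX : measurableType dX) (R : realType) (PX : probability TX R).
Variables (X : R -> TX -> R) (cX : continuous_process setT X) (hX : OU_process PX X).
Variables (Q : TX -> R) (Q0 : forall w, 0 <= Q w) (iQ : PX.-integrable setT (EFin \o Q)).
Hypothesis QX : {ae PX, forall w,
  (forall t, 0 <= t -> `|X t w| <= 80 * Num.sqrt (Q w + 1 + 2 * ln (t + 2))) /\
  (forall n : nat, coupled_motion X 1 n.+1%:R w ^+ 2 <=
     4 * n.+1%:R * (Q w + 2 * ln n.+2%:R))}.
Context dW (TW : measurableType dW) (PW : probability TW R).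
Variables (W : R -> TW -> R) (cW : continuous_process `[0, +oo[ W) (hW : brownian_motion PW W).
Variable kappa : R.
Hypothesis k1 : 1 <= kappa.

Let k0 : 0 < kappa. Proof. exact: lt_le_trans ltr01 k1. Qed.
Let cI := continuous_integrated_process kappa cX.
Let cB := continuous_coupled_motion cX kappa.

Let cosE (s : seq (R * R)) b : all (fun p => 0 <= p.2) s ->
  \int[PX]_w cos (lincomb (coupled_motion X kappa) s w + b) =
  \int[PW]_w cos (lincomb W s w + b).
Proof.
by move=> s0; rewrite (coupled_motion_cos cX hX b k0 s0) (brownian_cos cX hX cW hW b s0).
Qed.

Lemma brownian_path_law A : measurable A -> path_law PW cW A = path_law PX cB A.
Proof. by move=> mA; exact/esym/(path_law_unique cB cW cosE mA). Qed.

(** The sublinear growth proved for the noise on the space of X serves W through equality in law. *)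
Lemma brownian_path_eval t : 0 <= t -> {ae PW, forall w, c0_path W w t = W t w}.
Proof.
move=> t0; apply: (c0_path_eval_transfer cB cW cosE t0).
have [N [mN PN sN]] := QX; exists N; split => // w /= nw; apply: sN => /= -[XQ BQ]; apply: nw.
by apply: c0_pathE => //; exact: (coupled_motion_c0 cX (Q0 w) XQ BQ k1).
Qed.

Let sqrt_le_self (a : R) : 1 <= a -> Num.sqrt a <= a.
Proof.
move=> a1; rewrite -[leRHS]ger0_norm ?(le_trans ler01)// -sqrtr_sqr ler_wsqrtr//.
by rewrite expr2 ler_peMl// (le_trans ler01).
Qed.

Let integrable_envelope Y (cY : continuous_process `[0, +oo[ Y) (K : R) (phi : C0 R -> R) :
  0 <= K -> (forall f g, `|phi f - phi g| <= `|f - g|) ->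
  {ae PX, forall w, (fun t => if 0 <= t then Y t w else 0) \in c0_pred R /\
    forall t, 0 <= t -> `|Y t w| <= K * Num.sqrt (Q w + 7) *
      (Num.sqrt (1 + kappa * t) * Num.sqrt (Num.sqrt (1 + kappa * t)))} ->
  PX.-integrable setT (fun w => (phi (c0_path Y w))%:E).
Proof.
move=> K0 phiL YK; have kk0 : 0 <= K * (1 + kappa) by rewrite mulr_ge0// addr_ge0// ltW.
have M0 w : 0 <= (K * (1 + kappa)) * (7 + Q w) by rewrite mulr_ge0// addr_ge0.
apply: (integrable_path_comp cY phiL (integrable_affine iQ (K * (1 + kappa)) 7)) => //.
have [N [mN PN sN]] := YK; exists N; split => // w /= nw; apply: sN => /= -[cw Yw]; apply: nw.
have K0' : 0 <= K * Num.sqrt (Q w + 7) by rewrite mulr_ge0 ?sqrtr_ge0.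
apply: (le_trans (c0_path_norm_le cw k0 K0' Yw)).
by rewrite mulrAC ler_wpM2l// addrC sqrt_le_self//; have := Q0 w; lra.
Qed.

Lemma integrable_integrated_path (phi : C0 R -> R) :
  (forall f g, `|phi f - phi g| <= `|f - g|) ->
  PX.-integrable setT (fun w => (phi (c0_path (integrated_process kappa X) w))%:E).
Proof.
move=> phiL; apply: (integrable_envelope cI (ler0n _ 162) phiL).
have [N [mN PN sN]] := QX; exists N; split => // w /= nw; apply: sN => /= -[XQ BQ]; apply: nw.
by split; [exact: (integrated_process_c0 cX (Q0 w) XQ BQ k1)
          |exact: (integrated_process_bound cX (Q0 w) XQ BQ k1)].
Qed.

Lemma integrable_coupled_path (phi : C0 R -> R) :
  (forall f g, `|phi f - phi g| <= `|f - g|) ->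
  PX.-integrable setT (fun w => (phi (c0_path (coupled_motion X kappa) w))%:E).
Proof.
move=> phiL; apply: (integrable_envelope cB (ler0n _ 242) phiL).
have [N [mN PN sN]] := QX; exists N; split => // w /= nw; apply: sN => /= -[XQ BQ]; apply: nw.
by split; [exact: (coupled_motion_c0 cX (Q0 w) XQ BQ k1)
          |exact: (coupled_motion_bound cX (Q0 w) XQ BQ k1)].
Qed.

Lemma wasserstein1_le_coupling :
  (wasserstein1 (path_law PX cI) (path_law PW cW) <=
   (160 * (7 + \int[PX]_w Q w) * Num.sqrt (ln (1 + kappa) / kappa))%:E)%E.
Proof.
apply: ub_ereal_sup => _ [phi phiL <-].
have phiL1 (f g : C0 R) : `|phi f - phi g| <= 1 * `|f - g| by rewrite mul1r.
have iI := integrable_integrated_path phiL; have iB := integrable_coupled_path phiL.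
(* Once the law of W is exchanged for that of the noise, both integrals live on [PX] and can be
   subtracted pathwise. *)
have -> : (\int[path_law PW cW]_f (phi f)%:E =
    \int[PX]_w (phi (c0_path (coupled_motion X kappa) w))%:E)%E.
  rewrite -(path_law_integral _ phiL1 iB).
  by apply: eq_measure_integral => A mA _; exact: brownian_path_law.
rewrite (path_law_integral _ phiL1 iI) -integralB//.
set s := Num.sqrt _.
apply: (@le_trans _ _ (\int[PX]_w ((s * 160) * (7 + Q w))%:E)%E); last first.
  rewrite integral_affine// lee_fin.
  by rewrite [leRHS]mulrC mulrA.
have iD := integrableB measurableT iI iB.
have [mD _] := integrableP _ _ _ iD.
apply: le_trans (le_abse_integral _ measurableT mD) _.
have [mS _] := integrableP _ _ _ (integrable_affine iQ (s * 160) 7).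
apply: ae_ge0_le_integral.
- exact: measurableT.
- by move=> w _; exact: abse_ge0.
- by apply: measurableT_comp mD; exact: abse_measurable.
- by move=> w _; rewrite lee_fin mulr_ge0 ?mulr_ge0 ?sqrtr_ge0 ?ler0n// addr_ge0 ?ler0n.
- exact: mS.
have [N [mN PN sN]] := QX; exists N; split => // w /= nw; apply: sN => /= -[XQ BQ]; apply: nw => _.
rewrite lee_fin (le_trans (phiL _ _))//.
have := coupling_norm_bound cX (Q0 w) XQ BQ k1; rewrite -/s.
by move=> /le_trans; apply; rewrite -mulrA ler_wpM2l ?sqrtr_ge0//; have := Q0 w; lra.
Qed.

End coupling.

(** * The test function of the lower bound *)

Section grid_increments.
Context (R : realType).

Definition grid_increment n (f : C0 R) : R :=
  \big[Num.max/0]_(k < n) `|f (k.+1%:R / n%:R) - f (k%:R / n%:R)|.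

Lemma grid_increment_ge0 n f : 0 <= grid_increment n f.
Proof. exact: bigmax_ge_id. Qed.

Let grid_le1 n k : (k <= n)%N -> 0 <= (k%:R / n%:R : R) <= 1.
Proof.
case: n => [|n]; first by rewrite leqn0 => /eqP ->; rewrite mul0r lexx ler01.
by move=> kn; rewrite divr_ge0// ler_pdivrMr ?ltr0n// mul1r ler_nat.
Qed.

(** The grid lies in [0, 1], where the weight 1 + t is at most 2, and each increment involves two of
    its points. *)
Lemma grid_increment_lipschitz n f g :
  `|grid_increment n f - grid_increment n g| <= 4 * `|f - g|.
Proof.
have half (f1 f2 : C0 R) : grid_increment n f1 <= grid_increment n f2 + 4 * `|f1 - f2|.
  apply: bigmax_le => [|k _]; first by rewrite addr_ge0 ?mulr_ge0 ?grid_increment_ge0.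
  have ev t : (0 : R) <= t <= 1 -> `|f1 t - f2 t| <= 2 * `|f1 - f2|.
    move=> /andP[t0 t1]; have : `|(f1 - f2 : C0 R) t| <= `|f1 - f2| * (1 + `|t|) := c0_norm_ub _ _.
    rewrite [`|(_ : C0 R) t|](_ : _ = `|f1 t - f2 t|)// => /le_trans; apply.
    by rewrite [2 * _]mulrC ler_wpM2l// ger0_norm//; lra.
  have := ev _ (grid_le1 (ltn_ord k)); have := ev _ (grid_le1 (ltnW (ltn_ord k))).
  set a := k.+1%:R / _; set b := k%:R / _ => hb ha.
  have hg : `|f2 a - f2 b| <= grid_increment n f2.
    exact: (le_bigmax 0 (fun k : 'I_n => `|f2 (k.+1%:R / n%:R) - f2 (k%:R / n%:R)|) k).
  rewrite (_ : f1 a - f1 b = (f2 a - f2 b) + ((f1 a - f2 a) - (f1 b - f2 b))); last by ring.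
  apply: le_trans (ler_normD _ _) _; apply: lerD => //.
  by apply: le_trans (ler_normB _ _) _; lra.
rewrite ler_norml; have := half f g; have := half g f; rewrite (distrC g f).
by move=> h1 h2; apply/andP; split; lra.
Qed.

End grid_increments.

(** * Numerical inequalities for the Gaussian maximum *)

Section numeric_facts.
Context (R : realType).

Lemma expRN1_le_half : expR (- 1) <= 2^-1 :> R.
Proof.
by rewrite expRN lef_pV2 ?posrE ?expR_gt0//; have := expR_ge1Dx (1 : R); lra.
Qed.

Lemma expr_1BV_le_half n : (0 < n)%N -> (1 - n%:R^-1) ^+ n <= 2^-1 :> R.
Proof.
move=> n0; have n0' : 0 < n%:R :> R by rewrite ltr0n.
apply: le_trans expRN1_le_half.
rewrite (_ : - 1 = n%:R * - n%:R^-1 :> R); last by rewrite mulrN mulfV// gt_eqF.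
rewrite expRM_natl lerXn2r ?nnegrE ?expR_ge0//; last exact: expR_ge1Dx.
by rewrite subr_ge0 invf_le1// ler1n.
Qed.

Lemma ln2_ge_half : 2^-1 <= ln 2 :> R.
Proof.
rewrite -ler_expR lnK ?posrE//.
have := expR_ge1Dx (- 2^-1 : R); rewrite expRN.
have e0 := expR_gt0 (2^-1 : R); set e := expR _ in e0 *.
move=> h; have : e * (1 + - 2^-1) <= e * e^-1 by rewrite ler_pM2l.
by rewrite divff ?gt_eqF//; lra.
Qed.

(** The level is y standard deviations with y^2 = (ln n) / 2, so the exponent (y + 1)^2 / 2 in the
    tail bound is about (ln n) / 4. For ln n >= 6 the room left up to ln n absorbs the linear term
    and the factor 4. *)
Lemma gaussian_tail_ge_inv n : 6 <= ln n%:R :> R ->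
  ((n%:R^-1)%:E <= gaussian_law 0 (n%:R^-1 : R)
     `[(Num.sqrt n%:R^-1 * Num.sqrt (ln n%:R / 2))%R, +oo[)%E.
Proof.
move=> n6; have n0 : 0 < n%:R :> R.
  by rewrite ltNge; apply/negP => h; move: n6; rewrite ln0//; lra.
rewrite /gaussian_law invr_eq0 (gt_eqF n0).
apply: le_trans (normal_prob_tail _ _); rewrite ?invr_gt0 ?sqrtr_ge0//.
set y := Num.sqrt _; have y0 : 0 <= y by exact: sqrtr_ge0.
have y2 : y ^+ 2 = ln n%:R / 2 by rewrite sqr_sqrtr//; lra.
rewrite lee_fin ler_pdivlMr//.
have -> : 4 = expR (2 * ln 2) :> R.
  by rewrite mulr2n mulrDl !mul1r expRD lnK ?posrE//; lra.
have -> : n%:R^-1 = expR (- ln n%:R) :> R by rewrite expRN lnK.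
rewrite -expRD ler_expR.
have : ln 2 <= 1 :> R.
  by have := @le_ln1Dx R 1; rewrite (_ : 1 + 1 = 2 :> R)//; apply; lra.
nra.
Qed.

End numeric_facts.

(** * The largest increment of Brownian motion on a grid *)

Section brownian_grid.
Context d (T : measurableType d) (R : realType) (P : probability T R).
Variables (W : R -> T -> R) (cW : continuous_process `[0, +oo[ W) (hW : brownian_motion P W).
Variable n : nat.
Hypothesis n6 : 6 <= ln n%:R :> R.

Let n0 : 0 < n%:R :> R.
Proof. by rewrite ltNge; apply/negP => h; move: n6; rewrite ln0//; lra. Qed.

Let x : R := Num.sqrt n%:R^-1 * Num.sqrt (ln n%:R / 2).

Let x0 : 0 <= x. Proof. by rewrite mulr_ge0// sqrtr_ge0. Qed.

Let D (i : nat) := W (i.+1%:R / n%:R) \- W (i%:R / n%:R).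

Let grid0 i : (0 : R) <= i%:R / n%:R. Proof. by rewrite divr_ge0. Qed.

Let mD i : measurable_fun setT (D i).
Proof. by apply: measurable_funB; apply: cW.1; rewrite /= in_itv/= grid0. Qed.

Let small i := [set w | D i w < x].

Let msmall i : measurable (small i).
Proof.
rewrite (_ : small i = setT `&` D i @^-1` `]-oo, x[).
  by apply: mD => //; exact: measurable_itv.
by rewrite setTI; apply/seteqP; split => w; rewrite /= in_itv.
Qed.

Let Psmall i : fine (P (small i)) <= 1 - n%:R^-1.
Proof.
have [_ incr _] := hW.
have ss : 0 <= (i%:R / n%:R : R) <= i.+1%:R / n%:R.
  by rewrite grid0 ler_pM2r ?invr_gt0// ler_nat leqnSn.
have := incr _ _ ss `[x, +oo[%classic (measurable_itv _).
rewrite -mulrBl -natrB// subSnn mul1r => Plarge.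
have := gaussian_tail_ge_inv n6; rewrite -/x -Plarge.
have -> : D i @^-1` `[x, +oo[%classic = ~` small i.
  by apply/seteqP; split => w; rewrite /small /= in_itv/= andbT leNgt => /negP.
rewrite probability_setC//.
rewrite -[X in (_ <= 1 - X)%E]fineK ?fin_num_measure// -EFinB lee_fin; lra.
Qed.

(** Each of n independent increments exceeds the level with probability at least 1/n, so that all
    stay below it with probability at most (1 - 1/n)^n <= 1/e <= 1/2. *)
Lemma brownian_grid_small : (P (\bigcap_(i in `I_n) small i) <= 2^-1%:E)%E.
Proof.
have [_ _ ind] := hW.
have t0 : (0 : R) <= 0%:R / n%:R by [].
have ti i : (i%:R / n%:R : R) <= i.+1%:R / n%:R by rewrite ler_pM2r ?invr_gt0// ler_nat leqnSn.
have := ind n (fun i => i%:R / n%:R) t0 ti (fun=> `]-oo, x[%classic) (fun=> measurable_itv _).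
rewrite (_ : [set w | _] = \bigcap_(i in `I_n) small i); last first.
  apply/seteqP; split => w /= h i; first by move=> /= iN; have := h (Ordinal iN); rewrite in_itv.
  by rewrite in_itv/=; exact: (h i (ltn_ord i)).
move=> ->; rewrite lee_fin.
apply: (@le_trans _ _ (\prod_(i < n) (1 - n%:R^-1))).
  apply: ler_prod => i _; rewrite fine_ge0//=.
  by have := Psmall i; rewrite /small (_ : D i @^-1` _ = [set w | D i w < x])//;
    apply/seteqP; split => w; rewrite /= in_itv.
rewrite prodr_const card_ord; apply: expr_1BV_le_half.
by rewrite -(ltr_nat R).
Qed.

Hypothesis cE : forall t, 0 <= t -> {ae P, forall w, c0_path W w t = W t w}.

Lemma brownian_grid_increment :
  ((x / 2)%:E <= \int[P]_w (grid_increment n (c0_path W w))%:E)%E.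
Proof.
set G := \bigcap_(i in `I_n) small i.
have mG : measurable G by apply: bigcap_measurableType => i _; exact: msmall.
apply: (@le_trans _ _ (\int[P]_w (x * \1_(~` G) w)%:E)%E).
  rewrite (integralZl_indic measurableT (fun=> ~` G)); last 2 first.
  - by move=> x1; move: x0; rewrite leNgt x1.
  - exact: measurableC.
  rewrite integral_indic//; last exact: measurableC.
  rewrite setIT [X in (_ <= _ * X)%E](_ : _ = 1 - P G)%E; last exact: probability_setC.
  have := brownian_grid_small; rewrite -/G.
  rewrite -[P G]fineK ?fin_num_measure// -EFinB -EFinM !lee_fin => PG.
  by rewrite ler_wpM2l//; lra.
apply: ae_ge0_le_integral => //.
- by move=> w _; rewrite lee_fin mulr_ge0.
- apply/measurable_EFinP; apply: measurable_funM => //.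
  by apply: measurable_indic; exact: measurableC.
- by move=> w _; rewrite lee_fin grid_increment_ge0.
- by apply/measurable_EFinP; exact: (measurable_path_comp cW (@grid_increment_lipschitz R n)).
(* There are countably many grid points, so one null set serves them all. *)
- have : {ae P, forall w, forall i : nat, c0_path W w (i%:R / n%:R) = W (i%:R / n%:R) w}.
    by apply: ae_foralln => i; apply: cE.
  move=> [N [mN PN sN]]; exists N; split => // w /= nw; apply: sN => /= ww; apply: nw => _.
  rewrite lee_fin indicE in_setC.
  have [wG|wG] := boolP (w \in G); first by rewrite mulr0 grid_increment_ge0.
  rewrite mulr1; move: wG; rewrite notin_setE => /existsNP[i /not_implyP[/= iN /negP]].
  rewrite -leNgt /D/= => xi; apply: le_trans xi _.
  rewrite -!ww (le_trans (ler_norm _))//.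
  exact: (le_bigmax 0 (fun k : 'I_n => `|c0_path W w (k.+1%:R / n%:R) - c0_path W w (k%:R /
    n%:R)|) (Ordinal iN)).
Qed.

End brownian_grid.

Lemma grid_increment_path_law d (T : measurableType d) (R : realType) (P : probability T R)
    (Y : R -> T -> R) (cY : continuous_process `[0, +oo[ Y) n :
  (\int[path_law P cY]_f (grid_increment n f / 4)%:E =
   4^-1%:E * \int[P]_w (grid_increment n (c0_path Y w))%:E)%E.
Proof.
have phiL (f g : C0 R) : `|grid_increment n f / 4 - grid_increment n g / 4| <= 1 * `|f - g|.
  by rewrite -mulrBl normrM [`|4^-1|]ger0_norm// mul1r ler_pdivrMr// mulrC grid_increment_lipschitz.
rewrite (ge0_path_law_integral _ _ phiL); last by move=> f; rewrite divr_ge0 ?grid_increment_ge0.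
rewrite -ge0_integralZl_EFin//.
- by apply: eq_integral => w _; rewrite mulrC EFinM.
- by move=> w _; rewrite lee_fin grid_increment_ge0.
- by apply/measurable_EFinP; exact: (measurable_path_comp cY (@grid_increment_lipschitz R n)).
Qed.

(** * The lower bound *)

Section lower_bound.
Context dX (TX : measurableType dX) (R : realType) (PX : probability TX R).
Variables (X : R -> TX -> R) (cX : continuous_process setT X) (hX : OU_process PX X).
Variables (Q : TX -> R) (Q0 : forall w, 0 <= Q w) (iQ : PX.-integrable setT (EFin \o Q)).
Hypothesis QX : {ae PX, forall w,
  (forall t, 0 <= t -> `|X t w| <= 80 * Num.sqrt (Q w + 1 + 2 * ln (t + 2))) /\
  (forall n : nat, coupled_motion X 1 n.+1%:R w ^+ 2 <=
     4 * n.+1%:R * (Q w + 2 * ln n.+2%:R))}.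
Variable kappa : R.
Hypothesis k1 : 1 <= kappa.

Let k0 : 0 < kappa. Proof. exact: lt_le_trans ltr01 k1. Qed.
Let cI := continuous_integrated_process kappa cX.
Let L := ln (1 + kappa).

Lemma integrated_grid_increment n w : (0 < n)%N ->
  (forall t, 0 <= t -> `|X t w| <= 80 * Num.sqrt (Q w + 1 + 2 * ln (t + 2))) ->
  (forall n : nat, coupled_motion X 1 n.+1%:R w ^+ 2 <=
     4 * n.+1%:R * (Q w + 2 * ln n.+2%:R)) ->
  grid_increment n (c0_path (integrated_process kappa X) w) <=
  Num.sqrt kappa / n%:R * (160 * Num.sqrt L) * (6 + Q w).
Proof.
move=> n0 XQ BQ; have n0' : 0 < n%:R :> R by rewrite ltr0n.
have sk : Num.sqrt kappa ^+ 2 = kappa by rewrite sqr_sqrtr// ltW.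
have sk0 : 0 < Num.sqrt kappa by rewrite sqrtr_gt0.
have RHS0 : 0 <= Num.sqrt kappa / n%:R * (160 * Num.sqrt L) * (6 + Q w).
  by rewrite mulr_ge0 ?addr_ge0 ?ler0n// mulr_ge0 ?divr_ge0 ?sqrtr_ge0 ?ler0n// mulr_ge0
    ?sqrtr_ge0 ?ler0n.
apply: bigmax_le => // k _.
have ab : 0 <= (k%:R / n%:R : R) <= k.+1%:R / n%:R.
  by rewrite divr_ge0 ?ler0n// ler_pM2r ?invr_gt0// ler_nat leqnSn.
have b1 : k.+1%:R / n%:R <= 1 :> R by rewrite ler_pdivrMr// mul1r ler_nat.
have cw := integrated_process_c0 cX (Q0 w) XQ BQ k1.
rewrite !(c0_pathE cw) ?divr_ge0 ?ler0n//.
rewrite /integrated_process -mulrBr normrM ger0_norm ?invr_ge0 ?sqrtr_ge0//.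
have E := envelope_log (Q0 w) k1 (ltW k0); rewrite -/L in E.
have {}E : Num.sqrt (Q w + 1 + 2 * ln (kappa + 2)) <= (2 * Q w + 12) * Num.sqrt L.
  by apply: E; move: k1; lra.
have kab : 0 <= kappa * (k%:R / n%:R) <= kappa * (k.+1%:R / n%:R).
  by move: ab => /andP[a0 ab]; rewrite mulr_ge0 ?(ltW k0)//= ler_pM2l.
have fe s : kappa * (k%:R / n%:R) <= s <= kappa * (k.+1%:R / n%:R) ->
    `|X s w - 0| <= 80 * ((2 * Q w + 12) * Num.sqrt L).
  move: kab => /andP[kab0 _] /andP[ss sk'].
  have s0 : 0 <= s by exact: le_trans ss.
  have sk1 : s <= kappa by rewrite (le_trans sk')// ler_piMr// ltW.
  rewrite subr0 (le_trans (XQ _ s0))// ler_pM2l// (le_trans _ E)// ler_wsqrtr//.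
  rewrite lerD2l ler_pM2l// ler_ln ?posrE ?lerD2r//; last by move: k0; lra.
  by move: s0; lra.
have := Rintegral_increment_le (OU_continuous cX (w := w)) kab fe.
rewrite mul0r subr0 -mulrBr -mulrBl -natrB// subSnn => H.
have ski : 0 <= (Num.sqrt kappa)^-1 by rewrite invr_ge0 ltW.
apply: le_trans (ler_wpM2l ski H) _.
rewrite le_eqVlt; apply/orP; left; apply/eqP.
rewrite -[in X in _ * (_ * (X * _))]sk; field.
by rewrite !gt_eqF.
Qed.

Lemma integrated_grid_increment_expectation n : (0 < n)%N ->
  (\int[PX]_w (grid_increment n (c0_path (integrated_process kappa X) w))%:E <=
   (Num.sqrt kappa / n%:R * (160 * Num.sqrt L) * (6 + \int[PX]_w Q w))%:E)%E.
Proof.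
move=> n0; set c := _ * (160 * _).
have c0 : 0 <= c by rewrite mulr_ge0 ?divr_ge0 ?mulr_ge0 ?sqrtr_ge0 ?ler0n.
rewrite -integral_affine//.
have [mS _] := integrableP _ _ _ (integrable_affine iQ c 6).
apply: ae_ge0_le_integral => //.
- by move=> w _; rewrite lee_fin grid_increment_ge0.
- by apply/measurable_EFinP; exact: (measurable_path_comp cI (@grid_increment_lipschitz R n)).
- by move=> w _; rewrite lee_fin mulr_ge0// addr_ge0 ?ler0n.
- have [N [mN PN sN]] := QX; exists N; split => // w /= nw; apply: sN => /= -[XQ BQ].
  by apply: nw => _; rewrite lee_fin; exact: integrated_grid_increment.
Qed.

Context dW (TW : measurableType dW) (PW : probability TW R).
Variables (W : R -> TW -> R) (cW : continuous_process `[0, +oo[ W) (hW : brownian_motion PW W).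

Lemma wasserstein1_ge_grid (M : nat) : (64 <= M)%N ->
  1280 * (6 + \int[PX]_w Q w) <= M%:R ->
  (((32 * M%:R)^-1 * Num.sqrt (L / kappa))%:E <=
   wasserstein1 (path_law PX cI) (path_law PW cW))%E.
Proof.
move=> M64 MQ; have M0 : 0 < M%:R :> R by rewrite ltr0n (leq_trans _ M64).
(* [N] is an integer between kappa and 2 kappa, so n lies between M^2 kappa and 2 M^2 kappa. *)
pose N := (Num.truncn kappa).+1; pose n := (M ^ 2 * N)%N.
have nE : n%:R = M%:R ^+ 2 * N%:R :> R by rewrite natrM natrX.
have /andP[kN' kN] : (Num.truncn kappa)%:R <= kappa < N%:R by rewrite truncn_itv// ltW.
have N2 : N%:R <= 2 * kappa by rewrite /N -[_.+1%:R]natr1; move: k1; lra.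
have n0 : 0 < n%:R :> R by rewrite nE mulr_gt0 ?exprn_gt0// (lt_trans k0).
have sk : Num.sqrt kappa ^+ 2 = kappa by rewrite sqr_sqrtr// ltW.
have sk0 : 0 < Num.sqrt kappa by rewrite sqrtr_gt0.
have L0 : 0 <= L by apply: le_trans (log_scale_ge k1); rewrite invr_ge0.
(* This is where 64 = 2^6 enters: n >= 2^12 and ln 2 >= 1/2 give the bound ln n >= 6 required by the
   tail estimate. *)
have M2 : (2 : R) ^+ 12 <= M%:R ^+ 2.
  by rewrite (exprM _ 6 2) lerXn2r ?nnegrE ?exprn_ge0 ?ler0n// -natrX ler_nat.
have nM : M%:R ^+ 2 <= n%:R :> R by rewrite nE ler_peMr ?exprn_ge0 ?ler0n// ler1n.
have nL : L <= ln n%:R.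
  rewrite ler_ln ?posrE//; last by move: k1; lra.
  have : 2 <= M%:R ^+ 2 :> R by apply: le_trans M2; rewrite -[leLHS]expr1 ler_weXn2l// ler1n.
  rewrite nE => h; have : 2 * N%:R <= M%:R ^+ 2 * N%:R :> R by rewrite ler_wpM2r.
  by move: k1 kN; lra.
have n6 : 6 <= ln n%:R :> R.
  apply: (@le_trans _ _ (ln (2 ^+ 12))); last by rewrite ler_ln ?posrE ?exprn_gt0// (le_trans M2).
  by rewrite lnXn// -[ln 2 *+ _]mulr_natl; have := ln2_ge_half R; lra.
set s := Num.sqrt (L / kappa).
have sE : s = Num.sqrt L / Num.sqrt kappa by rewrite /s sqrtrM// sqrtrV// ltW.
have phiL (f g : C0 R) : `|grid_increment n f / 4 - grid_increment n g / 4| <= 1 * `|f - g|.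
  by rewrite -mulrBl normrM [`|4^-1|]ger0_norm// mul1r ler_pdivrMr// mulrC grid_increment_lipschitz.
have phi0 (f : C0 R) : 0 <= grid_increment n f / 4 by rewrite divr_ge0 ?grid_increment_ge0.
set I1 := (\int[path_law PX cI]_f (grid_increment n f / 4)%:E)%E.
set I0 := (\int[path_law PW cW]_f (grid_increment n f / 4)%:E)%E.
have I1_ge0 : (0 <= I1)%E by apply: integral_ge0 => f _; rewrite lee_fin.
(* With q = 6 + E Q and n >= M^2 kappa the expectation is at most (160/4) q s / M^2, which is at
   most s / (32 M) exactly when 1280 q <= M. *)
have I1_le : (I1 <= (s / (32 * M%:R))%:E)%E.
  have n0' : (0 < n)%N by rewrite -(ltr_nat R).
  rewrite /I1 grid_increment_path_law.
  apply: le_trans (lee_wpmul2l _ (integrated_grid_increment_expectation n0')) _; first by rewrite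
    lee_fin.
  rewrite -EFinM lee_fin sE.
  set q := 6 + _ in MQ *.
  have -> : 4^-1 * (Num.sqrt kappa / n%:R * (160 * Num.sqrt L) * q) =
      Num.sqrt L * (Num.sqrt kappa * (1280 * q) / (32 * n%:R)).
    by field; rewrite gt_eqF.
  have -> : Num.sqrt L / Num.sqrt kappa / (32 * M%:R) =
      Num.sqrt L * (M%:R ^+ 2 * Num.sqrt kappa ^+ 2 / (32 * M%:R * Num.sqrt kappa * M%:R ^+ 2 *
        Num.sqrt kappa ^+ 2)).
    by field; rewrite !gt_eqF.
  rewrite ler_wpM2l ?sqrtr_ge0//.
  apply: (@le_trans _ _ (Num.sqrt kappa * M%:R / (32 * (M%:R ^+ 2 * Num.sqrt kappa ^+ 2)))).
    apply: ler_pM; rewrite ?invr_ge0 ?mulr_ge0 ?sqrtr_ge0 ?ler0n//.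
    - by rewrite addr_ge0 ?ler0n//; apply: Rintegral_ge0 => w _; exact: Q0.
    - by rewrite ler_wpM2l ?sqrtr_ge0.
    rewrite lef_pV2 ?posrE ?mulr_gt0 ?exprn_gt0// ler_pM2l// sk nE ler_pM2l ?exprn_gt0//.
    exact: ltW.
  rewrite le_eqVlt; apply/orP; left; apply/eqP; field.
  by rewrite !gt_eqF.
(* The level x satisfies x^2 = ln n / (2n) >= L / (4 M^2 kappa), so x >= s / (2 M); the factor 1/2
   of the expected maximum and the 1/4 of the test function give 16. *)
have I0_ge : ((s / (16 * M%:R))%:E <= I0)%E.
  rewrite /I0 grid_increment_path_law.
  apply: (le_trans _ (lee_wpmul2l _ (brownian_grid_increment cW hW n6
    (brownian_path_eval cX hX Q0 QX cW hW k1)))); last by rewrite lee_fin.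
  rewrite -EFinM lee_fin.
  have : s / (2 * M%:R) <= Num.sqrt n%:R^-1 * Num.sqrt (ln n%:R / 2).
    rewrite -sqrtrM ?invr_ge0 ?ler0n//; apply: sqr_le_sqrt.
      by rewrite divr_ge0 ?sqrtr_ge0// mulr_ge0 ?ler0n.
    rewrite expr_div_n sqr_sqrtr ?divr_ge0 ?(ltW k0)//.
    have nk : n%:R <= 2 * M%:R ^+ 2 * kappa.
      rewrite nE [leRHS](_ : _ = M%:R ^+ 2 * (2 * kappa)); last by ring.
      by rewrite ler_wpM2l ?exprn_ge0 ?ler0n.
    have -> : L / kappa / (2 * M%:R) ^+ 2 = (2 * M%:R ^+ 2 * kappa)^-1 * (L / 2).
      by field; rewrite !gt_eqF.
    apply: ler_pM; rewrite ?invr_ge0 ?mulr_ge0 ?exprn_ge0 ?ler0n ?(ltW k0)//.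
      by rewrite lef_pV2 ?posrE ?mulr_gt0 ?exprn_gt0.
    by rewrite ler_pM2r.
  have -> : s / (16 * M%:R) = 4^-1 * (s / (2 * M%:R) / 2) by field; rewrite gt_eqF.
  by move=> h; rewrite ler_pM2l// ler_pM2r.
apply: (@le_trans _ _ `|I1 - I0|%E); last first.
  apply: ereal_sup_ubound; exists (fun f => grid_increment n f / 4) => //= f g.
  by rewrite -[leRHS]mul1r.
have -> : (32 * M%:R)^-1 * s = s / (16 * M%:R) - s / (32 * M%:R).
  by field; rewrite gt_eqF.
(* [I0] has only been bounded below; if it is infinite, the gap is infinite and the inequality is
   immediate. *)
move: I1_ge0 I1_le I0_ge; case: I1 => [r1| |]; case: I0 => [r0| |]//=; last by move=> *; exact:
  leey.
rewrite !lee_fin => _ h1 h0; rewrite distrC (le_trans _ (ler_norm _))//; lra.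
Qed.

End lower_bound.

Theorem theorem2p2 (R : realType)
    (dX : measure_display) (TX : measurableType dX) (PX : probability TX R)
    (X : R -> TX -> R) (cX : continuous_process setT X) (hX : OU_process PX X) :
  exists c C : R, [/\ 0 < c, 0 < C &
    forall (dW : measure_display) (TW : measurableType dW) (PW : probability TW R)
      (W : R -> TW -> R) (cW : continuous_process `[0, +oo[ W)
      (hW : brownian_motion PW W) (kappa : R), 1 <= kappa ->
    let mu_0 := path_law PW cW in
    let mu_kappa := path_law PX (continuous_integrated_process kappa cX) in
    ((c * Num.sqrt (ln (1 + kappa) / kappa))%:E <= wasserstein1 mu_kappa mu_0
      <= (C * Num.sqrt (ln (1 + kappa) / kappa))%:E)%E].
Proof.
have [Q [Q0 iQ QX]] := OU_path_envelope cX hX.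
have EQ0 : 0 <= \int[PX]_w Q w by apply: Rintegral_ge0 => w _; exact: Q0.
(* [M] depends only on the expectation of [Q], so it can be fixed before [W] and kappa are given. *)
pose M := (64 + (Num.truncn (1280 * (6 + \int[PX]_w Q w)))).+1.
have M64 : (64 <= M)%N by rewrite /M -addSn (leq_trans _ (leq_addr _ _)).
have MQ : 1280 * (6 + \int[PX]_w Q w) <= M%:R.
  by rewrite (le_trans (ltW (truncnS_gt _)))// ler_nat ltnS leq_addl.
exists (32 * M%:R)^-1, (160 * (7 + \int[PX]_w Q w)); split.
- by rewrite invr_gt0 mulr_gt0.
- by rewrite mulr_gt0// ltr_wpDr.
- move=> dW TW PW W cW hW kappa k1 /=; apply/andP; split.
    exact: wasserstein1_ge_grid.
  exact: wasserstein1_le_coupling.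
Qed.
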